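(* Let $T\subset\mathbb{R}^3$ be a polyhedron and $k\ge3$ an integer. For the linear operators $R_h^{(1)}$, $R_h^{(2)}$ and the composite weak gradient $\nabla_w: W_k^{(1)}(T)\to W_{k-1}^{(2)}(T)$, $$\nabla_w(R_h^{(1)}v)=R_h^{(2)}\nabla v\qquad\forall v\in H^1(T)\cap C^1(T).$$
   Context: Geometry and notation. $T\subset\mathbb{R}^3$ is a (closed, bounded) polyhedron with flat polygonal faces, each edge being shared by exactly two faces; functions in $C(T)$, $C^1(T)$ are continuous (resp. continuously differentiable) on the closed region $T$. $F(T)$, $E(T)$, $V(T)$ are its sets of faces, edges and vertices. $P_j(D)$ is the space of polynomials of total degree at most $j$ on $D$. $(\cdot,\cdot)_D$ is the $L^2$ inner product on $D$ (volume, surface or curve; for the two end points $\partial e$ of an edge it is the sum of values at the end points). $\mathbf{n}$ is the unit outward normal on $\partial T$. For a face $f$, $\mathbf{n}_f$ is a fixed unit normal, $\mathbf{t}_{f,1},\mathbf{t}_{f,2}$ are orthogonal unit vectors tangential to $f$, and $\mathbf{t}_{\partial f}$ is the unit tangent on $\partial f$ oriented by the right-hand rule with respect to $\mathbf{n}_f$. For an edge $e$, $\mathbf{t}_e$ is a fixed unit tangent vector and $\mathbf{n}_{\partial e}$ is the unit outward direction (along the edge) at its two end points. Spaces. - $W_{k-1,0}^{(2)}(T)=[P_{k-1}(T)]^3$, $W_{k-2,f}^{(2)}(f)=\{u_1\mathbf{t}_{f,1}+u_2\mathbf{t}_{f,2}: u_1,u_2\in P_{k-2}(f)\}$, $W_{k-3,e}^{(2)}(e)=\{u\mathbf{t}_e: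 u\in P_{k-3}(e)\}$. - $W_k^{(1)}(T)=\{v=\{v_0,v_f,v_e,v_n\}: v_0\in P_k(T), v_f\in P_{k-1}(f), v_e\in P_{k-2}(e), v_n\in\mathbb{R}, f\in F(T), e\in E(T), n\in V(T)\}$. - $W_{k-1}^{(2)}(T)=\{\mathbf{u}=\{\mathbf{u}_0,\mathbf{u}_f,\mathbf{u}_e\}: \mathbf{u}_0\in W_{k-1,0}^{(2)}(T),\mathbf{u}_f\in W_{k-2,f}^{(2)}(f),\mathbf{u}_e\in W_{k-3,e}^{(2)}(e), f\in F(T), e\in E(T)\}$. Weak gradient. $\nabla_w v=\{\nabla_{w,0}v,\nabla_{w,f}v,\nabla_{w,e}v\}\in W_{k-1}^{(2)}(T)$ for $v\in W_k^{(1)}(T)$, with components determined by $$(\nabla_{w,0}v,\varphi)_T=-(v_0,\nabla\cdot\varphi)_T+(v_f,\varphi\cdot\mathbf{n})_{\partial T}\quad\forall\varphi\in W_{k-1,0}^{(2)}(T),$$ $$(\nabla_{w,f}v,\theta\times\mathbf{n}_f)_f=-(v_f,(\nabla\times\theta)\cdot\mathbf{n}_f)_f+(v_e,\theta\cdot\mathbf{t}_{\partial f})_{\partial f}\quad\forall\theta\in W_{k-2,f}^{(2)}(f),$$ $$(\nabla_{w,e}v,\varphi\mathbf{t}_e)_e=-(v_e,\nabla\varphi\cdot\mathbf{t}_e)_e+(v_n,\varphi\,\mathbf{t}_e\cdot\mathbf{n}_{\partial e})_{\partial e}\quad\forall\varphi\mathbf{t}_e\in W_{k-3,e}^{(2)}(e).$$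 Projections. For $v\in H^1(T)\cap C^1(T)$, $R_h^{(1)}v=\{R_0^{(1)}v,\,R_f^{(1)}(v|_f),\,R_e^{(1)}(v|_e),\,v|_n\}\in W_k^{(1)}(T)$, where $R_0^{(1)},R_f^{(1)},R_e^{(1)}$ are the $L^2$ projections onto $P_k(T),P_{k-1}(f),P_{k-2}(e)$ and $v|_n$ is the value at the vertex $n$. For $\mathbf{u}\in H(\mathrm{curl};T)\cap[C(T)]^3$, $R_h^{(2)}\mathbf{u}=\{R_0^{(2)}\mathbf{u},\,R_f^{(2)}(\mathbf{n}_f\times(\mathbf{u}|_f\times\mathbf{n}_f)),\,R_e^{(2)}((\mathbf{u}|_e\cdot\mathbf{t}_e)\mathbf{t}_e)\}\in W_{k-1}^{(2)}(T)$, where $R_0^{(2)},R_f^{(2)},R_e^{(2)}$ are the $L^2$ projections onto $W_{k-1,0}^{(2)}(T),W_{k-2,f}^{(2)}(f),W_{k-3,e}^{(2)}(e)$. *)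

(* Defs.v *)
From HB Require Import structures.
From mathcomp Require Import all_boot all_order all_algebra.
From mathcomp Require mpoly.

Set Implicit Arguments.
Unset Strict Implicit.
Unset Printing Implicit Defensive.

Import Order.TTheory GRing.Theory Num.Theory.

(* The notations of mpoly clash with those of the analysis library, so mpoly is
   imported only here. *)
Module Mpoly3.
Import mpoly.
Local Open Scope ring_scope.

Definition poly_fun (R : comNzRingType) (j : nat) (u : 'rV[R]_3 -> R) : Prop :=
  exists p : {mpoly R[3]}, (msize p <= j.+1)%N /\ forall x, u x = p.@[x 0].

Lemma poly_fun_zero (R : comNzRingType) (j : nat) :
  @poly_fun R j (fun=> 0).
Proof. by exists 0; split=> [|x]; rewrite ?msize0 ?meval0. Qed.

End Mpoly3.

From mathcomp Require Import all_classical all_reals all_analysis.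
Import numFieldNormedType.Exports.

Local Open Scope classical_set_scope.
Local Open Scope ring_scope.

Section vector_calculus.
Context {R : realType}.
Local Notation vec := 'rV[R]_3.

Definition vec3 (a b c : R) : vec := \row_i [:: a; b; c]`_i.

Definition ei (i : 'I_3) : vec := delta_mx 0 i.

Definition dot (u v : vec) : R := \sum_i u 0 i * v 0 i.

(* The norm `|u| of the library on row vectors is the max norm. *)
Definition enorm (u : vec) : R := Num.sqrt (dot u u).

Definition i0 : 'I_3 := inord 0.
Definition i1 : 'I_3 := inord 1.
Definition i2 : 'I_3 := inord 2.

Definition cross (u v : vec) : vec :=
  vec3 (u 0 i1 * v 0 i2 - u 0 i2 * v 0 i1)
       (u 0 i2 * v 0 i0 - u 0 i0 * v 0 i2)
       (u 0 i0 * v 0 i1 - u 0 i1 * v 0 i0).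

Definition partial (i : 'I_3) (u : vec -> R) (x : vec) : R := 'D_(ei i) u x.

Definition grad (u : vec -> R) (x : vec) : vec := \row_i partial i u x.

Definition vcomp (u : vec -> vec) (i : 'I_3) : vec -> R := fun x => u x 0 i.

Definition div (u : vec -> vec) (x : vec) : R := \sum_i partial i (vcomp u i) x.

Definition curl (u : vec -> vec) (x : vec) : vec :=
  vec3 (partial i1 (vcomp u i2) x - partial i2 (vcomp u i1) x)
       (partial i2 (vcomp u i0) x - partial i0 (vcomp u i2) x)
       (partial i0 (vcomp u i1) x - partial i1 (vcomp u i0) x).

Definition leb1 := @lebesgue_measure R.
Definition leb2 := (leb1 \x leb1)%E.
Definition leb3 := (leb2 \x leb1)%E.

Definition coord3 (p : (measurableTypeR R * measurableTypeR R) * measurableTypeR R)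
  : vec := vec3 p.1.1 p.1.2 p.2.

Definition int_vol (T : set vec) (h : vec -> R) : R :=
  \int[leb3]_(p in coord3 @^-1` T) h (coord3 p).

End vector_calculus.

Section polyhedra.
Context {R : realType}.
Local Notation vec := 'rV[R]_3.

Definition segment (a b : vec) : set vec :=
  (fun s : R => a + s *: (b - a)) @` `[0, 1].

Definition open_segment (a b : vec) : set vec :=
  (fun s : R => a + s *: (b - a)) @` `]0, 1[.

Definition normal_to (f : set vec) (n : vec) : Prop :=
  forall x y, f x -> f y -> dot n (y - x) = 0.

(* Interior of a planar set f relative to its plane, which has normal n. *)
Definition rel_interior (n : vec) (f : set vec) : set vec :=
  [set x | f x /\ \forall y \near x, dot n (y - x) = 0 -> f y].

(* The direction d leaves D at the point x. *)
Definition points_out (D : set vec) (x d : vec) : Prop :=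
  \forall s \near 0^'+, ~ D (x + s *: d).

(* A polyhedron is a compact region which is the closure of its interior and
   whose boundary consists of finitely many polygonal faces; a polygon is in
   turn a compact planar set which is the closure of its relative interior and
   whose relative boundary consists of finitely many edges.  Faces meet only
   along their boundaries and edges only at vertices.  Convexity is not
   assumed. *)
Record polyhedron := Polyhedron {
  body :> set vec ;
  faceT : finType ;
  edgeT : finType ;
  vertT : finType ;
  vpos : vertT -> vec ;
  src : edgeT -> vertT ;
  tgt : edgeT -> vertT ;
  face : faceT -> set vec ;
  face_pt : faceT -> vec ;
  face_edges : faceT -> {set edgeT} ;
  (* outward unit normal on the boundary of the body, constant on each face *)
  nout : faceT -> vec ;
  edge := fun e : edgeT => segment (vpos (src e)) (vpos (tgt e)) ;

  body_nonempty : body !=set0 ;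
  body_compact : compact body ;
  body_regular : body = closure body° ;
  body_boundary : body `\` body° = \bigcup_f face f ;

  face_ptP : forall f, face f (face_pt f) ;
  face_compact : forall f, compact (face f) ;
  nout_unit : forall f, enorm (nout f) = 1 ;
  nout_normal : forall f, normal_to (face f) (nout f) ;
  nout_outward : forall f x, rel_interior (nout f) (face f) x ->
    points_out body x (nout f) ;
  face_regular : forall f, face f = closure (rel_interior (nout f) (face f)) ;
  face_boundary : forall f, face f `\` rel_interior (nout f) (face f) =
    \bigcup_(e in [set` face_edges f]) edge e ;
  face_meet : forall f g, f != g ->
    face f `&` face g `<=` \bigcup_(e in [set` face_edges f]) edge e ;

  vpos_inj : injective vpos ;
  edge_ends : forall e, src e != tgt e ;
  edge_meet : forall e e', e != e' -> forall x, edge e x -> edge e' x ->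
    exists n, [/\ x = vpos n, n \in [set src e; tgt e]
                & n \in [set src e'; tgt e']]%SET ;
  vert_edge : forall n, exists e, n \in [set src e; tgt e]%SET ;
  edge_two_faces : forall e, #|[set f | e \in face_edges f]%SET| = 2%N
}.

Section edges.
Variable T : polyhedron.

Definition edge_len (e : edgeT T) : R := enorm (vpos (tgt e) - vpos (src e)).

(* Unit vector along e from its source to its target. *)
Definition edge_dir (e : edgeT T) : vec :=
  (edge_len e)^-1 *: (vpos (tgt e) - vpos (src e)).

Definition int_edge (e : edgeT T) (h : vec -> R) : R :=
  \int[leb1]_(s in `[0, edge_len e]) h (vpos (src e) + s *: edge_dir e).

End edges.

(* The fixed normals and tangents of the faces and edges.  On an edge e of f,
   the right-hand rule for the tangent t to the boundary of f says that the
   conormal t x n_f points out of f. *)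
Record frame (T : polyhedron) := Frame {
  nf : faceT T -> vec ;
  tf1 : faceT T -> vec ;
  tf2 : faceT T -> vec ;
  te : edgeT T -> vec ;
  tbd : faceT T -> edgeT T -> vec ;

  nf_unit : forall f, enorm (nf f) = 1 ;
  nf_normal : forall f, normal_to (face f) (nf f) ;
  tf1_unit : forall f, enorm (tf1 f) = 1 ;
  tf2_unit : forall f, enorm (tf2 f) = 1 ;
  tf_orth : forall f, dot (tf1 f) (tf2 f) = 0 ;
  tf1_tangent : forall f, dot (nf f) (tf1 f) = 0 ;
  tf2_tangent : forall f, dot (nf f) (tf2 f) = 0 ;
  te_tangent : forall e, te e = edge_dir e \/ te e = - edge_dir e ;
  tbd_tangent : forall f e, e \in face_edges f ->
    tbd f e = edge_dir e \/ tbd f e = - edge_dir e ;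
  tbd_right_hand : forall f e, e \in face_edges f ->
    forall x, open_segment (vpos (src e)) (vpos (tgt e)) x ->
    points_out (face f) x (cross (tbd f e) (nf f))
}.

(* Surface integral over f, in the orthonormal coordinates of its plane. *)
Definition face_coord (T : polyhedron) (o : frame T) (f : faceT T)
    (p : measurableTypeR R * measurableTypeR R) : vec :=
  face_pt f + p.1 *: tf1 o f + p.2 *: tf2 o f.

Definition int_face (T : polyhedron) (o : frame T) (f : faceT T)
    (h : vec -> R) : R :=
  \int[leb2]_(p in face_coord o f @^-1` face f) h (face_coord o f p).

End polyhedra.

Section regularity.
Context {R : realType}.
Local Notation vec := 'rV[R]_3.

(* The gradient on the closed region T is the continuous extension of the
   gradient in the interior. *)
Definition grad_on (T : set vec) (v : vec -> R) (x : vec) : vec :=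
  lim (grad v y @[y --> within T° (nbhs x)]).

Definition C1_on (T : set vec) (v : vec -> R) : Prop :=
  [/\ {within T, continuous v},
      forall x, T° x -> differentiable v x
    & exists2 g : vec -> vec, {within T, continuous g} &
        forall x, T° x -> g x = grad v x].

Definition L2_on (T : set vec) (v : vec -> R) : Prop :=
  measurable_fun (coord3 @^-1` T) (v \o coord3) /\
  (@leb3 R).-integrable (coord3 @^-1` T) (fun p => ((v (coord3 p)) ^+ 2)%:E).

(* Smooth functions with compact support in the interior of T. *)
Definition test_fun (T : set vec) (phi : vec -> R) : Prop :=
  (forall (s : seq 'I_3) (x : vec), differentiable (foldr partial phi s) x) /\
  exists K : set vec, [/\ compact K, K `<=` T°
    & forall x, ~ K x -> phi x = 0].

Definition H1_on (T : set vec) (v : vec -> R) : Prop :=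
  L2_on T v /\ forall i : 'I_3, exists2 w : vec -> R, L2_on T w &
    forall phi, test_fun T phi ->
      int_vol T (fun x => v x * partial i phi x) =
      - int_vol T (fun x => w x * phi x).

End regularity.

Section spaces.
Context {R : realType}.
Local Notation vec := 'rV[R]_3.

(* Polynomial functions on R^3 of total degree at most j. *)
Definition poly_fun (j : nat) : set (vec -> R) :=
  [set u | @Mpoly3.poly_fun R j u].

Definition poly_vec (j : nat) : set (vec -> vec) :=
  [set u | forall i, poly_fun j (vcomp u i)].

Definition poly_tan (j : nat) (t1 t2 : vec) : set (vec -> vec) :=
  [set u | exists u1 u2, [/\ poly_fun j u1, poly_fun j u2
           & u = fun x => u1 x *: t1 + u2 x *: t2]].

Definition poly_dir (j : nat) (t : vec) : set (vec -> vec) :=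
  [set u | exists2 u1, poly_fun j u1 & u = fun x => u1 x *: t].

(* The functions on D that are restrictions of functions in W.  A function on
   D is represented by its extension by 0, so that functions on D are equal
   exactly when their representatives are. *)
Definition on {U : lmodType R} (D : set vec) (W : set (vec -> U)) :
  set (vec -> U) := [set patch (cst 0) D u | u in W].

(* An element of the space of restrictions to D of functions in W which is
   determined by the property Q. *)
Definition the_elt {U : normedModType R} (D : set vec) (W : set (vec -> U))
    (Q : (vec -> U) -> Prop) : vec -> U :=
  xget (cst 0) [set p | on D W p /\ Q p].

Lemma the_elt_on {U : normedModType R} (D : set vec) (W : set (vec -> U)) Q :
  W (cst 0) -> on D W (the_elt D W Q).
Proof.
move=> W0; rewrite /the_elt; case: xgetP => [p _ []//|_].
exists (cst 0) => //; apply/funext => x; rewrite /patch; by case: ifP.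
Qed.

Lemma poly_fun0 j : poly_fun j (cst 0).
Proof. exact: Mpoly3.poly_fun_zero. Qed.

Lemma poly_vec0 j : poly_vec j (cst 0).
Proof.
move=> i; have -> : vcomp (cst 0) i = (fun=> 0) :> (vec -> R).
  by apply/funext => x; rewrite /vcomp /cst mxE.
exact: poly_fun0.
Qed.

Lemma poly_tan0 j t1 t2 : poly_tan j t1 t2 (cst 0).
Proof.
exists (cst 0), (cst 0); split; [exact: poly_fun0|exact: poly_fun0|].
by apply/funext => x; rewrite /cst !scale0r addr0.
Qed.

Lemma poly_dir0 j t : poly_dir j t (cst 0).
Proof.
by exists (cst 0); [exact: poly_fun0|apply/funext => x; rewrite /cst scale0r].
Qed.

(* L^2 projection of u onto the restrictions to D of functions in W, for the
   inner product which integrates the pointwise product m by I. *)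
Definition L2proj {U : normedModType R} (D : set vec) (W : set (vec -> U))
    (m : U -> U -> R) (I : (vec -> R) -> R) (u : vec -> U) : vec -> U :=
  the_elt D W (fun p => forall q, W q ->
    I (fun x => m (p x) (q x)) = I (fun x => m (u x) (q x))).

Variables (T : polyhedron (R := R)) (o : frame T) (k : nat).

Record W1 := mkW1 {
  v0 : vec -> R ;
  vf : faceT T -> vec -> R ;
  ve : edgeT T -> vec -> R ;
  vn : vertT T -> R ;
  v0P : on T (poly_fun k) v0 ;
  vfP : forall f, on (face f) (poly_fun (k - 1)) (vf f) ;
  veP : forall e, on (edge e) (poly_fun (k - 2)) (ve e)
}.

Definition W2f (f : faceT T) := poly_tan (k - 2) (tf1 o f) (tf2 o f).

Definition W2e (e : edgeT T) := poly_dir (k - 3) (te o e).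

Record W2 := mkW2 {
  u0 : vec -> vec ;
  uf : faceT T -> vec -> vec ;
  ue : edgeT T -> vec -> vec ;
  u0P : on T (poly_vec (k - 1)) u0 ;
  ufP : forall f, on (face f) (W2f f) (uf f) ;
  ueP : forall e, on (edge e) (W2e e) (ue e)
}.

(* In the next three definitions the test functions are polynomials on R^3;
   the right-hand sides depend only on their restrictions to T, f or e. *)
Definition wgrad0 (v : W1) : vec -> vec :=
  the_elt T (poly_vec (k - 1)) (fun w => forall phi, poly_vec (k - 1) phi ->
    int_vol T (fun x => dot (w x) (phi x)) =
    - int_vol T (fun x => v0 v x * div phi x) +
    \sum_f int_face o f (fun x => vf v f x * dot (phi x) (nout f))).

Definition wgradf (v : W1) (f : faceT T) : vec -> vec :=
  the_elt (face f) (W2f f) (fun w => forall theta, W2f f theta ->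
    int_face o f (fun x => dot (w x) (cross (theta x) (nf o f))) =
    - int_face o f (fun x => vf v f x * dot (curl theta x) (nf o f)) +
    \sum_(e in face_edges f)
      int_edge e (fun x => ve v e x * dot (theta x) (tbd o f e))).

Definition wgrade (v : W1) (e : edgeT T) : vec -> vec :=
  the_elt (edge e) (W2e e) (fun w => forall phi, poly_fun (k - 3) phi ->
    int_edge e (fun x => dot (w x) (phi x *: te o e)) =
    - int_edge e (fun x => ve v e x * dot (grad phi x) (te o e)) +
    (vn v (tgt e) * (phi (vpos (tgt e)) * dot (te o e) (edge_dir e)) +
     vn v (src e) * (phi (vpos (src e)) * dot (te o e) (- edge_dir e)))).

Definition wgrad (v : W1) : W2 := @mkW2 (wgrad0 v) (wgradf v) (wgrade v)
  (the_elt_on _ _ (poly_vec0 _))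
  (fun f => the_elt_on _ _ (poly_tan0 _ _ _))
  (fun e => the_elt_on _ _ (poly_dir0 _ _)).

Definition Rh1 (v : vec -> R) : W1 := @mkW1
  (L2proj T (poly_fun k) *%R (int_vol T) v)
  (fun f => L2proj (face f) (poly_fun (k - 1)) *%R (int_face o f) v)
  (fun e => L2proj (edge e) (poly_fun (k - 2)) *%R (int_edge e) v)
  (fun n => v (vpos n))
  (the_elt_on _ _ (poly_fun0 _))
  (fun f => the_elt_on _ _ (poly_fun0 _))
  (fun e => the_elt_on _ _ (poly_fun0 _)).

Definition Rh2 (u : vec -> vec) : W2 := @mkW2
  (L2proj T (poly_vec (k - 1)) dot (int_vol T) u)
  (fun f => L2proj (face f) (W2f f) dot (int_face o f)
     (fun x => cross (nf o f) (cross (u x) (nf o f))))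
  (fun e => L2proj (edge e) (W2e e) dot (int_edge e)
     (fun x => dot (u x) (te o e) *: te o e))
  (the_elt_on _ _ (poly_vec0 _))
  (fun f => the_elt_on _ _ (poly_tan0 _ _ _))
  (fun e => the_elt_on _ _ (poly_dir0 _ _)).

End spaces.

(* Main.v *)
(* Both sides of the identity are obtained by the same choice among the elements
   of a finite-dimensional space satisfying a family of linear conditions, so it
   suffices that the conditions agree.  Testing with polynomials, the projections
   of v in the definition of the weak gradient may be replaced by v itself, since
   the polynomials they are multiplied by lie in the spaces projected onto.  What
   remains is integration by parts for v times a polynomial: the divergence
   theorem on T, Green's theorem on a face and the fundamental theorem of calculus
   on an edge.

   The first two theorems have a common proof.  Along almost every line parallel
   to a coordinate axis, the points of the line where it meets the boundary are
   finitely many and transversal.  On such a line the integral of the derivative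
   over the region is a signed sum of the values at these points, and Fubini's
   theorem turns the sum into integrals over the boundary pieces, projected along
   the axis.  A linear change of variables identifies the projected integral with
   a multiple of the intrinsic one. *)
From HB Require Import structures.
From mathcomp Require Import all_boot all_order all_algebra.
From mathcomp Require mpoly.
Require Import Defs.

Set Implicit Arguments.
Unset Strict Implicit.
Unset Printing Implicit Defensive.

Import Order.TTheory GRing.Theory Num.Theory.

(** Two obstacles shape the proof. For a function of class $C^1$ on the closed region, the gradient
    is given in the interior only, where it agrees with a continuous [g]. Green's theorem on a face
    and the fundamental theorem on an edge need tangential derivatives of [v] at points that the
    interior avoids. They are obtained by descent: a segment in a face is a limit of parallel
    segments in the interior, a segment in an edge is a limit of parallel segments in an adjacent
    face, and the mean value inequality passes to the limit.

    The projections are chosen elements, equal to 0 if no element qualifies, so their existence has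
    to be proved before [v] can replace them. Polynomials are given by a spanning family whose Gram
    matrix may be singular; the linear system is consistent by a Cauchy-Schwarz argument for
    semidefinite forms. *)

Module PolyFun.
Import mpoly.
Local Open Scope ring_scope.

(** * Polynomial functions on three-space *)

Section poly_fun.
Variable R : comNzRingType.
Implicit Types (u w : 'rV[R]_3 -> R) (j : nat).

Lemma poly_funZD j a u w : Mpoly3.poly_fun j u -> Mpoly3.poly_fun j w ->
  Mpoly3.poly_fun j (fun x => a * u x + w x).
Proof.
move=> [p [sp up]] [q [sq wq]]; exists (a *: p + q); split; last first.
  by move=> x; rewrite mevalD mevalZ up wq.
rewrite (leq_trans (msizeD_le _ _))// geq_max sq andbT.
exact: leq_trans (msizeZ_le _ _) sp.
Qed.

Lemma poly_funW j j' u : (j <= j')%N -> Mpoly3.poly_fun j u ->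
  Mpoly3.poly_fun j' u.
Proof. by move=> jj' [p [sp up]]; exists p; split=> //; exact: leq_trans sp _. Qed.

(** The monomials of degree at most [j]. A finite spanning family turns a projection into a linear
    system. *)
Lemma poly_fun_span j : exists n (b : 'I_n -> 'rV[R]_3 -> R),
  (forall i, Mpoly3.poly_fun j (b i)) /\
  forall u, Mpoly3.poly_fun j u ->
    exists c : 'I_n -> R, forall x, u x = \sum_i c i * b i x.
Proof.
pose I : finType := 'X_{1..3 < j.+1}.
exists #|I|, (fun i x => ('X_[R, val (enum_val i : I)]).@[x 0]); split.
  move=> i; exists 'X_[val (enum_val i : I)]; split=> //.
  by rewrite msizeX; case: (enum_val i : I).
move=> u [p [sp up]]; exists (fun i => p@_(val (enum_val i : I))) => x.
rewrite up {1}(mpolywE sp) raddf_sum /= (reindex (enum_val : 'I_#|I| -> I)) /=.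
  by apply: eq_bigr => i _; rewrite mevalZ.
by apply: onW_bij; exact: enum_val_bij.
Qed.

(** This bound, without the drop in degree, is enough: in the weak gradient a derivative of a test
    polynomial is always paired with a projection onto a space one degree larger. *)
Lemma msize_mderiv_le (p : {mpoly R[3]}) i : (msize (p^`M(i)) <= msize p)%N.
Proof.
rewrite [X in (X <= _)%N]msizeE; apply/bigmax_leqP_seq => m mp _.
have : p@_(m + U_(i)) != 0.
  apply/eqP => p0; move: mp; rewrite mcoeff_msupp mcoeff_mderiv p0 mul0rn.
  by rewrite eqxx.
rewrite -mcoeff_msupp => /msize_mdeg_lt; apply: leq_trans.
by rewrite mdegD mdeg1 addn1 leqW.
Qed.

(* Polynomial functions inherit the derivatives of the coordinate functions
   through any relation [E] obeying the rules of differentiation. *)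
Lemma poly_fun_derivative (E : ('rV[R]_3 -> R) -> ('rV[R]_3 -> R) -> Prop)
    (i : 'I_3) :
  (forall u u' w w', u =1 w -> u' =1 w' -> E u u' -> E w w') ->
  (forall c, E (fun=> c) (fun=> 0)) ->
  (forall l, E (fun x => x 0 l) (fun=> (i == l)%:R)) ->
  (forall u u' w w', E u u' -> E w w' ->
    E (fun x => u x + w x) (fun x => u' x + w' x)) ->
  (forall u u' w w', E u u' -> E w w' ->
    E (fun x => u x * w x) (fun x => u' x * w x + u x * w' x)) ->
  forall j u, Mpoly3.poly_fun j u -> exists2 u', Mpoly3.poly_fun j u' & E u u'.
Proof.
move=> Eext EC EX ED EM j u [p [sp up]].
pose ev (q : {mpoly R[3]}) (x : 'rV[R]_3) := q.@[x 0].
suff Ep : forall q, E (ev q) (ev (q^`M(i))).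
  exists (ev (p^`M(i))).
    by exists p^`M(i); split=> //; exact: leq_trans (msize_mderiv_le _ _) sp.
  by apply: Eext (Ep p) => // x; rewrite up.
have E1 q r : E (ev q) (ev (q^`M(i))) -> E (ev r) (ev (r^`M(i))) ->
    E (ev (q * r)) (ev ((q * r)^`M(i))).
  move=> Eq Er; apply: Eext (EM _ _ _ _ Eq Er) => x; rewrite /ev ?mevalM//.
  by rewrite mderivM mevalD !mevalM.
have Ec c : E (ev c%:MP) (ev ((c%:MP)^`M(i))).
  by apply: Eext (EC c) => x; rewrite /ev ?mderivC ?mevalC ?meval0.
move=> q; rewrite [q]mpolyE; elim/big_ind: _ => [|r s Er Es|m _].
- by rewrite -mpolyC0; exact: Ec.
- by apply: Eext (ED _ _ _ _ Er Es) => x; rewrite /ev ?mderivD mevalD.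
rewrite -mul_mpolyC; apply: (E1 _ _ (Ec _)).
rewrite mpolyXE_id; elim/big_ind: _ => [|r s Er Es|l _].
- exact: (Ec 1).
- exact: E1.
elim: (m l) => [|n IH]; first by rewrite expr0; exact: (Ec 1).
rewrite exprS; apply: E1 IH; apply: Eext (EX l) => x; rewrite /ev ?mevalXU//.
rewrite mderivX mnm1E mevalZ; have [->|il] := eqVneq l i.
  by rewrite mul1r -{1}[U_(i)%MM]add0m addmK mpolyX0 meval1.
by rewrite mul0r.
Qed.

End poly_fun.
End PolyFun.
From mathcomp Require Import all_classical all_reals all_analysis.
From mathcomp Require Import measurable_realfun ring lra.
Import numFieldNormedType.Exports.
Local Open Scope classical_set_scope.
Local Open Scope ring_scope.

(** * Changes of variables and slicing *)

Section borel_maps.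
Context {R : realType}.
Local Notation vec := 'rV[R]_3.

Lemma vec_ballP (x : vec) (U : set vec) :
  nbhs x U <-> exists2 e : R, 0 < e &
    forall y : vec, (forall i, `|x 0 i - y 0 i| < e) -> U y.
Proof.
split=> [/nbhs_ballP[e /= e0 xU]|[e e0 xU]].
  exists e => // y xy; apply: xU; split=> // i j.
  by rewrite (ord1 i); exact: xy.
apply/nbhs_ballP; exists e => //= y [_ xy]; apply: xU => i; exact: xy.
Qed.

(** An open set is the union of the countably many boxes with rational centre and radius that it
    contains, and the preimage of a box is a finite intersection of conditions on the
    coordinates. *)
Lemma measurable_preimage_open d (X : measurableType d) (c : X -> vec) :
  (forall i, measurable_fun setT (fun x => c x 0 i)) ->
  forall U, open U -> measurable (c @^-1` U).
Proof.
move=> mc U oU.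
pose box (q : 'rV[rat]_3 * rat) : set vec :=
  [set y | forall i, `|ratr (q.1 0 i) - y 0 i| < ratr q.2].
pose B (q : 'rV[rat]_3 * rat) : set vec :=
  [set x | box q `<=` U /\ box q x].
have -> : U = \bigcup_q B q.
  apply/seteqP; split=> [x Ux|x [q _]]; last first.
    by move=> [qU /qU].
  have /vec_ballP[e e0 xU] : nbhs x U by exact: open_nbhs_nbhs.
  (* With a radius below [e / 2] and a centre closer to [x] than this radius, the whole box stays
     within [e] of [x]. *)
  have e20 : 0 < e / 2 by rewrite divr_gt0.
  have [r] := rat_in_itvoo e20.
  rewrite in_itv/= => /andP[r0 re].
  have xq i : exists q : rat, `|ratr q - x 0 i| < ratr r.
    have xr : x 0 i - ratr r < x 0 i + ratr r by lra.
    have [q] := rat_in_itvoo xr.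
    rewrite in_itv/= => /andP[? ?]; exists q.
    by rewrite ltr_norml; apply/andP; split; lra.
  have [q qx] := choice xq.
  exists (\row_i q i, r) => //; split=> [|i]; last by rewrite mxE.
  move=> y /= qy; apply: xU => i; have := qy i; rewrite mxE => qyi.
  have := qx i; move: qyi; rewrite !ltr_norml => /andP[? ?] /andP[? ?].
  by apply/andP; split; lra.
rewrite preimage_bigcup; apply: countable_bigcupT_measurable => [|q].
  exact: countableP.
have [qU|qU] := pselect (box q `<=` U); last first.
  rewrite (_ : B q = set0) ?preimage_set0//.
  by apply/seteqP; split=> x // [].
have -> : B q = box q by apply/seteqP; split=> [x []|x ?].
have -> : c @^-1` box q = \bigcap_(i in [set: 'I_3])
    (fun x => c x 0 i) @^-1` [set y : R | `|ratr (q.1 0 i) - y| < ratr q.2].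
  by apply/seteqP; split=> x /= => [xq i _|xq i]; exact: xq.
apply: fin_bigcap_measurable => // i _.
rewrite -[X in measurable X]setTI; apply: mc => //.
have -> : [set y : R | `|ratr (q.1 0 i) - y| < ratr q.2] =
  ball (ratr (q.1 0 i) : R) (ratr q.2 : R) by [].
by apply: open_measurable; exact: ball_open.
Qed.

Lemma measurable_preimage_compact d (X : measurableType d) (c : X -> vec) :
  (forall i, measurable_fun setT (fun x => c x 0 i)) ->
  forall K, compact K -> measurable (c @^-1` K).
Proof.
move=> mc K /compact_closed => /(_ (@norm_hausdorff _ _)) cK.
rewrite -[c @^-1` K]setCK; apply: measurableC.
exact: measurable_preimage_open mc _ (closed_openC cK).
Qed.

Lemma compact_coord_bounded (K : set vec) : compact K ->
  exists2 C : R, 0 < C & forall x, K x -> forall i, `|x 0 i| < C.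
Proof.
move=> /compact_bounded[M [_ KM]]; exists (Num.max 0 (M + 1) + 1).
  by rewrite ltr_wpDl// le_max lexx.
move=> x Kx i; have xM : `|x| <= M + 1 by apply: KM => //; rewrite ltrDl.
have [_ /(_ 0 i)] : ball (0 : vec) (Num.max 0 (M + 1) + 1) x.
  rewrite -ball_normE /= sub0r normrN (le_lt_trans xM)//.
  by rewrite ltr_pwDr// le_max lexx orbT.
by rewrite /ball/= mxE sub0r normrN.
Qed.

(** Continuity within [K] makes preimages of open intervals relatively open, hence measurable, and
    compactness makes [F] bounded on a parameter set of finite measure. *)
Lemma integrable_compact d (X : measurableType d)
    (mu : {measure set X -> \bar R}) (c : X -> vec) (K : set vec) (F : vec -> R) :
  (forall i, measurable_fun setT (fun x => c x 0 i)) ->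
  (mu (c @^-1` K) < +oo)%E -> compact K -> {within K, continuous F} ->
  mu.-integrable (c @^-1` K) (EFin \o (F \o c)).
Proof.
move=> mc muK cK cF; have mK := measurable_preimage_compact mc cK.
apply: measurable_bounded_integrable => //.
  apply: (measurability _ (RGenOpens.measurableE R)) => //.
  move=> _ [_ [a [b ->] <-]].
  have oab : open (`]a, b[%classic : set R) by exact: interval_open.
  have /continuousP/(_ _ oab) := cF.
  move=> /open_subspaceP[V oV VE].
  have -> : c @^-1` K `&` (F \o c) @^-1` `]a, b[ = c @^-1` K `&` c @^-1` V.
    by rewrite ![c @^-1` K `&` _]setIC -preimage_setI VE.
  by apply: measurableI => //; exact: measurable_preimage_open.
have /compact_bounded[M [_ FM]] := continuous_compact cF cK.
exists M; split; first exact: num_real.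
by move=> y My x Kx; apply: (FM y My); exists (c x).
Qed.

End borel_maps.

Section product_sigma_finite.
Context d1 d2 (X : measurableType d1) (Y : measurableType d2) (R : realType).
Variables (m1 : {sigma_finite_measure set X -> \bar R})
  (m2 : {sigma_finite_measure set Y -> \bar R}).

(** For triple integrals a product measure is itself a factor in Fubini's theorem, so it has to be a
    sigma-finite measure. *)
Lemma sigma_finite_product : sigma_finite setT (m1 \x m2)%E.
Proof.
have /sigma_finiteP[F [TF ndF Foo]] := sigma_finiteT m1.
have /sigma_finiteP[G [TG ndG Goo]] := sigma_finiteT m2.
exists (fun n => F n `*` G n) => [|k].
  apply/seteqP; split=> // -[x y] _.
  have [n _ Fx] : (\bigcup_k F k) x by rewrite -TF.
  have [k _ Gy] : (\bigcup_k G k) y by rewrite -TG.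
  exists (maxn n k) => //; split.
  - by move: x Fx; exact/subsetPset/ndF/leq_maxl.
  - by move: y Gy; exact/subsetPset/ndG/leq_maxr.
have [? ?] := Foo k; have [? ?] := Goo k.
split; first exact: measurableX.
by rewrite product_measure1E// lte_mul_pinfty// ge0_fin_numE.
Qed.

Let mixin := Measure_isSigmaFinite.Build _ (X * Y)%type R (m1 \x m2)%E sigma_finite_product.
Definition product_sigma_finite : {sigma_finite_measure set (X * Y)%type -> \bar R} :=
  HB.pack (m1 \x m2)%E mixin.
End product_sigma_finite.

(** * Jacobians of affine maps and coordinate permutations *)

Section change_of_variables.
Context {R : realType}.
Local Notation mR := (measurableTypeR R).

Lemma ge0_integral_scaling d (X : measurableType d)
    (mu : {measure set X -> \bar R}) (phi : X -> X) (r : {nonneg R}) :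
  measurable_fun setT phi ->
  (forall A, measurable A -> (r%:num%:E * mu (phi @^-1` A))%E = mu A) ->
  forall D (F : X -> \bar R), measurable D -> measurable_fun D F ->
    (forall x, D x -> (0 <= F x)%E) ->
  (\int[mu]_(x in D) F x =
   r%:num%:E * \int[mu]_(x in phi @^-1` D) F (phi x))%E.
Proof.
move=> mphi H D F mD mF F0.
rewrite -(ge0_integral_pushforward mphi)//; last by move=> x /set_mem; exact: F0.
rewrite -ge0_integral_mscale//; apply: eq_measure_integral => A mA AD.
by rewrite -[LHS]H.
Qed.

(** [r] is the absolute Jacobian of [phi]. In terms of preimages, [r] times the pushforward of [mu]
    is [mu], a form that composes and that uniqueness theorems for measures can verify. *)
Definition scaling d (X : measurableType d) (mu : set X -> \bar R)
    (phi : X -> X) (r : R) :=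
  [/\ measurable_fun setT phi, 0 < r &
    forall A, measurable A -> (r%:E * mu (phi @^-1` A))%E = mu A].

Lemma integral_scaling d (X : measurableType d)
    (mu : {measure set X -> \bar R}) (phi : X -> X) (s : R) D (F : X -> R) :
  scaling mu phi s -> measurable D -> mu.-integrable D (EFin \o F) ->
  \int[mu]_(x in D) F x = s * \int[mu]_(x in phi @^-1` D) F (phi x).
Proof.
move=> [mphi s0 H] mD iF; have mF := measurable_int _ iF.
have [r r0 rs] : exists2 r : {nonneg R}, 0 < r%:num & r%:num = s.
  by exists (NngNum (ltW s0)).
move: H; rewrite -rs => H.
have mphiD : measurable (phi @^-1` D) by rewrite -[X in measurable X]setTI; exact: mphi.
have E := ge0_integral_scaling mphi H.
have iFphi : mu.-integrable (phi @^-1` D) (EFin \o (F \o phi)).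
  have mFp : measurable_fun (phi @^-1` D) (EFin \o (F \o phi)).
    by apply: (measurable_comp mD) mF (measurable_funS _ _ mphi) => //= _ [x ? <-].
  apply/integrableP; split=> //.
  (* Integrability passes to the composite because the factor is positive: an infinite integral
     would stay infinite after multiplication. *)
  move/integrableP : iF => [_]; rewrite E//; last exact: measurableT_comp.
  have : (0 <= \int[mu]_(x in phi @^-1` D) `|(EFin \o (F \o phi)) x|)%E.
    exact: integral_ge0.
  set I := integral _ _ _; case: I => [t _| _|//].
    by move=> _; rewrite ltry.
  by rewrite gt0_muley ?lte_fin.
rewrite /Rintegral -[RHS](@fineM _ r%:num%:E)//; last first.
  exact: integrable_fin_num.
congr fine; rewrite integralE [X in (X - _)%E]E//; last exact: measurable_funepos.
rewrite [X in (_ - X)%E]E//; last exact: measurable_funeneg.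
have fN := integrable_neg_fin_num mphiD iFphi.
rewrite -[X in (_ * X - _)%E]/(\int[mu]_(x in phi @^-1` D) ((EFin \o F)^\+%E \o phi) x)%E.
rewrite -[X in (_ - _ * X)%E]/(\int[mu]_(x in phi @^-1` D) ((EFin \o F)^\-%E \o phi) x)%E.
rewrite -funepos_comp -funeneg_comp.
rewrite -muleBr//; last by apply: fin_num_adde_defl; rewrite fin_numN.
by rewrite [in RHS]integralE.
Qed.

Lemma measurable_preimageT d (X : measurableType d) (phi : X -> X) A :
  measurable_fun setT phi -> measurable A -> measurable (phi @^-1` A).
Proof. by move=> mphi mA; rewrite -[X in measurable X]setTI; exact: mphi. Qed.

Lemma scaling_comp d (X : measurableType d) (mu : {measure set X -> \bar R})
    (f g : X -> X) (r s : R) :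
  scaling mu f r -> scaling mu g s -> scaling mu (f \o g) (r * s).
Proof.
move=> [mf r0 fE] [mg s0 gE]; split; [exact: measurableT_comp|exact: mulr_gt0|].
move=> A mA; rewrite EFinM -muleA comp_preimage gE ?fE//.
exact: measurable_preimageT.
Qed.

Lemma scaled_pushforward d1 d2 (X : measurableType d1) (Y : measurableType d2)
    (mu : {measure set X -> \bar R}) (phi : X -> Y) (r : R) :
  measurable_fun setT phi -> 0 <= r ->
  exists m : {measure set Y -> \bar R}, forall A, m A = (r%:E * mu (phi @^-1` A))%E.
Proof.
move=> mphi r0; pose m := mscale (NngNum r0) (pushforward mu phi).
by exists (m mphi) => A.
Qed.

Lemma scaling_affine1 (a b : R) : a != 0 ->
  scaling (@leb1 R) (fun x : mR => a * x + b : mR) `|a|.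
Proof.
move=> a0.
have mphi : measurable_fun [set: mR] (fun x : mR => a * x + b : mR).
  by apply: measurable_funD => //; exact: measurable_funM.
split=> //; first by rewrite normr_gt0.
have [m mE] := scaled_pushforward (@leb1 R) mphi (normr_ge0 a).
move=> A mA; rewrite -mE; apply/esym.
apply: lebesgue_measure_unique => // _ [[x y] _ <-]; rewrite [RHS]mE.
(* Lebesgue measure is determined on half-open intervals; a negative [a] moves the closed end of the
   preimage to the left. *)
have -> : (fun r : mR => a * r + b : mR) @^-1` `]x, y] =
    if 0 < a then `](x - b) / a, (y - b) / a]%classic else `[(y - b) / a, (x - b) / a[%classic.
  apply/seteqP; case: ltrgt0P a0 => // a0 _; split=> r /=; rewrite !in_itv/=.
  - by rewrite ltr_pdivrMr// ler_pdivlMr// => /andP[? ?]; apply/andP; split; lra.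
  - by rewrite ltr_pdivrMr// ler_pdivlMr// => /andP[? ?]; apply/andP; split; lra.
  - by rewrite ltr_ndivlMr// ler_ndivrMr// => /andP[? ?]; apply/andP; split; lra.
  - by rewrite ltr_ndivlMr// ler_ndivrMr// => /andP[? ?]; apply/andP; split; lra.
rewrite /leb1; case: ltrgt0P a0 => // a0 _; rewrite !lebesgue_measure_itv/= !lte_fin.
  rewrite (lebesgue_measure_itv `](x - b) / a, (y - b) / a])/= lte_fin.
  rewrite ltr_pM2r ?invr_gt0// ltrD2r; case: ifPn => _; last by rewrite mule0.
  by rewrite -!EFinD -EFinM; congr EFin; field; rewrite gt_eqF.
rewrite (lebesgue_measure_itv `[(y - b) / a, (x - b) / a[)/= lte_fin.
rewrite ltr_nM2r ?invr_lt0// ltrD2r; case: ifPn => _; last by rewrite mule0.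
by rewrite -!EFinD -EFinM; congr EFin; field; rewrite lt_eqF.
Qed.

Notation leb2 := (@leb2 R).
Notation leb3 := (@leb3 R).

Lemma leb2_xsection A : measurable A -> leb2 A = (\int[@leb1 R]_x leb1 (xsection A x))%E.
Proof. by []. Qed.

Lemma leb2_ysection A : measurable A -> leb2 A = (\int[@leb1 R]_y leb1 (ysection A y))%E.
Proof.
move=> mA; rewrite -[RHS]/((@leb1 R \x^ @leb1 R)%E A).
by apply: product_measure_unique => // B C mB mC; exact: product_measure2E.
Qed.

Lemma scaling_swap : scaling leb2 (fun p : mR * mR => (p.2, p.1)) 1.
Proof.
have mphi : measurable_fun [set: mR * mR] (fun p : mR * mR => (p.2, p.1)).
  exact: measurable_swap.
split=> // A mA; have [m mE] := scaled_pushforward leb2 mphi (@ler01 R).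
rewrite -mE; apply/esym; apply: product_measure_unique => // B C mB mC.
rewrite mE mul1e (_ : _ @^-1` _ = C `*` B).
  by rewrite [LHS]product_measure1E// muleC.
by apply/seteqP; split=> x/= [].
Qed.

(** On the section at height [y] the map is affine in one variable with slope [a]; the
    one-dimensional relation is integrated over [y]. *)
Lemma scaling_shear (a b c : R) : a != 0 ->
  scaling leb2 (fun p : mR * mR => (a * p.1 + b * p.2 + c : mR, p.2)) `|a|.
Proof.
move=> a0; have a0' : 0 < `|a| by rewrite normr_gt0.
have mphi : measurable_fun [set: mR * mR]
    (fun p : mR * mR => (a * p.1 + b * p.2 + c : mR, p.2)).
  apply: measurable_fun_pair => //; apply: measurable_funD => //.
  by apply: measurable_funD; apply: measurable_funM.
split=> // A mA; have mpA := measurable_preimageT mphi mA.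
rewrite !leb2_ysection// -ge0_integralZl//; last first.
  by apply: measurable_fun_ysection.
apply: eq_integral => y _.
have [_ _ /(_ (ysection A y)) E] := scaling_affine1 (b * y + c) a0.
rewrite -[RHS]E; last exact: measurable_ysection.
by congr (_ * leb1 _)%E; rewrite !ysectionE; apply/seteqP; split=> x/=; rewrite addrA.
Qed.

Lemma eq_scaling d (X : measurableType d) (mu : set X -> \bar R) (f g : X -> X)
    (r s : R) : f =1 g -> r = s -> scaling mu f r -> scaling mu g s.
Proof. by move=> /funext -> ->. Qed.

(** Gaussian elimination: the map is a product of two shears, the second conjugated by the swap,
    with pivots [a] and [(a * d - b * c) / a]. *)
Lemma scaling_affine2 (a b c d e f : R) : a * d - b * c != 0 ->
  scaling leb2 (fun p : mR * mR => (a * p.1 + b * p.2 + e : mR, c * p.1 + d * p.2 + f : mR))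
    `|a * d - b * c|.
Proof.
(* A vanishing pivot is repaired by exchanging the columns, which keeps the absolute determinant. *)
wlog a0 : a b c d / a != 0 => [H D0|D0].
  have [a0|] := eqVneq a 0; last by move=> a0; exact: H.
  have b0 : b != 0 by apply: contra_neq D0 => ->; rewrite a0; ring.
  have D1 : b * c - a * d != 0 by rewrite -opprB oppr_eq0.
  apply: eq_scaling (scaling_comp (H b a d c b0 D1) scaling_swap) => [p /=|].
    by rewrite [b * _ + _]addrC [d * _ + _]addrC.
  by rewrite mulr1 distrC.
have A0 : (a * d - b * c) / a != 0 by rewrite mulf_neq0// invr_eq0.
pose L := scaling_comp scaling_swap
  (scaling_comp (scaling_shear (c / a) (f - c * e / a) A0) scaling_swap).
apply: eq_scaling (scaling_comp L (scaling_shear b e a0)) => [[x y]/=|].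
  by congr pair; field.
by rewrite mulr1 mul1r -normrM mulfVK.
Qed.

Lemma product_pushforward_unique d1 d2 d3 (X : measurableType d1)
    (Y : measurableType d2) (Z : measurableType d3)
    (m1 : {sigma_finite_measure set X -> \bar R})
    (m2 : {sigma_finite_measure set Y -> \bar R})
    (mu : {measure set Z -> \bar R}) (phi : Z -> X * Y) :
  measurable_fun setT phi ->
  (forall A B, measurable A -> measurable B ->
    mu (phi @^-1` (A `*` B)) = (m1 A * m2 B)%E) ->
  forall A, measurable A -> (m1 \x m2)%E A = mu (phi @^-1` A).
Proof.
move=> mphi H A mA; have [m mE] := scaled_pushforward mu mphi (@ler01 R).
transitivity (m A); last by rewrite mE mul1e.
by apply: product_measure_unique => // B C mB mC; rewrite mE mul1e H.
Qed.

(** On a rectangle with factors [B] and [C] of the reordered product, the slice over [(x, y)] is the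
    section of [B] at [y] if [x] is in [C], and empty otherwise. Tonelli's theorem then separates
    the factors. *)
Lemma scaling_cycle d (X : measurableType d)
    (mu : {sigma_finite_measure set X -> \bar R}) :
  scaling (((mu \x mu) \x mu)%E) (fun p : X * X * X => ((p.1.2, p.2), p.1.1)) 1.
Proof.
have mphi : measurable_fun [set: X * X * X]
    (fun p : X * X * X => ((p.1.2, p.2), p.1.1)).
  apply: measurable_fun_pair; first apply: measurable_fun_pair => //.
    by apply: measurableT_comp.
  by apply: measurableT_comp.
split=> // A mA.
rewrite mul1e; apply/esym.
pose P1 := product_sigma_finite mu mu; pose P2 := product_sigma_finite P1 mu.
apply: (@product_pushforward_unique _ _ _ (X * X)%type X (X * X * X)%type P1 mu P2 _ mphi)
  => // B C mB mC.
rewrite -[LHS]/(\int[(mu \x mu)%E]_q mu (xsection _ q))%E.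
pose g (y : X) := mu (xsection B y).
have mg : measurable_fun setT g by exact: measurable_fun_xsection.
have mF : measurable_fun setT (fun q : X * X => ((\1_C q.1 : R)%:E * g q.2)%E).
  apply: emeasurable_funM; last exact: measurableT_comp.
  by apply/measurable_EFinP; apply: measurableT_comp.
rewrite (eq_integral (fun q : X * X => (\1_C q.1 : R)%:E * g q.2)%E); last first.
  move=> [x y] _ /=; rewrite indicE; case: (boolP (x \in C)) => xC.
    rewrite mul1e; congr (mu _); apply/seteqP; split=> z /xsectionP.
      by move=> []/= ? _; apply/xsectionP.
    by move=> ?; apply/xsectionP; split=> //=; exact: set_mem.
  rewrite mul0e -(measure0 mu); congr (mu _); apply/seteqP; split=> z //.
  by move=> /xsectionP[_ /mem_set/= xC']; rewrite xC' in xC.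
rewrite fubini_tonelli1//; last first.
  by move=> q; rewrite mule_ge0 ?lee_fin ?indicE.
rewrite /fubini_F /=.
under eq_integral do rewrite ge0_integralZl//.
rewrite ge0_integralZr//.
- by rewrite integral_indic// setIT muleC.
- by apply/measurable_EFinP.
- by apply: integral_ge0.
Qed.

End change_of_variables.

(** * Fubini's theorem with slices known almost everywhere *)

Section slicing.
Context {R : realType}.

Lemma Rintegrable_sum d (X : measurableType d) (mu : {measure set X -> \bar R})
    (D : set X) I (r : seq I) (P : pred I) (f : I -> X -> R) :
  measurable D -> (forall i, P i -> mu.-integrable D (EFin \o f i)) ->
  mu.-integrable D (EFin \o (fun x => \sum_(i <- r | P i) f i x)).
Proof.
move=> mD intf; apply: eq_integrable (integrable_sum mD r intf) => // x _ /=.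
by rewrite sumEFin.
Qed.

Lemma Rintegral_sum d (X : measurableType d) (mu : {measure set X -> \bar R})
    (D : set X) I (r : seq I) (P : pred I) (f : I -> X -> R) :
  measurable D -> (forall i, P i -> mu.-integrable D (EFin \o f i)) ->
  \int[mu]_(x in D) (\sum_(i <- r | P i) f i x) =
  \sum_(i <- r | P i) \int[mu]_(x in D) f i x.
Proof.
move=> mD intf; have int_sum s := Rintegrable_sum s mD intf.
elim: r => [|i r IH].
  under eq_Rintegral do rewrite big_nil; rewrite big_nil.
  by rewrite Rintegral_cst// mul0r.
under eq_Rintegral do rewrite big_cons; rewrite big_cons.
by case: ifPn => // Pi; rewrite RintegralD// ?IH//; exact: intf.
Qed.

Lemma Rintegrable_mkcond d (X : measurableType d) (mu : {measure set X -> \bar R})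
    (D : set X) (f : X -> R) : measurable D ->
  mu.-integrable D (EFin \o f) -> mu.-integrable setT (EFin \o (f \_ D)).
Proof. by move=> mD fi; rewrite -restrict_EFin; exact/(integrable_mkcond _ mD). Qed.

(** [N] will collect the lines in bad position and [D j] will be the shadow of a boundary piece. The
    weights are extended by zero outside the shadows so that they can be added pointwise. *)
Lemma Rintegral_slices d (Y : measurableType d)
    (nu : {sigma_finite_measure set Y -> \bar R}) (K : set (Y * measurableTypeR R))
    (h : Y * measurableTypeR R -> R) (J : finType) (P : pred J) (D : J -> set Y)
    (w : J -> Y -> R) (s : J -> R) (N : set Y) :
  measurable K -> (nu \x @leb1 R)%E.-integrable K (EFin \o h) ->
  (forall j, P j -> measurable (D j)) ->
  (forall j, P j -> nu.-integrable (D j) (EFin \o w j)) ->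
  nu.-negligible N ->
  (forall y, ~ N y -> \int[@leb1 R]_(t in xsection K y) h (y, t) =
     \sum_(j | P j) s j * (w j \_ (D j)) y) ->
  \int[(nu \x @leb1 R)%E]_(p in K) h p =
  \sum_(j | P j) s j * \int[nu]_(y in D j) w j y.
Proof.
move=> mK ih mD iw N0 H.
have ihK : (nu \x @leb1 R)%E.-integrable setT (EFin \o (h \_ K)).
  exact: Rintegrable_mkcond.
have iwD j : P j -> nu.-integrable setT (EFin \o (w j \_ (D j))).
  by move=> Pj; apply: Rintegrable_mkcond; [exact: mD|exact: iw].
have iwsD j : P j -> nu.-integrable setT (EFin \o (fun y => s j * (w j \_ (D j)) y)).
  by move=> Pj; apply: eq_integrable (integrableZl measurableT (s j) (iwD j Pj)).
transitivity (\int[nu]_y \sum_(j | P j) s j * (w j \_ (D j)) y); last first.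
  rewrite Rintegral_sum//.
  apply: eq_bigr => j Pj; rewrite RintegralZl//; last exact: iwD.
  by rewrite [in RHS]Rintegral_mkcond.
rewrite Rintegral_mkcond /Rintegral -integral12_prod_meas1//; congr fine.
apply: ae_eq_integral => //.
- exact: (measurable_fubini_F ihK).
- exact: measurable_int (Rintegrable_sum _ measurableT iwsD).
have NaE : {ae nu, forall y, ~ N y}.
  by apply: negligibleS N0 => y /= /contrapT.
apply: filterS2 (ae_integrable1 ihK) NaE => y iy Ny _; rewrite -H//.
have E : ((fun t : measurableTypeR R => h (y, t)) \_ (xsection K y)) =
    (fun t => (h \_ K) (y, t)).
  by apply/funext => t; rewrite !patchE mem_xsection.
rewrite Rintegral_mkcond E /Rintegral fineK//; exact: integrable_fin_num iy.
Qed.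

End slicing.

(** * Integration of derivatives over flat regions *)

Section ftc_compact.
Context {R : realType}.

(** The part of [I] inside [K] is nonempty, and both closed and open relative to [I]. *)
Lemma connected_sub_closed (X : topologicalType) (I K : set X) :
  connected I -> closed K ->
  (forall s, I s -> K s -> \forall t \near s, I t -> K t) ->
  forall s, I s -> K s -> I `<=` K.
Proof.
move=> cI cK openK s Is Ks; suff <- : I `&` K = I by move=> x [].
apply: cI; [by exists s| |by exists K].
exists (interior [set t | I t -> K t]); first exact: open_interior.
apply/seteqP; split=> t [It Kt]; split=> //; first exact: openK.
by move/interior_subset: Kt; apply.
Qed.

Lemma near_itvP (x : R) (P : set R) :
  (\forall t \near x, P t) <->
  exists2 e : R, 0 < e & forall t, x - e < t < x + e -> P t.
Proof.
split=> [/nbhs_ballP[e /= e0 xP]|[e e0 xP]].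
  by exists e => // t; rewrite -ltr_distl distrC; exact: xP.
by apply/nbhs_ballP; exists e => //= t; rewrite /ball/= distrC ltr_distl; exact: xP.
Qed.

Lemma Rintegral_FTC (F h : R -> R) (a b : R) : a < b ->
  {within `[a, b], continuous F} -> {within `[a, b], continuous h} ->
  (forall s, a < s < b -> is_derive s 1 F (h s)) ->
  \int[@leb1 R]_(s in `[a, b]) h s = F b - F a.
Proof.
move=> ab cF ch dF; rewrite /Rintegral (continuous_FTC2 (F := F))//.
  have /(continuous_within_itvP _ ab)[_ Fa Fb] := cF.
  by split=> // s; rewrite in_itv/= => /dF[].
by move=> s; rewrite in_itv/= => /dF sD; rewrite derive1E derive_val.
Qed.

(** [out j] tells that [A] lies to the left of [p j]. Such a set is a finite disjoint union of
    intervals; the induction on the number of boundary points splits off the leftmost interval. *)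
Lemma Rintegral_compact_FTC (J : finType) (Q : {set J}) (p : J -> R) (out : pred J)
    (A : set R) (F h : R -> R) :
  compact A -> {within A, continuous F} -> {within A, continuous h} ->
  (forall s, A s -> (forall j, j \in Q -> s != p j) ->
    (\forall t \near s, A t) /\ is_derive s 1 F (h s)) ->
  {in Q &, injective p} ->
  (forall j, j \in Q -> A (p j) /\
    \forall t \near p j, t != p j -> (A t <-> (t < p j) == out j)) ->
  \int[@leb1 R]_(s in A) h s = \sum_(j in Q) (-1) ^+ (~~ out j) * F (p j).
Proof.
elim: {Q}_.+1 {-2}Q (ltnSn #|Q|) A => // n IH Q Qn A cA cF ch regA pinj bdA.
have clA : closed A by apply: compact_closed => //; exact: Rhausdorff.
have [[a0 Aa0]|/set0P/negP/negPn/eqP A0] := pselect (A !=set0); last first.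
  rewrite A0 Rintegral_set0 big1// => j jQ.
  by have [] := bdA j jQ; rewrite A0.
have cid : {within A, continuous (fun x : R => x)}.
  by apply: continuous_subspaceT => x; exact: cvg_id.
have A0 : A !=set0 by exists a0.
have [a Aa amin] : exists2 a : R, A a & forall t, A t -> a <= t.
  have [a /set_mem Aa amin] := compact_EVT_min A0 cA cid.
  by exists a => // t At; apply: amin; exact: mem_set.
have [c Ac cmax] : exists2 c : R, A c & forall t, A t -> t <= c.
  have [c /set_mem Ac cmax] := compact_EVT_max A0 cA cid.
  by exists c => // t At; apply: cmax; exact: mem_set.
(* The minimum of [A] is a boundary point, for otherwise [A] would contain smaller points. *)
have [j1 j1Q paE] : exists2 j, j \in Q & a = p j.
  apply: contrapT => na.
  have [|/near_itvP[e e0 nA] _] := regA a Aa.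
    by move=> j jQ; apply: contra_notN na => /eqP ->; exists j.
  have /amin : A (a - e / 2) by apply: nA; apply/andP; split; lra.
  by lra.
have [_ /near_itvP[e1 e10 ne1]] := bdA j1 j1Q; rewrite -paE in ne1.
have o1 : out j1 = false.
  apply/negP => o1; have : A (a - e1 / 2).
    apply/ne1; [by apply/andP; split; lra|by apply/eqP; lra|].
    by rewrite o1; apply/eqP; lra.
  by move=> /amin; lra.
have {}ne1 t : a < t -> t < a + e1 -> A t.
  move=> ? ?; apply/ne1; [by apply/andP; split; lra|by apply/eqP; lra|].
  by rewrite o1 eqbF_neg -leNgt; lra.
have pgt j : j \in Q :\ j1 -> a < p j.
  move=> /setD1P[jj1 jQ]; have [Aj _] := bdA j jQ.
  rewrite lt_neqAle amin// andbT paE; apply: contra_neq jj1 => /esym.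
  exact: pinj.
(* By connectedness, an interval to the right of [a] that has a point close to [a] and avoids the
   other boundary points lies in [A]. *)
have subA (I : interval R) s0 : (forall t, t \in I -> a < t) ->
    s0 \in I -> s0 < a + e1 ->
    (forall t j, t \in I -> j \in Q :\ j1 -> t != p j) -> [set` I] `<=` A.
  move=> Ia Is0 s0e Ip; apply: (connected_sub_closed _ clA _ Is0).
  - exact/connected_intervalP/interval_is_interval.
  - move=> s Is As; have [|nA _] := regA s As; last first.
      by apply: filterS nA => t At _.
    move=> j jQ; have [->|jj1] := eqVneq j j1.
      by rewrite -paE gt_eqF// Ia.
    by apply: Ip => //; apply/setD1P.
  - by apply: ne1 => //; exact: Ia.
(* Were [a] the only boundary point, [A] would contain the whole ray to its right. *)
have [Q10|[j0 j0Q]] := set_0Vmem (Q :\ j1).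
  have acA : [set` `]a, +oo[] `<=` A.
    apply: (subA _ (a + e1 / 2)) => [t|||t j]; rewrite ?in_itv/= ?andbT; [by []|lra|lra|].
    by rewrite Q10 inE.
  have := amin _ Ac; have := cmax (c + e1) => /[swap] ac.
  have /acA Ace : [set` `]a, +oo[] (c + e1) by rewrite /= in_itv/= andbT; lra.
  by move=> /(_ Ace); lra.
have [j2 j2Q1 j2min] := arg_minP p j0Q.
have j2Q : j2 \in Q :\ j1 by [].
have [b bE] : exists b, b = p j2 by exists (p j2).
rewrite -bE in j2min.
have ab : a < b by rewrite bE; exact: pgt.
have abA : [set` `]a, b[] `<=` A.
  have [s0 s0a [s0b s0e]] : exists2 s, a < s & s < b /\ s < a + e1.
    have [be|be] := ltP b (a + e1); first by exists ((a + b) / 2); [|split]; lra.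
    by exists (a + e1 / 2); [|split]; lra.
  apply: (subA _ s0) => // [t||t j]; rewrite ?in_itv/=.
  - by move=> /andP[].
  - by rewrite s0a.
  - by move=> /andP[_ tb] /j2min bp; rewrite lt_eqF//; lra.
have /setD1P[j21 j2Q'] := j2Q.
have [Ab] := bdA j2 j2Q'; rewrite -bE in Ab *.
move=> /near_itvP[e2 e20 ne2].
have o2 : out j2.
  have [s0 s0a [s0b s0e]] : exists2 s, a < s & s < b /\ b - e2 < s.
    have [be|be] := ltP a (b - e2); first by exists (b - e2 / 2); [|split]; lra.
    by exists ((a + b) / 2); [|split]; lra.
  have As0 : A s0 by apply: abA; rewrite /= in_itv/= s0a.
  have /ne2 H : b - e2 < s0 < b + e2 by apply/andP; split; lra.
  have /H/iffLR/(_ As0) : s0 != b by rewrite lt_eqF.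
  by rewrite s0b => /eqP.
have {}ne2 t : A t -> b < t -> b + e2 <= t.
  move=> At bt; rewrite leNgt; apply/negP => te.
  have /ne2 H : b - e2 < t < b + e2 by apply/andP; split; lra.
  have /H/iffLR/(_ At) : t != b by rewrite gt_eqF.
  by rewrite o2 ltNge (ltW bt).
have abA' : [set` `[a, b]] `<=` A.
  move=> t /=; rewrite in_itv/= => /andP[]; rewrite le_eqVlt => /predU1P[<-//|ta].
  by rewrite le_eqVlt => /predU1P[->//|tb]; apply: abA; rewrite /= in_itv/= ta.
(* No point of [A] lies strictly between [b] and [b + e2], so the rest of [A] is cut out by a closed
   ray and remains compact. *)
pose A' := A `&` [set` `[b + e2, +oo[].
have A'P t : A' t <-> A t /\ b < t.
  rewrite /A'/= in_itv/= andbT; split=> -[At bt]; split=> //; first by lra.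
  exact: ne2.
have cA' : compact A'.
  by apply: compact_closedI => //; exact: interval_closed.
have A'A : A' `<=` A by move=> t /A'P[].
have AE : A = [set` `[a, b]] `|` A'.
  apply/seteqP; split=> t; last by case; [exact: abA'|exact: A'A].
  move=> At; have [tb|bt] := leP t b; last by right; apply/A'P.
  by left; rewrite /= in_itv/= tb amin.
have mA' : measurable (A' : set (measurableTypeR R)) by exact: compact_measurable.
rewrite AE Rintegral_setU//; last 2 first.
- by rewrite -AE; exact: continuous_compact_integrable.
- apply/eqP/seteqP; split=> t // [/=]; rewrite in_itv/= => /andP[_ tb] /A'P[_].
  by lra.
have -> : \int[@leb1 R]_(s in [set` `[a, b]]) h s = F b - F a.
  apply: Rintegral_FTC => // [||s /andP[as_ sb]].
  - exact: continuous_subspaceW cF.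
  - exact: continuous_subspaceW ch.
  - have [||//] := regA s; first by apply: abA; rewrite /= in_itv/= as_.
    move=> j jQ; have [->|jj1] := eqVneq j j1; first by rewrite -paE gt_eqF.
    by have /j2min bj : j \in Q :\ j1 by [apply/setD1P]; rewrite lt_eqF//; lra.
rewrite (big_setD1 j1)//= (big_setD1 j2)//= o1 o2 expr0 expr1 mul1r mulN1r -paE -bE.
rewrite addrA [- F a + F b]addrC; congr (_ + _); apply: IH => //.
- by move: Qn; rewrite (cardsD1 j1) j1Q (cardsD1 j2) j2Q add1n ltnS; exact: ltnW.
- exact: continuous_subspaceW cF.
- exact: continuous_subspaceW ch.
- move=> s /A'P[As bs] sp; have [j jQ|nA sD] := regA s As.
    have [->|jj1] := eqVneq j j1; first by rewrite -paE gt_eqF//; lra.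
    have [->|jj2] := eqVneq j j2; first by rewrite -bE gt_eqF.
    by apply: sp; apply/setD1P; split=> //; apply/setD1P.
  split=> //; apply: filterS2 nA (lt_nbhsr bs) => t At bt; exact/A'P.
- by move=> i j /setD1P[_ /setD1P[_ iQ]] /setD1P[_ /setD1P[_ jQ]]; exact: pinj.
- move=> j /setD1P[j2j jQ1]; have /setD1P[j1j jQ] := jQ1.
  have bp : b < p j.
    rewrite lt_neqAle j2min// andbT bE; apply: contra_neq j2j => /esym.
    exact: pinj.
  have [Aj nj] := bdA j jQ; split; first by apply/A'P.
  apply: filterS2 nj (lt_nbhsr bp) => t nt bt /nt <-.
  by rewrite A'P; split=> [[]|].
Qed.

End ftc_compact.

(** * Dot products and continuity along lines *)

Section vectors.
Context {R : realType}.
Local Notation vec := 'rV[R]_3.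
Implicit Types (u v w : vec) (a : R).

Lemma big_ord3 (F : 'I_3 -> R) : \sum_i F i = F i0 + F i1 + F i2.
Proof.
rewrite !big_ord_recl big_ord0 addr0 addrA.
by congr (F _ + F _ + F _); apply: val_inj; rewrite /= inordK.
Qed.

Lemma dotE u v :
  dot u v = u 0 i0 * v 0 i0 + u 0 i1 * v 0 i1 + u 0 i2 * v 0 i2.
Proof.
exact: big_ord3.
Qed.

Lemma dotC u v : dot u v = dot v u.
Proof. by apply: eq_bigr => i _; rewrite mulrC. Qed.

Lemma dotDl u v w : dot (u + v) w = dot u w + dot v w.
Proof. by rewrite -big_split; apply: eq_bigr => i _; rewrite mxE mulrDl. Qed.

Lemma dotZl a u v : dot (a *: u) v = a * dot u v.
Proof. by rewrite mulr_sumr; apply: eq_bigr => i _; rewrite mxE mulrA. Qed.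

Lemma dotDr u v w : dot u (v + w) = dot u v + dot u w.
Proof. by rewrite dotC dotDl ![dot _ u]dotC. Qed.

Lemma dotZr a u v : dot u (a *: v) = a * dot u v.
Proof. by rewrite dotC dotZl [dot v _]dotC. Qed.

Lemma dotNl u v : dot (- u) v = - dot u v.
Proof. by rewrite -scaleN1r dotZl mulN1r. Qed.

Lemma dotNr u v : dot u (- v) = - dot u v.
Proof. by rewrite dotC dotNl dotC. Qed.

Lemma dotBr u v w : dot u (v - w) = dot u v - dot u w.
Proof. by rewrite dotDr dotNr. Qed.

Lemma dotBl u v w : dot (u - v) w = dot u w - dot v w.
Proof. by rewrite dotDl dotNl. Qed.

Lemma dot0l v : dot 0 v = 0.
Proof. by rewrite -(scale0r v) dotZl mul0r. Qed.

Lemma dot_gt0 v : (0 < dot v v) = (v != 0).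
Proof.
have v0 : 0 <= dot v v by apply: sumr_ge0 => i _; rewrite -expr2 sqr_ge0.
rewrite lt_def v0 andbT; congr negb; apply/eqP/eqP => [|->]; last exact: dot0l.
move=> /psumr_eq0P H; apply/rowP => i; rewrite mxE.
have /eqP : v 0 i * v 0 i = 0 by apply: H => // k _; rewrite -expr2 sqr_ge0.
by rewrite mulf_eq0 orbb => /eqP.
Qed.

Lemma enormE1 u : enorm u = 1 -> dot u u = 1.
Proof.
move=> u1; have u0 : 0 <= dot u u by apply: sumr_ge0 => i _; rewrite -expr2 sqr_ge0.
by rewrite -[LHS]sqr_sqrtr// -/(enorm u) u1 expr1n.
Qed.

Lemma add2_subl u v w : u + v + w - u = v + w.
Proof. by rewrite addrAC [u + v]addrC addrK. Qed.

Lemma dot_continuous u : continuous (dot u).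
Proof.
move=> v; rewrite (_ : dot u = fun x => u 0 i0 * x 0 i0 + u 0 i1 * x 0 i1 + u 0 i2 * x 0 i2).
  have c i : {for v, continuous (fun x : vec => u 0 i * x 0 i)}.
    by apply: continuousM; [exact: cst_continuous|exact: coord_continuous].
  exact: continuousD (continuousD (c _) (c _)) (c _).
by apply/funext => x; exact: dotE.
Qed.

Lemma dot_affine_continuous u v a : continuous (fun x : vec => dot u (x - v) / a).
Proof.
have -> : (fun x : vec => dot u (x - v) / a) =
    (fun y => y - a^-1 * dot u v) \o dot (a^-1 *: u).
  by apply/funext => x; rewrite /= dotBr dotZl; ring.
move=> x; apply: continuous_comp; first exact: dot_continuous.
by apply: cvgB; [exact: cvg_id|exact: cvg_cst].
Qed.

Lemma line_continuous u v : continuous (fun s : R => u + s *: v).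
Proof. by move=> s; apply: cvgD; [exact: cvg_cst|exact: scalel_continuous]. Qed.

Lemma near_line u v (s : R) (P : set vec) :
  (\forall y \near u + s *: v, P y) -> \forall t \near s, P (u + t *: v).
Proof. exact: line_continuous. Qed.

Lemma near_all (v : vec) (P : set vec) : (forall y, P y) -> \forall y \near v, P y.
Proof. by move=> Py; exact: filterE. Qed.

Lemma within_continuous_comp (X Y Z : topologicalType) (c : X -> Y) (f : Y -> Z)
    (A : set Y) : continuous c -> {within A, continuous f} ->
  {within c @^-1` A, continuous (f \o c)}.
Proof.
move=> cc /continuousP cf; apply/continuousP => U oU.
have /open_subspaceP[V oV VE] := cf U oU.
apply/open_subspaceP; exists (c @^-1` V); first by apply: open_comp.
by rewrite -preimage_setI VE.
Qed.

Lemma continuous_comp_within (X Y Z : topologicalType) (f : X -> Y) (c : Y -> Z)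
    (A : set X) : continuous c -> {within A, continuous f} ->
  {within A, continuous (c \o f)}.
Proof.
move=> cc /continuousP cf; apply/continuousP => U oU.
have oV : open (c @^-1` U) by apply: open_comp.
exact: cf oV.
Qed.

Lemma is_derive_line (w : vec -> R) u v (s l : R) :
  is_derive (u + s *: v) v w l -> is_derive s 1 (fun t => w (u + t *: v)) l.
Proof.
have E : (fun h : R =>
      h^-1 *: (((fun t => w (u + t *: v)) \o shift s) (h *: (1 : R)) - w (u + s *: v))) =
    (fun h : R => h^-1 *: ((w \o shift (u + s *: v)) (h *: v) - w (u + s *: v))).
  apply/funext => h; congr (_ *: (w _ - _)) => /=.
  by rewrite [h%:A]mulr1 scalerDl addrCA.
by move=> [dw <-]; split; [rewrite /derivable E|rewrite /derive E].
Qed.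

Lemma measurable_dot dX (X : measurableType dX) (c : X -> vec) u :
  (forall i, measurable_fun setT (fun x => c x 0 i)) ->
  measurable_fun setT (fun x => dot u (c x)).
Proof.
move=> mc; under eq_fun do rewrite dotE.
by apply: measurable_funD; [apply: measurable_funD|]; exact: measurable_funM.
Qed.

End vectors.

(** * Regions bounded by flat pieces, and the lines crossing them *)

Section flat_regions.
Context {R : realType}.
Local Notation vec := 'rV[R]_3.

(* Common setting for a polyhedron ([m = 0]) and for a face of it ([m] a normal
   of its plane): [I] is the interior of [K] relative to the affine space
   through [K] orthogonal to [m], and the boundary consists of the flat pieces
   [G j] with outward conormals [mu j]; [O j] are the generic points of [G j]. *)
Record flat_region (K I : set vec) (m : vec) (J : finType) (P : pred J)
    (G O : J -> set vec) (pt mu : J -> vec) : Prop := FlatRegion {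
  fr_compact : compact K ;
  fr_closure : K = closure I ;
  fr_open : forall x, I x -> \forall y \near x, dot m (y - x) = 0 -> I y ;
  fr_flat : normal_to K m ;
  fr_bound : K `\` I = \bigcup_(j in [set` P]) G j ;
  fr_piece : forall j, P j -> compact (G j) ;
  fr_pt : forall j, P j -> G j (pt j) ;
  fr_mu : forall j, P j -> normal_to (G j) (mu j) ;
  fr_mu0 : forall j, P j -> mu j != 0 ;
  fr_mum : forall j, P j -> dot m (mu j) = 0 ;
  fr_generic : forall j, P j -> O j `<=` G j ;
  fr_out : forall j x, P j -> O j x -> points_out K x (mu j) ;
  fr_meet : forall i j x, P i -> P j -> O i x -> G j x -> i = j
}.

Section flat_region.
Variables (K I : set vec) (m : vec) (J : finType) (P : pred J).
Variables (G O : J -> set vec) (pt mu : J -> vec).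
Hypothesis fr : flat_region K I m P G O pt mu.

Let closedK : closed K.
Proof. by apply: compact_closed (fr_compact fr); exact: norm_hausdorff. Qed.

Let closedG j : P j -> closed (G j).
Proof. by move=> Pj; apply: compact_closed (fr_piece fr Pj); exact: norm_hausdorff. Qed.

Let subIK : I `<=` K.
Proof. by rewrite (fr_closure fr); exact: subset_closure. Qed.

Let GK j x : P j -> G j x -> K x /\ ~ I x.
Proof.
move=> Pj Gx; have : (\bigcup_(j in [set` P]) G j) x by exists j.
by rewrite -(fr_bound fr).
Qed.

Let subBB (x a b : vec) : b - a = (b - x) - (a - x).
Proof. by rewrite opprB addrA subrK. Qed.

(** The other pieces are closed and avoid the generic point [x], so close to [x] the boundary
    consists of [G j] alone. *)
Lemma flat_region_near_bound j x : P j -> O j x ->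
  \forall y \near x, K y -> ~ I y -> dot (mu j) (y - x) = 0.
Proof.
move=> Pj Ox.
have : forall l, \forall y \near x, P l -> G l y -> l = j.
  move=> l; have [->|lj] := eqVneq l j; first exact: near_all.
  have [Pl|nPl] := boolP (P l); last exact: near_all.
  have : \forall y \near x, ~ G l y.
    apply: open_nbhs_nbhs; split; first exact/closed_openC/closedG.
    by move=> Gx; move/eqP: lj; apply; rewrite (fr_meet fr Pj Pl Ox Gx).
  by apply: filterS => y Gy _ /Gy.
move=> /filter_forall; apply: filterS => y Gy Ky nIy.
have [l Pl Gly] : (\bigcup_(j in [set` P]) G j) y by rewrite -(fr_bound fr).
have Gjy := Gly; rewrite (Gy l Pl Gly) in Gjy.
by apply: (fr_mu fr Pj) => //; exact: (fr_generic fr Pj).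
Qed.

(** A segment with both ends strictly on one side of the plane of [G j] has no boundary point, so
    its part in [K] is open as well as closed in it. *)
Lemma segment_side (j : J) (x a b : vec) :
  (forall s : R, 0 <= s <= 1 -> K (a + s *: (b - a)) -> ~ I (a + s *: (b - a)) ->
    dot (mu j) (a + s *: (b - a) - x) = 0) ->
  dot m (b - a) = 0 -> 0 < dot (mu j) (a - x) * dot (mu j) (b - x) ->
  K a -> K b /\ I b.
Proof.
move=> bd mab side Ka.
have sideE (s : R) : 0 <= s <= 1 -> dot (mu j) (a + s *: (b - a) - x) != 0.
  have -> : a + s *: (b - a) - x = (1 - s) *: (a - x) + s *: (b - x).
    by apply/rowP => i; rewrite !mxE; ring.
  rewrite dotDr !dotZr => /andP[s0 s1]; apply/eqP => E.
  move: side; set p := dot _ _ in E *; set q := dot _ _ in E * => pq.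
  have p0 : p != 0 by apply: contraTneq pq => ->; rewrite mul0r ltxx.
  have pp : 0 < p * p by rewrite -expr2 exprn_even_gt0.
  (* After multiplication by [p] a zero of the interpolated value is a zero of a sum of two
     nonnegative terms, which are not both zero. *)
  have Ep : (1 - s) * (p * p) + s * (p * q) = 0.
    by transitivity (p * ((1 - s) * p + s * q)); [ring|rewrite E mulr0].
  have [z|s'] := eqVneq s 0; first by move: Ep; rewrite z; lra.
  have : 0 < s * (p * q) by rewrite mulr_gt0// lt_def s'.
  have : 0 <= (1 - s) * (p * p) by rewrite mulr_ge0 ?subr_ge0// ltW.
  by lra.
have sI (s : R) : 0 <= s <= 1 -> K (a + s *: (b - a)) -> I (a + s *: (b - a)).
  move=> s01 Ks; apply: contrapT => nI.
  by have /eqP := sideE _ s01; apply; exact: bd.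
have : [set` `[0, 1 : R]] `<=` (fun s : R => a + s *: (b - a)) @^-1` K.
  apply: (@connected_sub_closed R _ _ (@segment_connected R 0 1) _ _ 0).
  - apply: (closed_comp _ closedK) => s _; exact: line_continuous.
  - move=> s /=; rewrite in_itv/= => s01 Ks.
    have := near_line (fr_open fr (sI s s01 Ks)); apply: filterS => t H _.
    by apply: subIK; apply: H; rewrite opprD addrACA subrr add0r -scalerBl dotZr mab mulr0.
  - by rewrite /= in_itv/= lexx ler01.
  - by rewrite /= scale0r addr0.
move=> /(_ 1); rewrite /= in_itv/= lexx ler01 scale1r => /(_ isT).
rewrite addrC subrK => Kb; split=> //.
have := sI 1; rewrite scale1r addrC subrK; apply => //.
by rewrite lexx ler01.
Qed.

(** Near a generic point [K] is half of a ball. Two points on the same side in a small box are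
    joined by a segment on that side, so [segment_side] spreads the answer from one witness to the
    whole half. *)
Lemma flat_region_local j x : P j -> O j x ->
  \forall y \near x, dot m (y - x) = 0 ->
    (0 < dot (mu j) (y - x) -> ~ K y) /\ (dot (mu j) (y - x) < 0 -> I y).
Proof.
move=> Pj Ox; have /vec_ballP[e e0 bd] := flat_region_near_bound Pj Ox.
have Gx := fr_generic fr Pj Ox; have [Kx nIx] := GK Pj Gx.
pose B : set vec := [set y | forall i, `|x 0 i - y 0 i| < e].
have oB : open B.
  rewrite (_ : B = ball x e); first exact: ball_open.
  apply/seteqP; split=> y => [By|[_ By] i]; last exact: By.
  by split=> // i k; rewrite (ord1 i); exact: By.
have nB : nbhs x B by apply/vec_ballP; exists e.
have mm : dot m (mu j) = 0 := fr_mum fr Pj.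
have mumu : 0 < dot (mu j) (mu j) by rewrite dot_gt0 (fr_mu0 fr).
have convB a b (s : R) : B a -> B b -> 0 <= s <= 1 -> B (a + s *: (b - a)).
  move=> Ba Bb /andP[s0 s1] i; rewrite !mxE.
  have := Ba i; have := Bb i; rewrite !ltr_norml => /andP[b1 b2] /andP[a1 a2].
  have [->|s'] := eqVneq s 0; first by apply/andP; split; lra.
  have {}s0 : 0 < s by rewrite lt_def s'.
  have := mulr_gt0 s0 (_ : 0 < e - (x 0 i - b 0 i)).
  have := mulr_gt0 s0 (_ : 0 < e + (x 0 i - b 0 i)).
  have := mulr_ge0 (_ : 0 <= 1 - s) (_ : 0 <= e - (x 0 i - a 0 i)).
  have := mulr_ge0 (_ : 0 <= 1 - s) (_ : 0 <= e + (x 0 i - a 0 i)).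
  move=> h1 h2 h3 h4; have {}h1 := h1 ltac:(lra) ltac:(lra).
  have {}h2 := h2 ltac:(lra) ltac:(lra).
  have {}h3 := h3 ltac:(lra); have {}h4 := h4 ltac:(lra).
  by apply/andP; split; lra.
have side a b : B a -> B b -> dot m (b - a) = 0 ->
    0 < dot (mu j) (a - x) * dot (mu j) (b - x) -> K a -> K b /\ I b.
  move=> Ba Bb; apply: segment_side => s s01; apply: bd.
  exact: convB.
(* The witness outside [K]: a small step from [x] along the outward conormal. *)
have [z0 [Bz0 mz0 z0x nKz0]] : exists z, [/\ B z, dot m (z - x) = 0,
    0 < dot (mu j) (z - x) & ~ K z].
  have nB' : \forall s \near (0 : R), B (x + s *: mu j).
    by apply: near_line; rewrite scale0r addr0.
  have /filter_ex[s [Bs [s0 Ks]]] : \forall s \near (0:R)^'+,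
      B (x + s *: mu j) /\ (0 < s /\ ~ K (x + s *: mu j)).
    near=> s; split; [|split].
    - by near: s; exact: cvg_within.
    - by near: s; exact: nbhs_right_gt.
    - by near: s; exact: (fr_out fr Pj Ox).
  exists (x + s *: mu j); split=> //; rewrite addrAC subrr add0r dotZr.
  - by rewrite mm mulr0.
  - exact: mulr_gt0.
have outside y : B y -> dot m (y - x) = 0 -> 0 < dot (mu j) (y - x) -> ~ K y.
  move=> By my yx Ky; apply: nKz0; apply: (proj1 (side y z0 _ _ _ _ _)) => //.
    by rewrite (subBB x) dotBr mz0 my subr0.
  exact: mulr_gt0.
(* The witness inside: [x] is a limit of points of [I], which nearby are not on the positive side;
   one lying in the plane of [G j] is moved along [- mu j], as [I] is relatively open. *)
have [z1 [Bz1 Iz1 mz1 z1x]] : exists z, [/\ B z, I z, dot m (z - x) = 0 &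
    dot (mu j) (z - x) < 0].
  have : closure I x by rewrite -(fr_closure fr).
  move=> /(_ _ nB)[y [Iy By]].
  have my : dot m (y - x) = 0 by apply: (fr_flat fr) => //; exact: subIK.
  have [yx|xy|yx] := ltrgtP (dot (mu j) (y - x)) 0; first by exists y.
    by have := outside _ By my xy (subIK Iy).
  have nI : \forall s \near (0 : R), B (y + s *: (- mu j)) /\
      (dot m (y + s *: (- mu j) - y) = 0 -> I (y + s *: (- mu j))).
    apply: (@near_line _ y _ 0 (fun z => B z /\ (dot m (z - y) = 0 -> I z))).
    rewrite scale0r addr0; apply: filterI (fr_open fr Iy).
    exact: open_nbhs_nbhs.
  have /filter_ex[s [[Bs Is] s0]] : \forall s \near (0:R)^'+,
      (B (y + s *: - mu j) /\ (dot m (y + s *: (- mu j) - y) = 0 -> I (y + s *: (- mu j))))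
      /\ 0 < s.
    by near=> s; split; [near: s; exact: cvg_within|near: s; exact: nbhs_right_gt].
  exists (y + s *: - mu j); split=> //.
  - by apply: Is; rewrite addrAC subrr add0r dotZr dotNr mm oppr0 mulr0.
  - by rewrite addrAC dotDr my add0r dotZr dotNr mm oppr0 mulr0.
  - by rewrite addrAC dotDr yx add0r dotZr dotNr mulrN oppr_lt0 mulr_gt0.
apply: filterS nB => y By my; split; first exact: outside.
move=> yx; have [] // := side z1 y Bz1 By; last exact: subIK.
  by rewrite (subBB x) dotBr mz1 my subr0.
by rewrite nmulr_rgt0.
Unshelve. all: by end_near.
Qed.


Section slice.
Variables (w h : vec -> R) (d : vec).
Hypotheses (d0 : d != 0) (md : dot m d = 0).
Hypotheses (cw : {within K, continuous w}) (ch : {within K, continuous h}).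
Hypothesis dw : forall x, I x -> is_derive x d w (h x).

(* The parameter at which the line through [b] with direction [d] crosses the
   affine hull of [G j]; a junk value when [dot (mu j) d = 0]. *)
Definition crossing (b : vec) (j : J) : R := dot (mu j) (pt j - b) / dot (mu j) d.

Lemma crossingP b j s : P j -> dot (mu j) d != 0 -> G j (b + s *: d) -> s = crossing b j.
Proof.
move=> Pj mud Gs; have := fr_mu fr Pj Gs (fr_pt fr Pj).
rewrite opprD addrA dotBr dotZr => /eqP; rewrite subr_eq0 => /eqP E.
by rewrite /crossing E mulfK.
Qed.

(** The crossings are the boundary points of the trace of [K] on the line, and the sign of
    [dot (mu j) d] tells whether the line leaves or enters [K] there. *)
Lemma Rintegral_line (b : vec) :
  (forall x, K x -> dot m (x - b) = 0) ->
  (forall j s, P j -> G j (b + s *: d) -> O j (b + s *: d) /\ dot (mu j) d != 0) ->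
  \int[@leb1 R]_(s in [set s | K (b + s *: d)]) h (b + s *: d) =
  \sum_(j | P j && (dot (mu j) d != 0)) Num.sg (dot (mu j) d) *
    ((fun x => w (x + crossing x j *: d)) \_
       [set x | G j (x + crossing x j *: d)]) b.
Proof.
move=> mb gen; pose A := [set s | K (b + s *: d)].
have dd : dot d d != 0 by rewrite gt_eqF// dot_gt0.
pose Q := [set j | P j && (dot (mu j) d != 0) && `[< G j (b + crossing b j *: d) >]]%SET.
have QP j : j \in Q -> [/\ P j, dot (mu j) d != 0 & G j (b + crossing b j *: d)].
  by rewrite inE => /andP[/andP[? ?] /asboolP].
rewrite (Rintegral_compact_FTC (Q := Q) (p := crossing b)
  (out := fun j => 0 < dot (mu j) d) (F := fun s => w (b + s *: d)) (A := A)).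
- rewrite [LHS]big_mkcond [RHS]big_mkcond; apply: eq_bigr => j _.
  rewrite inE patchE; case: ifPn => [/andP[/andP[-> mud] /asboolP Gj]|].
    rewrite mud/= mem_set//; case: ltrgt0P mud => // [mu_gt0|mu_lt0] _.
      by rewrite gtr0_sg// expr0.
    by rewrite ltr0_sg// expr1.
  case: ifPn => //= _ /asboolPn nG.
  by rewrite memNset// mulr0.
(* The trace is closed and contained in the image of [K] under the coordinate [t] along [d], hence
   compact. *)
- pose t (x : vec) : R := dot d (x - b) / dot d d.
  have ct : continuous t by exact: dot_affine_continuous.
  apply: (subclosed_compact _ (B := t @` K)).
  + by apply: closed_comp closedK => s _; exact: line_continuous.
  + apply: continuous_compact (fr_compact fr).
    exact: continuous_subspaceT.
  + move=> s Ks; exists (b + s *: d) => //.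
    by rewrite /t addrAC subrr add0r dotZr mulfK.
- exact: (within_continuous_comp (@line_continuous _ b d) cw).
- exact: (within_continuous_comp (@line_continuous _ b d) ch).
- move=> s Ks sQ.
  have Is : I (b + s *: d).
    apply: contrapT => nI.
    have [j Pj Gj] : (\bigcup_(j in [set` P]) G j) (b + s *: d) by rewrite -(fr_bound fr).
    have [_ mud] := gen j s Pj Gj; have sE := crossingP Pj mud Gj.
    have /sQ/eqP : j \in Q by rewrite inE -sE mud andbT; apply/andP; split=> //; exact/asboolP.
    by apply.
  split; last exact/is_derive_line/dw.
  have := near_line (fr_open fr Is); apply: filterS => t H.
  by apply/subIK/H; rewrite opprD addrACA subrr add0r -scalerBl dotZr md mulr0.
(* Different pieces are crossed at different parameters, since a generic point belongs to one piece
   only. *)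
- move=> i j /QP[Pi mui Gi] /QP[Pj muj Gj] ij.
  apply: (fr_meet fr Pi Pj (proj1 (gen _ _ Pi Gi))); by rewrite ij.
- move=> j /QP[Pj muj Gj]; have [Oj _] := gen _ _ Pj Gj.
  split; first by have [] := GK Pj Gj.
  have := near_line (flat_region_local Pj Oj); apply: filterS => t.
  rewrite opprD addrACA subrr add0r -scalerBl !dotZr md mulr0 => /(_ erefl)[out1 in1] tp.
  rewrite /A/=; case: (ltrgt0P (dot (mu j) d)) muj => // mud _ in out1 in1 *.
    case: ltgtP tp => // tp _; split=> //.
    + by move=> _; apply/subIK/in1; rewrite nmulr_rlt0// subr_lt0.
    + by move=> Kt; exfalso; apply: out1 Kt; rewrite mulr_gt0// subr_gt0.
  case: ltgtP tp => // tp _; split=> //.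
  + by move=> Kt; exfalso; apply: out1 Kt; rewrite nmulr_rgt0// subr_lt0.
  + by move=> _; apply/subIK/in1; rewrite pmulr_rlt0// subr_gt0.
Qed.

Lemma measurable_crossing dY (Y : measurableType dY) (b : Y -> vec) j i :
  (forall i, measurable_fun setT (fun y => b y 0 i)) ->
  measurable_fun setT (fun y => (b y + crossing (b y) j *: d) 0 i).
Proof.
move=> mb; under eq_fun do rewrite !mxE.
apply: measurable_funD => //; apply: measurable_funM => //.
apply: measurable_funM => //; apply: measurable_dot => k.
by under eq_fun do rewrite !mxE; exact: measurable_funB.
Qed.

(** [b] gives the base points of the lines with direction [d], and [D j] is the shadow of [G j]. A
    piece parallel to [d] casts its shadow into [N] and so drops out of the sum. *)
Lemma Rintegral_flat_region dY (Y : measurableType dY)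
    (nu : {sigma_finite_measure set Y -> \bar R}) (b : Y -> vec) (N : set Y) :
  (forall i, measurable_fun setT (fun y => b y 0 i)) ->
  (forall y x, K x -> dot m (x - b y) = 0) ->
  let c (p : Y * measurableTypeR R) := b p.1 + p.2 *: d in
  let D j := [set y | G j (b y + crossing (b y) j *: d)] in
  ((nu \x @leb1 R) (c @^-1` K) < +oo)%E ->
  (forall j, P j -> dot (mu j) d != 0 -> (nu (D j) < +oo)%E) ->
  nu.-negligible N ->
  (forall y, ~ N y -> forall j s, P j -> G j (b y + s *: d) ->
    O j (b y + s *: d) /\ dot (mu j) d != 0) ->
  \int[(nu \x @leb1 R)%E]_(p in c @^-1` K) h (c p) =
  \sum_(j | P j && (dot (mu j) d != 0)) Num.sg (dot (mu j) d) *
    \int[nu]_(y in D j) w (b y + crossing (b y) j *: d).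
Proof.
move=> mb mK c D finK finD N0 gen.
have mc i : measurable_fun setT (fun p => c p 0 i).
  rewrite /c; under eq_fun do rewrite !mxE.
  apply: measurable_funD; first exact: (measurableT_comp (mb i)).
  by apply: measurable_funM.
have mD j i := measurable_crossing j i mb.
apply: (Rintegral_slices (N := N)
  (w := fun j y => w (b y + crossing (b y) j *: d))) => //.
- exact: measurable_preimage_compact (fr_compact fr).
- exact: integrable_compact (fr_compact fr) ch.
- move=> j /andP[Pj _]; exact: measurable_preimage_compact (mD j) _ (fr_piece fr Pj).
- move=> j /andP[Pj mud].
  apply: (integrable_compact (mD j)); [exact: finD|exact: fr_piece fr _ Pj|].
  by apply: continuous_subspaceW cw => x Gx; have [] := GK Pj Gx.
- move=> y Ny; rewrite xsectionE.
  rewrite -[LHS]/(\int[@leb1 R]_(s in [set s | K (b y + s *: d)]) h (b y + s *: d)).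
  rewrite (Rintegral_line (mK y) (gen y Ny)).
  by apply: eq_bigr => j _; rewrite !patchE.
Qed.

End slice.
End flat_region.
End flat_regions.

(** * Tangential derivatives at boundary points *)

Section boundary_derivatives.
Context {R : realType}.
Local Notation vec := 'rV[R]_3.

Lemma within_continuous_near (X Y : topologicalType) (K : set X) (f : X -> Y) x U :
  {within K, continuous f} -> K x -> nbhs (f x) U -> \forall y \near x, K y -> U (f y).
Proof.
move=> cf Kx fU; have := cf x U fU.
by rewrite /nbhs/= -nbhs_subspace_in.
Qed.

Lemma MVT_le (f df : R -> R) (l e a b : R) :
  (forall s, Num.min a b <= s <= Num.max a b -> is_derive s 1 f (df s)) ->
  (forall s, Num.min a b <= s <= Num.max a b -> `|df s - l| <= e) ->
  `|f b - f a - (b - a) * l| <= `|b - a| * e.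
Proof.
wlog ab : a b / a < b => [H|] df' dfe.
  have [ab|ba|->] := ltgtP a b; first exact: H.
  - have := H b a ba; rewrite minC maxC => /(_ df' dfe).
    rewrite -normrN [`|b - a|]distrC; congr (_ <= _); congr `|_|; ring.
  - by rewrite !subrr mul0r subrr normr0 mul0r.
rewrite min_l ?max_r ?ltW// in df' dfe.
have cf : {within `[a, b], continuous f}.
  by apply: derivable_within_continuous => s; rewrite in_itv/= => /df'[].
have df'' s : s \in `]a, b[ -> is_derive s 1 f (df s).
  by rewrite in_itv/= => /andP[? ?]; apply: df'; rewrite !ltW.
have [c] := MVT ab df'' cf; rewrite in_itv/= => /andP[ac cb] ->.
rewrite [df c * _]mulrC -mulrBr normrM ler_wpM2l//; apply: dfe.
by rewrite !ltW.
Qed.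

Lemma near_plane (x t mu : vec) (P : set vec) : (\forall y \near x, P y) ->
  exists2 r : R, 0 < r & forall s k, `|s| < r -> `|k| < r -> P (x + s *: t + k *: mu).
Proof.
move=> /vec_ballP[d d0 gd].
have [C C0 tC] : exists2 C : R, 0 < C & forall y, [set t; mu] y -> forall i, `|y 0 i| < C.
  by apply: compact_coord_bounded; apply: compactU; exact: compact_set1.
have C20 : 0 < 2 * C by rewrite mulr_gt0.
exists (d / (2 * C)) => [|s k sr kr]; first exact: divr_gt0.
apply: gd => i; rewrite !mxE -addrA opprD addrA subrr sub0r normrN.
have ti := tC t (or_introl erefl) i; have mi := tC mu (or_intror erefl) i.
rewrite (le_lt_trans (ler_normD _ _))// !normrM.
have := ler_pM (normr_ge0 s) (normr_ge0 _) (ltW sr) (ltW ti).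
have := ltr_pM (normr_ge0 k) (normr_ge0 _) kr mi.
have -> : d / (2 * C) * C = d / 2 by field; rewrite gt_eqF.
by lra.
Qed.

(** Difference quotients at [x] are limits of those on parallel segments pushed off along [mu],
    where the derivative is known and, by continuity of [g], uniformly close to [g x]. *)
Lemma is_derive_boundary (K : set vec) (v g : vec -> R) (x t mu : vec) (r : R) :
  0 < r -> {within K, continuous v} -> {within K, continuous g} ->
  (forall s, `|s| < r -> K (x + s *: t)) ->
  (forall s e, `|s| < r -> 0 < e < r -> let y := x + s *: t + e *: mu in
    K y /\ is_derive y t v (g y)) ->
  is_derive x t v (g x).
Proof.
move=> r0 cv cg Kt Kmu.
have Kx : K x by have := Kt 0; rewrite scale0r addr0 normr0; apply.
suff : h^-1 *: ((v \o shift x) (h *: t) - v x) @[h --> (0 : R)^'] --> g x.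
  by move=> vt; split; [exact: cvgP vt|exact: cvg_lim vt].
apply/cvgrPdist_le => /= e e0.
have [d d0 gd] : exists2 d : R, 0 < d & forall s k, `|s| < d -> `|k| < d ->
    K (x + s *: t + k *: mu) -> `|g x - g (x + s *: t + k *: mu)| < e.
  apply: (near_plane t mu (P := fun y => K y -> `|g x - g y| < e)).
  apply: (within_continuous_near cg Kx (U := ball (g x) e)).
  exact: nbhsx_ballx.
pose r1 := Num.min r d; have r10 : 0 < r1 by rewrite lt_min r0.
have gnear s k : `|s| < r1 -> 0 < k < r1 -> `|g x - g (x + s *: t + k *: mu)| < e.
  rewrite !lt_min => /andP[sr sd] /andP[k0 /andP[kr kd]].
  apply: gd => //; first by rewrite gtr0_norm.
  by apply: (proj1 (Kmu _ _ _ _)); rewrite ?k0.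
have vnear h : `|h| < r -> v (x + h *: t + k *: mu) @[k --> (0 : R)^'+] --> v (x + h *: t).
  move=> hr U vU; have Kh := Kt _ hr.
  have := within_continuous_near cv Kh vU.
  rewrite -{1}[x + h *: t]addr0 -(scale0r mu) => /near_line H.
  have : \forall k \near (0 : R)^'+, (K (x + h *: t + k *: mu) -> U (v (x + h *: t + k *: mu)))
      /\ 0 < k < r.
    near=> k; split; first by near: k; exact: cvg_within.
    by apply/andP; split; near: k; [exact: nbhs_right_gt|exact: nbhs_right_lt].
  by apply: filterS => k [Uk kr]; apply: Uk; have [] := Kmu _ _ hr kr.
(* The mean value inequality holds on the segment at each small height [k], with a bound independent
   of [k]; continuity of [v] within [K] allows [k] to tend to 0. *)
have key h : `|h| < r1 -> `|v (x + h *: t) - v x - h * g x| <= `|h| * e.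
  move=> hr1; have hr : `|h| < r by move: hr1; rewrite lt_min => /andP[].
  have lim : `|v (x + h *: t + k *: mu) - v (x + 0 *: t + k *: mu) - h * g x|
      @[k --> (0 : R)^'+] --> `|v (x + h *: t) - v (x + 0 *: t) - h * g x|.
    apply: cvg_norm; apply: cvgB; last exact: cvg_cst.
    by apply: cvgB; apply: vnear => //; rewrite normr0.
  rewrite scale0r addr0 in lim; apply: (ler_cvg_to lim (cvg_cst _)).
  near=> k; have k0r : 0 < k < r1.
    by apply/andP; split; near: k; [exact: nbhs_right_gt|exact: nbhs_right_lt].
  have sr s : Num.min 0 h <= s <= Num.max 0 h -> `|s| < r1.
    move=> /andP[s1 s2]; apply: le_lt_trans hr1; rewrite ler_norml.
    have := ler_norm h; have := ler_norm (- h); rewrite normrN => h1 h2.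
    move: s1 s2; have [h0|h0] := leP 0 h; last first.
      by rewrite ltr0_norm// in h1 h2 * => ? ?; apply/andP; split; lra.
    by rewrite ger0_norm// => ? ?; apply/andP; split; lra.
  have := @MVT_le (fun s => v (x + k *: mu + s *: t)) (fun s => g (x + k *: mu + s *: t))
    (g x) e 0 h.
  rewrite subr0 scale0r addr0 [x + k *: mu + h *: t]addrAC; apply=> s /sr sh.
    apply: is_derive_line; rewrite addrAC.
    move: sh k0r; rewrite !lt_min => /andP[sh _] /andP[k0 /andP[kr _]].
    by apply: (proj2 (Kmu _ _ sh _)); rewrite k0.
  by rewrite addrAC distrC ltW// gnear.
near=> h; have h0 : h != 0 by near: h; exact: nbhs_dnbhs_neq.
have hr : `|h| < r1 by near: h; apply: dnbhs0_lt.
have := key h hr; rewrite /= [_ *: t + x]addrC => kh.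
rewrite distrC -(ler_pM2l (_ : 0 < `|h|)) ?normr_gt0// -normrM mulrBr.
by rewrite [h * (_ *: _)]mulVKf.
Unshelve. all: by end_near.
Qed.

End boundary_derivatives.

(** * Orthonormal frames and cross products *)

Section orthonormal_frames.
Context {R : realType}.
Local Notation vec := 'rV[R]_3.
Implicit Types (a b c d n u v : vec).

Lemma vec3E (x y z : R) :
  ((vec3 x y z 0 i0 = x) * (vec3 x y z 0 i1 = y) * (vec3 x y z 0 i2 = z))%type.
Proof. by rewrite /vec3 /i0 /i1 /i2 !mxE !inordK. Qed.

Lemma cross_lagrange a b c d :
  dot (cross a b) (cross c d) = dot a c * dot b d - dot a d * dot b c.
Proof. by rewrite !dotE /cross !vec3E; ring. Qed.

Lemma dot_cross_cycle a b c : dot (cross a b) c = dot a (cross b c).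
Proof. by rewrite !dotE /cross !vec3E; ring. Qed.

Lemma dot_crossl a b : dot a (cross a b) = 0.
Proof. by rewrite !dotE /cross !vec3E; ring. Qed.

Lemma dot_crossr a b : dot b (cross a b) = 0.
Proof. by rewrite !dotE /cross !vec3E; ring. Qed.

Definition orthonormal a b c :=
  [/\ dot a a = 1, dot b b = 1 & dot c c = 1] /\
  [/\ dot a b = 0, dot a c = 0 & dot b c = 0].

(** A square matrix with orthonormal rows has orthonormal columns too, and this is the expansion of
    [v] in coordinates. *)
Lemma orthonormal_decomp a b c v : orthonormal a b c ->
  v = dot a v *: a + dot b v *: b + dot c v *: c.
Proof.
move=> [[aa bb cc] [ab ac bc]].
pose s (k : 'I_3) : vec := [:: a; b; c]`_k.
pose M : 'M[R]_3 := \matrix_(k, i) s k 0 i.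
have MM : M *m M^T = 1%:M.
  apply/matrixP => i j; rewrite !mxE.
  transitivity (dot (s i) (s j)); first by apply: eq_bigr => k _; rewrite !mxE.
  by case: i j => [[|[|[|//]]] ?] [[|[|[|//]]] ?]; rewrite /s/= ?[dot b a]dotC
    ?[dot c _]dotC.
have /matrixP MM' := mulmx1C MM.
apply/rowP => i; rewrite !mxE.
have -> : v 0 i = \sum_j v 0 j * (M^T *m M) j i.
  by rewrite (bigD1 i)//= big1 ?addr0 => [|j ji]; rewrite MM' mxE ?eqxx ?mulr1// (negbTE ji) mulr0.
have E (k : 'I_3) : s k 0 i * dot (s k) v = \sum_j v 0 j * (s k 0 j * s k 0 i).
  by rewrite mulr_sumr; apply: eq_bigr => j _; ring.
under eq_bigr do rewrite mxE big_ord3 !mxE !mulrDr.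
rewrite !big_split/= -!E /s /i0 /i1 /i2 !inordK//=; ring.
Qed.

Lemma dot_decomp a b c u v : orthonormal a b c ->
  dot u v = dot a u * dot a v + dot b u * dot b v + dot c u * dot c v.
Proof.
move=> o; rewrite {1}(orthonormal_decomp v o) !dotDr !dotZr ![dot u _]dotC; ring.
Qed.

(** The frames carry no orientation, hence the factor [s]; only its absolute value enters the
    Jacobians. *)
Lemma orthonormal_third a b c : orthonormal a b c ->
  exists2 s : R, `|s| = 1 & cross a b = s *: c.
Proof.
move=> o; have [[aa bb cc] [ab ac bc]] := o; exists (dot c (cross a b)).
  have := dot_decomp (cross a b) (cross a b) o.
  rewrite dot_crossl dot_crossr cross_lagrange aa bb ab !mul0r subr0 mulr1 !add0r => E.
  have : dot c (cross a b) ^+ 2 == 1 by rewrite expr2 -E.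
  by rewrite sqrf_eq1 => /orP[]/eqP ->; rewrite ?normrN normr1.
by rewrite {1}(orthonormal_decomp (cross a b) o) dot_crossl dot_crossr !scale0r !add0r.
Qed.

End orthonormal_frames.

(** * Null sets and sets of finite measure *)

Section null_sets.
Context {R : realType}.
Local Notation mR := (measurableTypeR R).

Lemma negligible_fin_bigcup d (X : measurableType d) (mu : {measure set X -> \bar R})
    (J : finType) (A : J -> set X) :
  (forall j, mu.-negligible (A j)) -> mu.-negligible (\bigcup_j A j).
Proof.
move=> A0; have -> : \bigcup_j A j = \big[setU/set0]_(j <- enum J) A j.
  rewrite -bigcup_seq; apply/seteqP; split=> x [j _ Aj]; exists j => //.
  by rewrite /= mem_enum.
by elim/big_ind: _ => //; [exact: negligible_set0|exact: negligibleU].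
Qed.

Lemma leb1_set1 (a : mR) : @leb1 R [set a] = 0%E.
Proof. exact: lebesgue_measure_set1. Qed.

Lemma leb2_line (a b c : R) : (a != 0) || (b != 0) ->
  (@leb2 R).-negligible [set y : mR * mR | a * y.1 + b * y.2 = c].
Proof.
move=> ab; set L := [set y | _].
have mL : measurable L.
  have -> : L = (fun y : mR * mR => a * y.1 + b * y.2 : mR) @^-1` [set c] by [].
  rewrite -[X in measurable X]setTI; apply: (_ : measurable_fun setT _) => //.
  by apply: measurable_funD; apply: measurable_funM.
exists L; split=> //; case/orP: ab => [a0|b0].
  rewrite leb2_ysection//; apply: integral0_eq => y _.
  rewrite (_ : ysection L y = [set (c - b * y) / a]) ?leb1_set1//.
  rewrite ysectionE; apply/seteqP; split=> x /=.
    by move=> <-; rewrite addrK mulrAC divff// mul1r.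
  by move=> ->; rewrite /L/= mulrCA divff// mulr1 subrK.
rewrite leb2_xsection//; apply: integral0_eq => y _.
rewrite (_ : xsection L y = [set (c - a * y) / b]) ?leb1_set1//.
rewrite xsectionE; apply/seteqP; split=> x /=.
  by move=> <-; rewrite addrAC subrr add0r mulrAC divff// mul1r.
by move=> ->; rewrite /L/= mulrCA divff// mulr1 addrC subrK.
Qed.

Definition box1 (C : R) : set mR := [set x : mR | `|x| <= C].

Lemma measurable_box1 C : measurable (box1 C).
Proof.
rewrite (_ : box1 C = [set` `[- C, C]%R]); first exact: measurable_itv.
by apply/seteqP; split=> x; rewrite /box1/= in_itv/= ler_norml.
Qed.

Lemma box1_fin C : (@leb1 R (box1 C) < +oo)%E.
Proof.
rewrite (_ : box1 C = [set` `[- C, C]%R]).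
  by rewrite /leb1 (lebesgue_measure_itv `[- C, C])/= lte_fin; case: ifP; rewrite ltry.
by apply/seteqP; split=> x; rewrite /box1/= in_itv/= ler_norml.
Qed.

Lemma leb1_bounded_fin (A : set mR) C : measurable A -> A `<=` box1 C -> (@leb1 R A < +oo)%E.
Proof.
move=> mA AC; apply: le_lt_trans (box1_fin C).
by apply: le_measure => //; rewrite inE//; exact: measurable_box1.
Qed.

Lemma box2_fin C : (@leb2 R (box1 C `*` box1 C) < +oo)%E.
Proof.
rewrite /leb2 product_measure1E; [|exact: measurable_box1..].
by rewrite lte_mul_pinfty// ?ge0_fin_numE//; exact: box1_fin.
Qed.

Lemma leb2_bounded_fin (A : set (mR * mR)) C : measurable A ->
  A `<=` box1 C `*` box1 C -> (@leb2 R A < +oo)%E.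
Proof.
move=> mA AC; apply: le_lt_trans (box2_fin C).
by apply: le_measure => //; rewrite inE//; apply: measurableX; exact: measurable_box1.
Qed.

Lemma leb3_bounded_fin (A : set (mR * mR * mR)) C : measurable A ->
  A `<=` box1 C `*` box1 C `*` box1 C -> (@leb3 R A < +oo)%E.
Proof.
move=> mA AC; apply: (@le_lt_trans _ _ (@leb3 R (box1 C `*` box1 C `*` box1 C))).
  apply: le_measure => //; rewrite inE//.
  by apply: measurableX; [apply: measurableX|]; exact: measurable_box1.
rewrite /leb3 product_measure1E; [|apply: measurableX|]; try exact: measurable_box1.
by rewrite lte_mul_pinfty// ?ge0_fin_numE//; [exact: box2_fin|exact: box1_fin].
Qed.

End null_sets.

(** * Polyhedra *)

Section polyhedron_regions.
Context {R : realType}.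
Local Notation vec := 'rV[R]_3.
Variables (T : polyhedron (R := R)) (o : frame T).
Implicit Types (f : faceT T) (e : edgeT T).

Lemma nout1 f : dot (nout f) (nout f) = 1.
Proof. exact/enormE1/nout_unit. Qed.

Lemma edge_face f e : e \in face_edges f -> edge e `<=` face f.
Proof.
move=> ef x ex; have : (\bigcup_(e in [set` face_edges f]) edge e) x by exists e.
by rewrite -face_boundary => -[].
Qed.

Lemma face_body f : face f `<=` T.
Proof.
move=> x fx; have : (\bigcup_f face (p := T) f) x by exists f.
by rewrite -body_boundary => -[].
Qed.

(** For [m = 0] relative openness is openness. The generic points of a face are its relative
    interior points: other faces meet it along edges only, and these lie outside the relative
    interior. *)
Lemma body_flat_region : flat_region T (T : set vec)° 0 xpredT (@face R T)
  (fun f => rel_interior (nout f) (face f)) (@face_pt R T) (@nout R T).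
Proof.
split.
- exact: body_compact.
- exact: body_regular.
- move=> x Tx; have := @nbhs_interior _ x T Tx; apply: filterS => y //.
- by move=> x y _ _; rewrite dot0l.
- by rewrite body_boundary; apply/seteqP; split=> x [f _ fx]; exists f.
- by move=> f _; exact: face_compact.
- by move=> f _; exact: face_ptP.
- by move=> f _; exact: nout_normal.
- by move=> f _; rewrite -dot_gt0 nout1.
- by move=> f _; rewrite dot0l.
- by move=> f _ x [].
- by move=> f x _; exact: nout_outward.
- move=> f g x _ _ fx gx; apply: contrapT => /eqP fg.
  have : (\bigcup_(e in [set` face_edges f]) edge e) x.
    by apply: (face_meet fg); split=> //; case: fx.
  by rewrite -face_boundary => -[].
Qed.

Lemma rel_interior_pt f : exists x, rel_interior (nout f) (face f) x.
Proof.
have : closure (rel_interior (nout f) (face f)) (face_pt f).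
  by rewrite -face_regular; exact: face_ptP.
by move=> /(_ setT filterT)[x [? _]]; exists x.
Qed.

Lemma nf1 f : dot (nf o f) (nf o f) = 1.
Proof. exact/enormE1/nf_unit. Qed.

(** The outward normal and the normal of the frame are given independently. They are parallel
    because a face has a relative interior point and therefore spans its plane. *)
Lemma nout_nf f : exists2 s : R, s ^+ 2 = 1 & nout f = s *: nf o f.
Proof.
have [x [fx /near_plane]] := rel_interior_pt f.
have n1 := nout1 f; have m1 := nf1 f; set n := nout f in n1 *; set m := nf o f in m1 *.
(* [t] is the part of [m] orthogonal to [n]. A small step along [t] stays in the face, so [m] is
   orthogonal to [t] as well, and [t] vanishes. *)
pose t := m - dot m n *: n; have nt : dot n t = 0.
  by rewrite dotBr dotZr n1 mulr1 [dot m n]dotC subrr.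
move=> /(_ t 0)[r r0 xr]; have r2 : `|r / 2| < r by rewrite gtr0_norm ?divr_gt0//; lra.
have /xr/(_ r2) : `|r / 2| < r by [].
rewrite scaler0 addr0 addrAC subrr add0r dotZr nt mulr0 => /(_ erefl) fy.
have := nf_normal o fx fy; rewrite addrAC subrr add0r dotZr => /eqP.
rewrite mulf_eq0 gt_eqF ?divr_gt0//= => /eqP mt.
have tt : t = 0.
  apply/eqP; rewrite -[_ == _]negbK -dot_gt0 -leNgt {1}/t dotBl dotZl mt nt.
  by rewrite mulr0 subrr.
have mE : m = dot m n *: n by apply/eqP; rewrite -subr_eq0; apply/eqP.
have ss : dot m n ^+ 2 = 1.
  by move: m1; rewrite {1}mE dotZl [dot n m]dotC -expr2.
exists (dot m n) => //.
by have := congr1 ( *:%R (dot m n)) mE; rewrite scalerA -expr2 ss scale1r.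
Qed.

Lemma edge_vec_neq0 e : vpos (tgt e) - vpos (src e) != 0.
Proof.
rewrite subr_eq0; apply/eqP => /vpos_inj H.
by have := edge_ends e; rewrite H eqxx.
Qed.

Lemma edge_len_gt0 e : 0 < edge_len e.
Proof. by rewrite /edge_len sqrtr_gt0 dot_gt0 edge_vec_neq0. Qed.

Lemma edge_vecE e : vpos (tgt e) - vpos (src e) = edge_len e *: edge_dir e.
Proof. by rewrite scalerA divff ?scale1r// gt_eqF// edge_len_gt0. Qed.

Lemma edge_dir1 e : dot (edge_dir e) (edge_dir e) = 1.
Proof.
have l0 := edge_len_gt0 e; rewrite /edge_dir dotZl dotZr mulrA -invfM -expr2 sqr_sqrtr.
  by rewrite mulVf// gt_eqF// dot_gt0 edge_vec_neq0.
by rewrite ltW// dot_gt0 edge_vec_neq0.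
Qed.

Lemma edgeP e (x : vec) :
  edge e x <-> exists2 s, 0 <= s <= edge_len e & x = vpos (src e) + s *: edge_dir e.
Proof.
have l0 := edge_len_gt0 e; split=> [[s /=]|[s /andP[s0 s1] ->]].
  rewrite in_itv/= => /andP[s0 s1] <-; exists (s * edge_len e).
    by rewrite mulr_ge0//= ?ler_piMl// ltW.
  by rewrite -scalerA -edge_vecE.
exists (s / edge_len e).
  by rewrite /= in_itv/= divr_ge0 ?ler_pdivrMr ?mul1r// ltW.
by rewrite edge_vecE scalerA divfK// gt_eqF.
Qed.

Lemma open_segmentP e (x : vec) :
  open_segment (vpos (src e)) (vpos (tgt e)) x <->
  exists2 s, 0 < s < edge_len e & x = vpos (src e) + s *: edge_dir e.
Proof.
have l0 := edge_len_gt0 e; split=> [[s /=]|[s /andP[s0 s1] ->]].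
  rewrite in_itv/= => /andP[s0 s1] <-; exists (s * edge_len e).
    by rewrite mulr_gt0//= gtr_pMl.
  by rewrite -scalerA -edge_vecE.
exists (s / edge_len e).
  by rewrite /= in_itv/= divr_gt0 ?ltr_pdivrMr ?mul1r.
by rewrite edge_vecE scalerA divfK// gt_eqF.
Qed.

Lemma edge_cases e (x : vec) : edge e x ->
  [\/ open_segment (vpos (src e)) (vpos (tgt e)) x, x = vpos (src e) | x = vpos (tgt e)].
Proof.
move=> /edgeP[s /andP[]]; rewrite le_eqVlt => /predU1P[<- _ ->|s0].
  by rewrite scale0r addr0; apply: Or32.
rewrite le_eqVlt => /predU1P[->|s1] xE.
  by apply: Or33; rewrite xE -edge_vecE addrC subrK.
by apply: Or31; apply/open_segmentP; exists s => //; rewrite s0.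
Qed.

Lemma src_edge e : edge e (vpos (src e)).
Proof. by apply/edgeP; exists 0; rewrite ?scale0r ?addr0// lexx ltW// edge_len_gt0. Qed.

Lemma tgt_edge e : edge e (vpos (tgt e)).
Proof.
apply/edgeP; exists (edge_len e); first by rewrite lexx ltW// edge_len_gt0.
by rewrite -edge_vecE addrC subrK.
Qed.

Lemma nf_edge_dir f e : e \in face_edges f -> dot (nf o f) (edge_dir e) = 0.
Proof.
move=> ef; rewrite /edge_dir dotZr.
have -> : dot (nf o f) (vpos (tgt e) - vpos (src e)) = 0; last by rewrite mulr0.
by apply: (nf_normal o); apply: (edge_face ef); [exact: src_edge|exact: tgt_edge].
Qed.

Definition conormal f e := cross (tbd o f e) (nf o f).

Lemma tbd1 f e : e \in face_edges f ->
  [/\ dot (tbd o f e) (tbd o f e) = 1, dot (nf o f) (tbd o f e) = 0 &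
    forall u, dot (tbd o f e) u = 0 <-> dot (edge_dir e) u = 0].
Proof.
move=> ef; have nd := nf_edge_dir ef.
have [->|->] := tbd_tangent o ef; first by rewrite edge_dir1.
rewrite dotNl !dotNr opprK edge_dir1 nd oppr0; split=> // u.
by rewrite dotNl; split=> [/eqP|->]; rewrite ?oppr0// oppr_eq0 => /eqP.
Qed.

Lemma conormal1 f e : e \in face_edges f ->
  dot (conormal f e) (conormal f e) = 1.
Proof.
move=> /tbd1[tt nt _]; rewrite cross_lagrange tt nf1 [dot _ (nf o f)]dotC nt; ring.
Qed.

Lemma conormal_dir f e : e \in face_edges f -> dot (conormal f e) (edge_dir e) = 0.
Proof.
by move=> /tbd1[_ _ E]; rewrite dotC; apply/E; rewrite dot_crossl.
Qed.

Lemma dot_nout f u : dot (nf o f) u = 0 -> dot (nout f) u = 0.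
Proof. by move=> nu; have [s _ ->] := nout_nf f; rewrite dotZl nu mulr0. Qed.

(** The normal is [nout f], which is the one that defines the relative interior. An interior point
    of an edge is generic because distinct edges meet only at common ends. *)
Lemma face_flat_region f : flat_region (face f) (rel_interior (nout f) (face f))
  (nout f) (mem (face_edges f)) (@edge R T)
  (fun e => open_segment (vpos (src e)) (vpos (tgt e))) (fun e => vpos (src e)) (conormal f).
Proof.
split.
- exact: face_compact.
- exact: face_regular.
- move=> x [fx nx]; have := nbhs_interior nx; apply: filterS => y ny xy.
  split; first exact: nbhs_singleton ny xy.
  apply: filterS ny => z + yz; apply.
  by rewrite -[z - x](subrKA y) dotDr yz add0r.
- exact: nout_normal.
- by rewrite face_boundary.
- move=> e _; rewrite /edge /segment; apply: continuous_compact; last exact: segment_compact.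
  by apply: continuous_subspaceT; exact: line_continuous.
- by move=> e _; exact: src_edge.
- move=> e ef x y /edgeP[s _ ->] /edgeP[r _ ->].
  rewrite opprD addrACA subrr add0r -scalerBl dotZr conormal_dir ?mulr0//.
- by move=> e ef; rewrite -dot_gt0 conormal1.
- by move=> e ef; apply: dot_nout; exact: dot_crossr.
- move=> e ef x [s]; rewrite /= in_itv/= => /andP[? ?] <-; exists s => //=.
  by rewrite in_itv/= !ltW.
- by move=> e x ef; exact: tbd_right_hand.
- move=> e e' x ef ef' ex e'x; apply: contrapT => /eqP ee'.
  have [s /andP[s0 s1] xE] := (open_segmentP e x).1 ex.
  have ex' : edge e x by apply/edgeP; exists s => //; rewrite !ltW.
  have [n [xn + _]] := edge_meet ee' ex' e'x; rewrite !inE => /orP[]/eqP nE.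
    move: xE; rewrite xn nE => /eqP; rewrite -subr_eq0 opprD addrA subrr sub0r oppr_eq0.
    rewrite scaler_eq0 gt_eqF//= => /eqP d0; have := edge_dir1 e.
    by rewrite d0 dot0l => /eqP; rewrite eq_sym oner_eq0.
  move: xE; rewrite xn nE => /eqP; rewrite -subr_eq0 opprD addrA edge_vecE -scalerBl.
  rewrite scaler_eq0 gt_eqF ?subr_gt0//= => /eqP d0; have := edge_dir1 e.
  by rewrite d0 dot0l => /eqP; rewrite eq_sym oner_eq0.
Qed.

End polyhedron_regions.

(** * Derivatives of a continuously differentiable function on faces and edges *)

Section C1_functions.
Context {R : realType}.
Local Notation vec := 'rV[R]_3.
Variables (T : polyhedron (R := R)) (o : frame T).
Implicit Types (f : faceT T) (e : edgeT T).

Lemma is_derive_grad (v : vec -> R) (x d : vec) : differentiable v x ->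
  is_derive x d v (dot (grad v x) d).
Proof.
move=> dv; split; first exact: diff_derivable.
rewrite deriveE// {1}[d]row_sum_delta linear_sum; apply: eq_bigr => i _.
by rewrite linearZ/= mxE /partial deriveE// mulrC.
Qed.

Variables (v : vec -> R) (g : vec -> vec).
Hypotheses (cv : {within T, continuous v}) (cg : {within T, continuous g}).
Hypothesis dv : forall x, (T : set vec)° x -> differentiable v x.
Hypothesis gE : forall x, (T : set vec)° x -> g x = grad v x.

Lemma within_continuous_dot d : {within T, continuous (fun x => dot (g x) d)}.
Proof.
have -> : (fun x => dot (g x) d) = dot d \o g by apply/funext => x; rewrite /= dotC.
exact: continuous_comp_within (@dot_continuous _ d) cg.
Qed.

Lemma is_derive_body x d : (T : set vec)° x -> is_derive x d v (dot (g x) d).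
Proof. by move=> Tx; rewrite gE//; exact/is_derive_grad/dv. Qed.

(** Pushing along [- nout f] leads from the face into the interior of the body, where [g] is the
    gradient. *)
Lemma is_derive_face f x t : rel_interior (nout f) (face f) x -> dot (nout f) t = 0 ->
  is_derive x t v (dot (g x) t).
Proof.
move=> fx nt; have n1 := nout1 f.
have [r r0 xr] := near_plane t (- nout f)
  (flat_region_local (body_flat_region T) (isT : xpredT f) fx).
have [r' r'0 xr'] := near_plane t 0 (proj2 fx).
apply: (@is_derive_boundary _ T v (fun y => dot (g y) t) x t (- nout f) (Num.min r r')) => //.
- by rewrite lt_min r0.
- exact: within_continuous_dot.
- move=> s; rewrite lt_min => /andP[_ sr']; apply: (@face_body _ _ f).
  have := xr' s 0 sr'; rewrite normr0 scale0r addr0 => /(_ r'0); apply.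
  by rewrite addrAC subrr add0r dotZr nt mulr0.
- move=> s e; rewrite !lt_min => /andP[sr _] /andP[e0 /andP[er _]].
  have er' : `|e| < r by rewrite gtr0_norm.
  have [_] := xr s e sr er' (dot0l _).
  rewrite add2_subl dotDr !dotZr dotNr nt n1 mulr0 add0r mulrN1 oppr_lt0.
  move=> /(_ e0) Ty; split; last exact: is_derive_body.
  exact: interior_subset.
Qed.

(** The same descent one dimension lower: minus the conormal leads from the edge into the relative
    interior of [f], where [is_derive_face] applies. *)
Lemma is_derive_edge f e x : e \in face_edges f ->
  open_segment (vpos (src e)) (vpos (tgt e)) x ->
  is_derive x (edge_dir e) v (dot (g x) (edge_dir e)).
Proof.
move=> ef ex; have nd : dot (nout f) (edge_dir e) = 0.
  by apply: (dot_nout (o := o)); exact: nf_edge_dir.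
have nm : dot (nout f) (conormal o f e) = 0 by apply: (dot_nout (o := o)); exact: dot_crossr.
have [r r0 xr] := near_plane (edge_dir e) (- conormal o f e)
  (flat_region_local (face_flat_region o f) ef ex).
have [u /andP[u0 ul] xE] := (open_segmentP e x).1 ex.
(* The distance to the nearer end of the edge. *)
pose r' := Num.min u (edge_len e - u).
have r'0 : 0 < r' by rewrite lt_min u0 subr_gt0.
apply: (@is_derive_boundary _ T v (fun y => dot (g y) (edge_dir e)) x (edge_dir e)
  (- conormal o f e) (Num.min r r')) => //.
- by rewrite lt_min r0.
- exact: within_continuous_dot.
- move=> s; rewrite lt_min => /andP[_ sr']; apply: (@face_body _ _ f); apply: (edge_face ef).
  apply/edgeP; exists (u + s); last by rewrite xE scalerDl addrA.
  move: sr'; rewrite lt_min !ltr_norml => /andP[/andP[? ?] /andP[? ?]].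
  by apply/andP; split; lra.
- move=> s k; rewrite !lt_min => /andP[sr _] /andP[k0 /andP[kr _]].
  have kr' : `|k| < r by rewrite gtr0_norm.
  have := xr s k sr kr'; rewrite add2_subl !(dotDr, dotZr s, dotZr k, dotNr) nd nm.
  rewrite conormal_dir// conormal1// !mulr0 oppr0 mulr0 !add0r mulrN1 oppr_lt0.
  move=> /(_ erefl)[_ /(_ k0) fy]; split; last exact: (is_derive_face fy).
  by apply: (@face_body _ _ f); case: fy.
Qed.

End C1_functions.

(** * The divergence theorem in one direction *)

Section direction_integrals.
Context {R : realType}.
Local Notation vec := 'rV[R]_3.
Local Notation mR := (measurableTypeR R).
Variables (T : polyhedron (R := R)) (o : frame T).
Implicit Types (f : faceT T) (e : edgeT T).

Lemma dot_bounded (K : set vec) u : compact K ->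
  exists2 C : R, 0 < C & forall x, K x -> `|dot u x| <= C.
Proof.
move=> cK; have cu : {within K, continuous (dot u)}.
  exact/continuous_subspaceT/dot_continuous.
have /compact_bounded[M [_ KM]] := continuous_compact cu cK.
exists (Num.max 1 (M + 1)) => [|x Kx]; first by rewrite lt_max ltr01.
by apply: (KM (Num.max 1 (M + 1))); [rewrite lt_max ltrDl ltr01 orbT|exists x].
Qed.

Lemma measurable_affine2 (a b c : vec) i :
  measurable_fun setT (fun y : mR * mR => (a + y.1 *: b + y.2 *: c) 0 i : mR).
Proof.
under eq_fun do rewrite !mxE.
apply: measurable_funD; last by apply: measurable_funM.
by apply: measurable_funD => //; apply: measurable_funM.
Qed.

Lemma dot_tf f : orthonormal (tf1 o f) (tf2 o f) (nf o f).
Proof.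
split; split; try exact: nf1.
- exact/enormE1/tf1_unit.
- exact/enormE1/tf2_unit.
- exact: tf_orth.
- by rewrite dotC; exact: tf1_tangent.
- by rewrite dotC; exact: tf2_tangent.
Qed.

Lemma dot_bounded2 (K : set vec) (a u : vec) : compact K ->
  exists2 C : R, 0 < C & forall x, K x -> `|dot u (x - a)| <= C.
Proof.
move=> cK; have [C C0 KC] := dot_bounded u cK.
exists (C + `|dot u a|) => [|x Kx]; first by rewrite ltr_wpDr.
by rewrite dotBr (le_trans (ler_normB _ _))// lerD2r KC.
Qed.

Lemma plane_coord_fin (K : set vec) (a b c n : vec) : compact K -> orthonormal b c n ->
  (@leb2 R [set p : mR * mR | K (a + p.1 *: b + p.2 *: c)%R] < +oo)%E.
Proof.
move=> cK [[bb cc _] [bc _ _]].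
have [C C0 KC] := dot_bounded2 a b cK; have [D D0 KD] := dot_bounded2 a c cK.
have mK : measurable [set p : mR * mR | K (a + p.1 *: b + p.2 *: c)].
  exact: (measurable_preimage_compact (measurable_affine2 a b c) cK).
apply: (leb2_bounded_fin (C := C + D)) => // p Kp.
have := KC _ Kp; have := KD _ Kp.
rewrite add2_subl !dotDr !dotZr bb cc bc [dot c b]dotC bc !mulr0 !mulr1 addr0 add0r => h1 h2.
by split; rewrite /box1/=; lra.
Qed.

Lemma measurable_face f : measurable (face_coord o f @^-1` face f).
Proof.
apply: (measurable_preimage_compact (c := face_coord o f)); last exact: face_compact.
exact: measurable_affine2.
Qed.

Lemma integrable_face f w : {within face f, continuous w} ->
  (@leb2 R).-integrable (face_coord o f @^-1` face f) (EFin \o (w \o face_coord o f)).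
Proof.
move=> cw; apply: (integrable_compact (c := face_coord o f)) => //.
- exact: measurable_affine2.
- exact: plane_coord_fin (@face_compact _ _ f) (dot_tf f).
- exact: face_compact.
Qed.


Section space.
Variables (b1 b2 b3 : vec).
Hypothesis ob : orthonormal b1 b2 b3.

Let b (y : mR * mR) : vec := y.1 *: b1 + y.2 *: b2.

Lemma measurable_base i : measurable_fun setT (fun y => b y 0 i : mR).
Proof.
under eq_fun do rewrite !mxE.
by apply: measurable_funD; apply: measurable_funM.
Qed.

Lemma dot_base y s : [/\ dot b1 (b y + s *: b3) = y.1, dot b2 (b y + s *: b3) = y.2 &
  dot b3 (b y + s *: b3) = s].
Proof.
have [[b11 b22 b33] [b12 b13 b23]] := ob.
by rewrite !dotDr !dotZr b11 b22 b33 [dot b2 b1]dotC [dot b3 b1]dotC [dot b3 b2]dotC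
  b12 b13 b23; split; ring.
Qed.

Lemma dot_base0 u y : dot u (b y) = dot u b1 * y.1 + dot u b2 * y.2.
Proof. by rewrite dotDr !dotZr ![_ * dot u _]mulrC. Qed.

Lemma base_coords x : let y := (dot b1 x, dot b2 x) in b y + dot b3 x *: b3 = x.
Proof. by rewrite /b/= -(orthonormal_decomp x ob). Qed.

Lemma measurable_space i :
  measurable_fun setT (fun p : mR * mR * mR => (b p.1 + p.2 *: b3) 0 i : mR).
Proof.
under eq_fun do rewrite mxE [(_ *: b3) _ _]mxE.
apply: measurable_funD; last by apply: measurable_funM.
exact: (measurableT_comp (measurable_base i)).
Qed.

Lemma body_coord_fin :
  (@leb3 R [set p : mR * mR * mR | (T : set vec) (b p.1 + p.2 *: b3)%R] < +oo)%E.
Proof.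
have cT : compact T := @body_compact _ T.
have [C1 C10 K1] := dot_bounded b1 cT; have [C2 C20 K2] := dot_bounded b2 cT.
have [C3 C30 K3] := dot_bounded b3 cT.
apply: (leb3_bounded_fin (C := C1 + C2 + C3)).
  exact: (measurable_preimage_compact measurable_space cT).
move=> p Tp; have [E1 E2 E3] := dot_base p.1 p.2.
have := K1 _ Tp; have := K2 _ Tp; have := K3 _ Tp; rewrite E1 E2 E3 => h3 h2 h1.
by split; [split|]; rewrite /box1/=; lra.
Qed.

Lemma face_base_fin f (s : mR * mR -> R) :
  measurable [set y | face f (b y + s y *: b3)] ->
  (@leb2 R [set y | face f (b y + s y *: b3)%R] < +oo)%E.
Proof.
move=> mD; have cf := @face_compact _ _ f.
have [C1 C10 K1] := dot_bounded b1 cf; have [C2 C20 K2] := dot_bounded b2 cf.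
apply: (leb2_bounded_fin (C := C1 + C2)) => // y fy.
have [E1 E2 _] := dot_base y (s y).
have := K1 _ fy; have := K2 _ fy; rewrite E1 E2 => h2 h1.
by split; rewrite /box1/=; lra.
Qed.

(** Projecting a point of the plane of [f] along [b3] and lifting it back to that plane returns the
    point, as [b3] is transversal to the plane. *)
Lemma face_crossing f p : dot (nout f) b3 != 0 ->
  let y := (dot b1 (face_coord o f p), dot b2 (face_coord o f p)) in
  b y + crossing (@face_pt R T) (@nout R T) b3 (b y) f *: b3 = face_coord o f p.
Proof.
move=> nb; have := base_coords (face_coord o f p).
set x := face_coord o f p => /= xE; set y := (_, _) in xE *.
suff -> : crossing (@face_pt R T) (@nout R T) b3 (b y) f = dot b3 x by [].
have nx : dot (nout f) (x - face_pt f) = 0.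
  rewrite /x /face_coord add2_subl dotDr !dotZr (dot_nout (tf1_tangent o f)).
  by rewrite (dot_nout (tf2_tangent o f)) !mulr0 addr0.
have -> : b y = x - dot b3 x *: b3 by apply/eqP; rewrite eq_sym subr_eq xE.
rewrite /crossing opprB addrCA -opprB dotBr nx subr0 dotZr mulfK//.
Qed.

(** By Lagrange's identity the determinant of the projection is a dot product of two cross products,
    which up to sign are [b3] and the normal of [f]. *)
Lemma projection_det f :
  `|dot b1 (tf1 o f) * dot b2 (tf2 o f) - dot b1 (tf2 o f) * dot b2 (tf1 o f)| =
  `|dot (nout f) b3|.
Proof.
rewrite -cross_lagrange; have [s s1 ->] := orthonormal_third ob.
have [t t1 ->] := orthonormal_third (dot_tf f).
have [r r2 ->] := nout_nf o f.
have r1 : `|r| = 1.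
  by move/eqP: r2; rewrite sqrf_eq1 => /orP[]/eqP ->; rewrite ?normrN normr1.
by rewrite !dotZl dotZr !normrM s1 t1 r1 !mul1r dotC.
Qed.

(** The factor is the cosine of the angle between the face and the base plane, the ratio by which
    projection shrinks areas. *)
Lemma face_projection f w : {within face f, continuous w} -> dot (nout f) b3 != 0 ->
  let c y := b y + crossing (@face_pt R T) (@nout R T) b3 (b y) f *: b3 in
  \int[@leb2 R]_(y in [set y | face f (c y)]) w (c y) =
  `|dot (nout f) b3| * int_face o f w.
Proof.
move=> cw nb c; have mc i : measurable_fun setT (fun y => c y 0 i).
  by apply: measurable_crossing => k; exact: measurable_base.
have mD : measurable [set y | face f (c y)].
  exact: (measurable_preimage_compact mc (@face_compact _ _ f)).
have iw : (@leb2 R).-integrable [set y | face f (c y)] (EFin \o (w \o c)).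
  by apply: integrable_compact => //; [exact: face_base_fin|exact: face_compact].
pose phi p : mR * mR := (dot b1 (face_coord o f p), dot b2 (face_coord o f p)).
have sphi : scaling (@leb2 R) phi `|dot (nout f) b3|.
  rewrite -projection_det.
  apply: (@eq_scaling _ _ _ _ _ _ _ _ _ erefl (@scaling_affine2 R _ _ _ _
    (dot b1 (face_pt f)) (dot b2 (face_pt f)) _)) => [p|].
    by rewrite /phi /face_coord !dotDr !dotZr; congr pair; ring.
  by rewrite -normr_gt0 projection_det normr_gt0.
rewrite (integral_scaling sphi mD iw); congr (_ * _).
rewrite /int_face; have E p : c (phi p) = face_coord o f p by exact: face_crossing.
congr (fine (integral _ _ _)); last by apply/funext => p; rewrite /= E.
by apply/seteqP; split=> p; rewrite /= E.
Qed.

Lemma base_neq0 u : u != 0 -> dot u b3 = 0 -> (dot u b1 != 0) || (dot u b2 != 0).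
Proof.
move=> u0 u3; rewrite -negb_and; apply: contra u0 => /andP[/eqP u1 /eqP u2].
rewrite -[_ == _]negbK -dot_gt0 (dot_decomp u u ob) ![dot _ u]dotC u1 u2 u3.
by rewrite !mul0r !addr0 ltxx.
Qed.

(* The projection along [b3] of the line carrying an edge lies in a line, even
   when the edge is parallel to [b3]. *)
Lemma edge_shadow e :
  exists a : vec, [/\ a != 0, dot a b3 = 0 & dot a (edge_dir e) = 0].
Proof.
have [E|E] := eqVneq (cross b3 (edge_dir e)) 0; last first.
  exists (cross b3 (edge_dir e)); split=> //.
    by rewrite dotC dot_crossl.
  by rewrite dotC dot_crossr.
have [[b11 b22 b33] [b12 b13 b23]] := ob; exists b1; split=> //.
  by rewrite -dot_gt0 b11.
have := cross_lagrange b3 (edge_dir e) b3 (edge_dir e).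
rewrite E dot0l b33 edge_dir1 [dot (edge_dir e) b3]dotC.
have := dot_decomp (edge_dir e) (edge_dir e) ob; rewrite edge_dir1 => H1 H2.
have : dot b1 (edge_dir e) ^+ 2 = 0.
  have := sqr_ge0 (dot b1 (edge_dir e)); have := sqr_ge0 (dot b2 (edge_dir e)).
  by rewrite !expr2; lra.
by move/eqP; rewrite sqrf_eq0 => /eqP.
Qed.

(** The coefficient of each face is assembled from two sources: its sign from the sense in which the
    lines cross the face, its absolute value from the area ratio of the projection. *)
Lemma divergence_direction w h : {within T, continuous w} -> {within T, continuous h} ->
  (forall x, (T : set vec)° x -> is_derive x b3 w (h x)) ->
  \int[@leb3 R]_(p in [set p : mR * mR * mR | (T : set vec) (b p.1 + p.2 *: b3)])
    h (b p.1 + p.2 *: b3) = \sum_f dot (nout f) b3 * int_face o f w.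
Proof.
move=> cw ch dw; have [[b11 b22 b33] [b12 b13 b23]] := ob.
have b30 : b3 != 0 by rewrite -dot_gt0 b33.
have [a aP] := choice edge_shadow.
(* The bad lines are those meeting an edge or a face parallel to [b3]; their base points lie on
   finitely many lines of the base plane. *)
pose L u x : set (mR * mR) := [set y | dot u b1 * y.1 + dot u b2 * y.2 = dot u x].
pose N := (\bigcup_(e in [set: edgeT T]) L (a e) (vpos (src e))) `|`
  (\bigcup_(f in [set: faceT T]) (if dot (nout f) b3 == 0 then L (nout f) (face_pt f) else set0)).
have N0 : (product_sigma_finite (@leb1 R) (@leb1 R)).-negligible N.
  apply: negligibleU; first apply: negligible_fin_bigcup => e.
    by apply: leb2_line; have [a0 a3 _] := aP e; exact: base_neq0.
  apply: negligible_fin_bigcup => f.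
  case: eqP => [n3|_]; last exact: negligible_set0.
  by apply: leb2_line; apply: base_neq0 => //; rewrite -dot_gt0 nout1.
have Lb u y x : dot u b3 = 0 -> (L u x y <-> dot u (b y) = dot u x).
  by rewrite dot_base0.
have H := @Rintegral_flat_region _ _ _ _ _ _ _ _ _ _ (body_flat_region T) w h b3 b30
  (dot0l _) cw ch dw _ (mR * mR)%type (product_sigma_finite (@leb1 R) (@leb1 R)) b N
  measurable_base (fun _ _ _ => dot0l _).
apply: etrans (H body_coord_fin _ N0 _) _ => {H}.
- move=> f _ _; apply: face_base_fin.
  apply: (measurable_preimage_compact _ (@face_compact _ _ f)) => i.
  by apply: measurable_crossing => k; exact: measurable_base.
- move=> y Ny f s _ fy; have nb : dot (nout f) b3 != 0.
    apply/eqP => n3; apply: Ny; right; exists f => //; rewrite n3 eqxx.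
    apply/(Lb _ _ _ n3); have := nout_normal fy (face_ptP f).
    rewrite opprD addrA !dotBr dotZr n3 mulr0 subr0 => /eqP; rewrite subr_eq0 => /eqP ->//.
  split=> //; apply: contrapT => nfy.
  have [e _ ey] : (\bigcup_(e in [set` face_edges f]) edge e) (b y + s *: b3).
    by rewrite -face_boundary.
  have [a0 a3 ad] := aP e; apply: Ny; left; exists e => //; apply/(Lb _ _ _ a3).
  have [r _ E] := (edgeP e _).1 ey.
  have -> : b y = vpos (src e) + r *: edge_dir e - s *: b3.
    by apply/eqP; rewrite eq_sym subr_eq -E.
  by rewrite dotBr dotDr (dotZr r) (dotZr s) a3 ad !mulr0 addr0 subr0.
- rewrite big_mkcond; apply: eq_bigr => f _ /=.
  case: eqP => [->|/eqP nb]; first by rewrite mul0r.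
  have cwf : {within face f, continuous w} by apply: continuous_subspaceW cw; exact: face_body.
  have := face_projection cwf nb => /= ->.
  by rewrite mulrA -numEsg.
Qed.

Lemma integrable_body h : {within T, continuous h} ->
  (@leb3 R).-integrable [set p : mR * mR * mR | (T : set vec) (b p.1 + p.2 *: b3)%R]
    (EFin \o (fun p => h (b p.1 + p.2 *: b3))).
Proof.
move=> ch; apply: (integrable_compact measurable_space body_coord_fin _ ch).
exact: body_compact.
Qed.

End space.

Definition int_basis (b1 b2 b3 : vec) (h : vec -> R) : R :=
  \int[@leb3 R]_(p in [set p : mR * mR * mR |
      (T : set vec) (p.1.1 *: b1 + p.1.2 *: b2 + p.2 *: b3)])
    h (p.1.1 *: b1 + p.1.2 *: b2 + p.2 *: b3).

(** Cyclic shifts bring each axis to the third place, the direction in which [divergence_direction]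
    differentiates. *)
Lemma int_basis_cycle b1 b2 b3 h : orthonormal b1 b2 b3 -> {within T, continuous h} ->
  int_basis b1 b2 b3 h = int_basis b3 b1 b2 h.
Proof.
move=> ob ch; have ih := integrable_body ob ch.
have mT : measurable [set p : mR * mR * mR |
    (T : set vec) (p.1.1 *: b1 + p.1.2 *: b2 + p.2 *: b3)].
  by apply: (measurable_preimage_compact (measurable_space b1 b2 b3)); exact: body_compact.
rewrite /int_basis (integral_scaling (scaling_cycle (@leb1 R)) mT ih) mul1r.
have E (p : mR * mR * mR) : p.1.2 *: b1 + p.2 *: b2 + p.1.1 *: b3 =
    p.1.1 *: b3 + p.1.2 *: b1 + p.2 *: b2 by rewrite addrC addrA.
congr (fine (integral _ _ _)); last by apply/funext => p; rewrite /= E.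
by apply/seteqP; split=> p /=; rewrite E.
Qed.

Lemma ei_orthonormal : orthonormal (ei i0) (ei i1) (ei i2 : vec).
Proof.
have E i j : dot (ei i) (ei j) = (i == j)%:R :> R.
  rewrite /dot (bigD1 i)//= big1 ?addr0 /ei => [|k ki]; rewrite !mxE ?eqxx//= ?mul1r//.
  by rewrite (negbTE ki) mul0r.
have D : (i0 == i1) = false /\ (i0 == i2) = false /\ (i1 == i2) = false.
  by rewrite /i0 /i1 /i2 -!val_eqE /= !inordK.
by case: D => [D1 [D2 D3]]; split; split; rewrite E ?eqxx ?D1 ?D2 ?D3.
Qed.

Lemma dot_ei i (x : vec) : dot (ei i) x = x 0 i.
Proof.
rewrite /dot (bigD1 i)//= big1 ?addr0 /ei => [|l li]; rewrite !mxE ?eqxx ?mul1r//=.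
by rewrite (negbTE li) mul0r.
Qed.

Lemma int_volE h : int_vol T h = int_basis (ei i0) (ei i1) (ei i2) h.
Proof.
have E (p : mR * mR * mR) : coord3 p = p.1.1 *: ei i0 + p.1.2 *: ei i1 + p.2 *: ei i2.
  apply/rowP => i; rewrite (orthonormal_decomp (coord3 p) ei_orthonormal).
  by rewrite !dot_ei /coord3 !vec3E.
rewrite /int_vol /int_basis; congr (fine (integral _ _ _)).
  by apply/seteqP; split=> p /=; rewrite E.
by apply/funext => p; rewrite E.
Qed.

Lemma ord3P (P : 'I_3 -> Prop) : P i0 -> P i1 -> P i2 -> forall i, P i.
Proof.
move=> P0 P1 P2 i; have : i \in [:: i0; i1; i2].
  by case: i => [[|[|[|//]]] ?]; rewrite !inE /i0 /i1 /i2 -!val_eqE /= !inordK.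
by rewrite !inE => /or3P[]/eqP ->.
Qed.

Lemma int_vol_direction i w h : {within T, continuous w} -> {within T, continuous h} ->
  (forall x, (T : set vec)° x -> is_derive x (ei i) w (h x)) ->
  int_vol T h = \sum_f dot (nout f) (ei i) * int_face o f w.
Proof.
have o012 := ei_orthonormal; have [[e00 e11 e22] [e01 e02 e12]] := o012.
have o201 : orthonormal (ei i2) (ei i0) (ei i1 : vec).
  by split; split=> //; rewrite dotC.
have o120 : orthonormal (ei i1) (ei i2) (ei i0 : vec).
  by split; split=> //; rewrite dotC.
move=> cw ch; rewrite int_volE; move: i; apply: ord3P => dw.
- rewrite (int_basis_cycle o012 ch) (int_basis_cycle o201 ch).
  exact: divergence_direction.
- by rewrite (int_basis_cycle o012 ch); exact: divergence_direction.
- exact: divergence_direction.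
Qed.

End direction_integrals.

(** * Green's theorem in one direction of a face *)

Section face_integrals.
Context {R : realType}.
Local Notation vec := 'rV[R]_3.
Local Notation mR := (measurableTypeR R).
Variables (T : polyhedron (R := R)) (o : frame T) (f : faceT T).
Implicit Types (e : edgeT T).

Section plane.
Variables (t1 t2 : vec).
Hypothesis ot : orthonormal t1 t2 (nf o f).

Let b (y : mR) : vec := face_pt f + y *: t1.

Lemma measurable_plane_base i : measurable_fun setT (fun y => b y 0 i : mR).
Proof.
by under eq_fun do rewrite !mxE; apply: measurable_funD => //; apply: measurable_funM.
Qed.

Lemma plane_coord1 y s : dot t1 (b y + s *: t2 - face_pt f) = y.
Proof.
have [[t11 _ _] [t12 _ _]] := ot.
by rewrite add2_subl dotDr !dotZr t11 t12 mulr0 mulr1 addr0.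
Qed.

(** In the plane of the face a quarter turn carries the edge direction to the conormal and [t1] to
    [t2], up to signs, so the two cosines have the same absolute value. *)
Lemma conormal_plane e : e \in face_edges f ->
  `|dot t1 (edge_dir e)| = `|dot (conormal o f e) t2|.
Proof.
move=> ef; have [[t11 t22 nn] [t12 t1n t2n]] := ot.
have on : orthonormal (nf o f) t2 t1 by split; split; rewrite // dotC.
have [s s1 E] := orthonormal_third on.
rewrite /conormal dot_cross_cycle E dotZr normrM s1 mul1r [dot (tbd o f e) _]dotC.
by have [->|->] := tbd_tangent o ef; rewrite ?dotNr ?normrN.
Qed.

Lemma edge_plane e r : e \in face_edges f -> let x := vpos (src e) + r *: edge_dir e in
  dot (nf o f) (x - face_pt f) = 0.
Proof.
move=> ef; rewrite /= addrAC dotDr dotZr (nf_edge_dir _ ef) mulr0 addr0.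
by apply: (nf_normal o (face_ptP f)); apply: (edge_face ef); exact: src_edge.
Qed.

Lemma edge_crossing e r : e \in face_edges f -> dot (conormal o f e) t2 != 0 ->
  let x := vpos (src e) + r *: edge_dir e in let y := dot t1 (x - face_pt f) in
  b y + crossing (fun e => vpos (src e)) (conormal o f) t2 (b y) e *: t2 = x.
Proof.
move=> ef mt x y; have nx := edge_plane r ef.
have := orthonormal_decomp (x - face_pt f) ot; rewrite nx scale0r addr0 -/y => xE.
have by_ : b y = x - dot t2 (x - face_pt f) *: t2.
  apply/eqP; rewrite eq_sym subr_eq /b -addrA -xE addrC subrK//.
suff -> : crossing (fun e => vpos (src e)) (conormal o f) t2 (b y) e =
    dot t2 (x - face_pt f) by rewrite by_ subrK.
have mx : dot (conormal o f e) (vpos (src e) - x) = 0.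
  by rewrite /x opprD addrA subrr sub0r dotNr (dotZr r) conormal_dir// mulr0 oppr0.
move: (dot t2 _) by_ => k by_.
by rewrite /crossing by_ opprB addrCA dotDr mx addr0 (dotZr k) mulfK.
Qed.

Lemma edge_base_fin e (s : mR -> R) : measurable [set y | edge e (b y + s y *: t2)] ->
  (@leb1 R [set y | edge e (b y + s y *: t2)%R] < +oo)%E.
Proof.
move=> mD; have cE : compact (edge e).
  rewrite /edge /segment; apply: continuous_compact; last exact: segment_compact.
  by apply: continuous_subspaceT; exact: line_continuous.
have [C C0 KC] := dot_bounded2 (face_pt f) t1 cE.
apply: (leb1_bounded_fin (C := C)) => // y ey.
by have := KC _ ey; rewrite plane_coord1.
Qed.

Lemma edge_projection e w : e \in face_edges f -> {within edge e, continuous w} ->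
  dot (conormal o f e) t2 != 0 ->
  let c y := b y + crossing (fun e => vpos (src e)) (conormal o f) t2 (b y) e *: t2 in
  \int[@leb1 R]_(y in [set y | edge e (c y)]) w (c y) =
  `|dot (conormal o f e) t2| * int_edge e w.
Proof.
move=> ef cw mt c; have cE : compact (edge e) := fr_piece (face_flat_region o f) ef.
have mc i : measurable_fun setT (fun y => c y 0 i).
  by apply: measurable_crossing => k; exact: measurable_plane_base.
have mD : measurable [set y | edge e (c y)] := measurable_preimage_compact mc cE.
have iw : (@leb1 R).-integrable [set y | edge e (c y)] (EFin \o (w \o c)).
  by apply: integrable_compact => //; exact: edge_base_fin.
pose phi (r : mR) : mR := dot t1 (vpos (src e) + r *: edge_dir e - face_pt f).
have sphi : scaling (@leb1 R) phi `|dot (conormal o f e) t2|.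
  rewrite -(conormal_plane ef).
  apply: (@eq_scaling _ _ _ _ _ _ _ _ _ erefl (@scaling_affine1 R _
    (dot t1 (vpos (src e) - face_pt f)) _)) => [r|].
    by rewrite /phi (addrAC _ (r *: _)) [RHS]dotDr (dotZr r) [RHS]addrC [r * _]mulrC.
  by rewrite -normr_gt0 (conormal_plane ef) normr_gt0.
rewrite (integral_scaling sphi mD iw); congr (_ * _).
have E r : c (phi r) = vpos (src e) + r *: edge_dir e by exact: edge_crossing.
rewrite /int_edge; congr (fine (integral _ _ _)); last by apply/funext => r; rewrite /= E.
apply/seteqP; split=> r /=; rewrite E in_itv/= => H; last by apply/edgeP; exists r.
have [s se] := (edgeP e _).1 H; move/addrI/eqP; rewrite -subr_eq0 -scalerBl scaler_eq0.
rewrite -[edge_dir e == 0]negbK -dot_gt0 edge_dir1 ltr01 orbF subr_eq0 => /eqP ->.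
exact: se.
Qed.

Lemma stokes_direction w h : {within face f, continuous w} -> {within face f, continuous h} ->
  (forall x, rel_interior (nout f) (face f) x -> is_derive x t2 w (h x)) ->
  \int[@leb2 R]_(p in [set p : mR * mR | face f (b p.1 + p.2 *: t2)]) h (b p.1 + p.2 *: t2) =
  \sum_(e in face_edges f) dot (conormal o f e) t2 * int_edge e w.
Proof.
move=> cw ch dw; have [[t11 t22 nn] [t12 t1n t2n]] := ot.
have t20 : t2 != 0 by rewrite -dot_gt0 t22.
have mt2 : dot (nout f) t2 = 0 by apply: (dot_nout (o := o)); rewrite dotC.
have mt1 : dot (nout f) t1 = 0 by apply: (dot_nout (o := o)); rewrite dotC.
(* The bad lines are those through an end of an edge. This covers edges parallel to [t2], whose
   points all have the [t1]-coordinate of the source. *)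
pose N : set mR := \bigcup_(e in [set: edgeT T]) ([set dot t1 (vpos (src e) - face_pt f)] `|`
  [set dot t1 (vpos (tgt e) - face_pt f)]).
have N0 : (@leb1 R).-negligible N.
  apply: negligible_fin_bigcup => e; apply: negligibleU.
    by apply/negligibleP; [exact: measurable_set1|exact: leb1_set1].
  by apply/negligibleP; [exact: measurable_set1|exact: leb1_set1].
have mK y x : face f x -> dot (nout f) (x - b y) = 0.
  move=> fx; rewrite /b opprD addrA dotBr dotZr mt1 mulr0 subr0.
  exact: (nout_normal (face_ptP f)).
have H := @Rintegral_flat_region _ _ _ _ _ _ _ _ _ _ (face_flat_region o f) w h t2 t20
  mt2 cw ch dw _ mR (@leb1 R) b N measurable_plane_base mK.
apply: etrans (H (plane_coord_fin (face_pt f) (@face_compact _ _ f) ot) _ N0 _) _ => {H}.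
- move=> e ef _; apply: edge_base_fin.
  apply: (measurable_preimage_compact _ (fr_piece (face_flat_region o f) ef)) => i.
  by apply: measurable_crossing => k; exact: measurable_plane_base.
- move=> y Ny e s ef ey; have yE := plane_coord1 y s; split.
    have [//|xE|xE] := edge_cases ey; exfalso; apply: Ny; exists e => //; [left|right].
      by rewrite /= -yE xE.
    by rewrite /= -yE xE.
  rewrite -normr_gt0 -(conormal_plane ef) normr_gt0; apply/eqP => td.
  apply: Ny; exists e => //; left; rewrite /= -yE.
  have [r _ ->] := (edgeP e _).1 ey.
  by rewrite (addrAC _ (r *: _)) [LHS]dotDr (dotZr r) td mulr0 addr0.
- rewrite big_mkcond [RHS]big_mkcond; apply: eq_bigr => e _ /=.
  case: ifPn => [/andP[ef mt]|].
    have cwe : {within edge e, continuous w}.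
      by apply: continuous_subspaceW cw; exact: edge_face.
    have := edge_projection ef cwe mt => /= ->.
    by rewrite ef mulrA -numEsg.
  by case: (e \in face_edges f) => //=; rewrite negbK => /eqP ->; rewrite mul0r.
Qed.

End plane.

Lemma int_face_tf2 w h : {within face f, continuous w} -> {within face f, continuous h} ->
  (forall x, rel_interior (nout f) (face f) x -> is_derive x (tf2 o f) w (h x)) ->
  int_face o f h = \sum_(e in face_edges f) dot (conormal o f e) (tf2 o f) * int_edge e w.
Proof. by move=> cw ch dw; rewrite -(stokes_direction (dot_tf o f) cw ch dw). Qed.

Lemma int_face_tf1 w h : {within face f, continuous w} -> {within face f, continuous h} ->
  (forall x, rel_interior (nout f) (face f) x -> is_derive x (tf1 o f) w (h x)) ->
  int_face o f h = \sum_(e in face_edges f) dot (conormal o f e) (tf1 o f) * int_edge e w.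
Proof.
move=> cw ch dw; have [[t11 t22 nn] [t12 t1n t2n]] := dot_tf o f.
(* Exchanging the tangents makes [tf1 o f] the direction of the lines; the swap of coordinates has
   Jacobian 1. *)
have ot : orthonormal (tf2 o f) (tf1 o f) (nf o f) by split; split; rewrite // dotC.
rewrite -(stokes_direction ot cw ch dw) /int_face.
rewrite (integral_scaling (@scaling_swap R) (measurable_face o f) (integrable_face o ch)).
rewrite mul1r; have E (p : mR * mR) : face_coord o f (p.2, p.1) =
    face_pt f + p.1 *: tf2 o f + p.2 *: tf1 o f by rewrite /face_coord addrAC.
congr (fine (integral _ _ _)); last by apply/funext => p; rewrite /= E.
by apply/seteqP; split=> p /=; rewrite E.
Qed.

End face_integrals.

(** * Projections onto polynomials *)

Section positive_functionals.
Context {R : realType}.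
Local Notation vec := 'rV[R]_3.

Lemma within_continuousZD (D : set vec) a (u w : vec -> R) :
  {within D, continuous u} -> {within D, continuous w} ->
  {within D, continuous (fun x => a * u x + w x)}.
Proof.
move=> cu cw x; apply: cvgD; last exact: cw.
by apply: cvgM; [exact: cvg_cst|exact: cu].
Qed.

Lemma within_continuousM (D : set vec) (u w : vec -> R) :
  {within D, continuous u} -> {within D, continuous w} ->
  {within D, continuous (fun x => u x * w x)}.
Proof. by move=> cu cw x; apply: cvgM; [exact: cu|exact: cw]. Qed.

Lemma within_continuousC (D : set vec) (c : R) : {within D, continuous (fun=> c)}.
Proof. by move=> x; exact: cvg_cst. Qed.

Lemma within_continuous_sum (D : set vec) I (r : seq I) (P : pred I) (F : I -> vec -> R) :
  (forall i, P i -> {within D, continuous (F i)}) ->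
  {within D, continuous (fun x => \sum_(i <- r | P i) F i x)}.
Proof.
move=> cF; elim: r => [|i r IH].
  by under eq_fun do rewrite big_nil; exact: within_continuousC.
have [Pi|nPi] := boolP (P i); last first.
  by under eq_fun do rewrite big_cons (negbTE nPi).
under eq_fun do rewrite big_cons Pi -[F i _]mul1r.
by apply: within_continuousZD => //; exact: cF.
Qed.

(** The common abstraction of volume, face and edge integrals. Linearity is asked for functions
    continuous on [D], whose integrability is at hand. *)
Record posfun (D : set vec) (I : (vec -> R) -> R) : Prop := PosFun {
  posfun_eq : forall u w : vec -> R, (forall x, D x -> u x = w x) -> I u = I w ;
  posfunZD : forall a (u w : vec -> R), {within D, continuous u} -> {within D, continuous w} ->
    I (fun x => a * u x + w x) = a * I u + I w ;
  posfun_ge0 : forall u : vec -> R, (forall x, D x -> 0 <= u x) -> 0 <= I u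
}.

Section posfun_theory.
Variables (D : set vec) (I : (vec -> R) -> R).
Hypothesis pI : posfun D I.
Implicit Types u w : vec -> R.

Lemma posfun0 : I (fun=> 0) = 0.
Proof.
have c0 : {within D, continuous (fun=> 0 : R)} by exact: within_continuousC.
have := posfunZD pI 1 c0 c0; rewrite !mul1r addr0.
by move=> /eqP; rewrite -subr_eq0 opprD addNKr oppr_eq0 => /eqP.
Qed.

Lemma posfunZ a u : {within D, continuous u} -> I (fun x => a * u x) = a * I u.
Proof.
move=> cu; rewrite -[RHS]addr0 -posfun0 -(posfunZD pI)//; last exact: within_continuousC.
by apply: (posfun_eq pI) => x _; rewrite addr0.
Qed.

Lemma posfunD u w : {within D, continuous u} -> {within D, continuous w} ->
  I (fun x => u x + w x) = I u + I w.
Proof.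
move=> cu cw; rewrite -[I u]mul1r -(posfunZD pI)//.
by apply: (posfun_eq pI) => x _; rewrite mul1r.
Qed.

Lemma posfun_sum J (r : seq J) (P : pred J) (F : J -> vec -> R) :
  (forall i, P i -> {within D, continuous (F i)}) ->
  I (fun x => \sum_(i <- r | P i) F i x) = \sum_(i <- r | P i) I (F i).
Proof.
move=> cF; elim: r => [|i r IH].
  by rewrite big_nil -[RHS]posfun0; apply: (posfun_eq pI) => x _; rewrite big_nil.
rewrite big_cons; have [Pi|nPi] := boolP (P i); last first.
  by rewrite -IH; apply: (posfun_eq pI) => x _; rewrite big_cons (negbTE nPi).
under eq_fun do rewrite big_cons Pi.
rewrite posfunD ?IH//; [exact: cF|exact: within_continuous_sum].
Qed.

(* The quadratic [t |-> I ((t u + w)^2)] is nonnegative and has no leading term. *)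
Lemma posfun_degenerate u w : {within D, continuous u} -> {within D, continuous w} ->
  I (fun x => w x * w x) = 0 -> I (fun x => u x * w x) = 0.
Proof.
move=> cu cw w0; set a := I _; pose b := I (fun x => u x * u x).
have Q t : 0 <= t * (2 * a) + b.
  have -> : t * (2 * a) + b = I (fun x => (t * w x + u x) * (t * w x + u x)).
    rewrite (posfun_eq pI (w := fun x => t ^+ 2 * (w x * w x) +
      (t * 2 * (u x * w x) + u x * u x))); last by move=> x _; ring.
    rewrite !(posfunZD pI); [|by do ?apply: within_continuousZD; exact: within_continuousM..].
    by rewrite w0 /a /b; ring.
  by apply: (posfun_ge0 pI) => x _; exact: sqr_ge0.
apply/eqP/negP => /negP a0; have := Q (- (b + 1) / (2 * a)).
rewrite divfK ?mulf_neq0 ?pnatr_eq0//; lra.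
Qed.

(** The Gram matrix may be singular, so its system is solved by consistency: a kernel vector gives a
    combination [w] whose square integrates to 0, and [posfun_degenerate] makes [u] orthogonal to
    [w]. *)
Lemma posfun_projection n (b : 'I_n -> vec -> R) (u : vec -> R) :
  (forall i, {within D, continuous (b i)}) -> {within D, continuous u} ->
  exists c : 'I_n -> R, forall j,
    I (fun x => (\sum_i c i * b i x) * b j x) = I (fun x => u x * b j x).
Proof.
move=> cb cu.
have cbb i j : {within D, continuous (fun x => b i x * b j x)} by exact: within_continuousM.
have cS (c : 'I_n -> R) : {within D, continuous (fun x => \sum_i c i * b i x)}.
  apply: within_continuous_sum => i _; apply: within_continuousM => //.
  exact: within_continuousC.
have IS (c : 'I_n -> R) w : {within D, continuous w} ->
    I (fun x => w x * \sum_i c i * b i x) = \sum_i c i * I (fun x => w x * b i x).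
  move=> cw; rewrite (posfun_eq pI (w := fun x => \sum_i c i * (w x * b i x))); last first.
    by move=> x _; rewrite mulr_sumr; apply: eq_bigr => i _; rewrite mulrCA.
  rewrite posfun_sum; last first.
    by move=> i _; apply: within_continuousM;
      [exact: within_continuousC|exact: within_continuousM].
  by apply: eq_bigr => i _; rewrite posfunZ//; exact: within_continuousM.
pose G : 'M[R]_n := \matrix_(i, j) I (fun x => b i x * b j x).
pose r : 'rV[R]_n := \row_j I (fun x => u x * b j x).
have rG : (r <= G)%MS.
  rewrite submxE; apply/eqP/rowP => l; rewrite [RHS]mxE.
  (* A column of the cokernel gives a [w] orthogonal to every [b i], and thus to itself. *)
  pose z i := cokermx G i l; pose w x := \sum_i z i * b i x.
  have Iw i : I (fun x => b i x * w x) = 0.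
    have := congr1 (fun M : 'M[R]_n => M i l) (mulmx_coker G).
    rewrite mxE [RHS]mxE => <-; rewrite IS//; apply: eq_bigr => k _.
    by rewrite [G _ _]mxE mulrC.
  have cw : {within D, continuous w} by exact: cS.
  have ww : I (fun x => w x * w x) = 0.
    rewrite {2}/w IS//; apply: big1 => i _.
    by rewrite (posfun_eq pI (w := fun x => b i x * w x)) ?Iw ?mulr0// => x _; rewrite mulrC.
  rewrite -[RHS](posfun_degenerate cu cw ww) IS// mxE.
  by apply: eq_bigr => k _; rewrite [r _ _]mxE mulrC.
exists (fun i => (r *m pinvmx G) 0 i) => j.
have := congr1 (fun M : 'rV[R]_n => M 0 j) (mulmxKpV rG).
rewrite mxE [RHS]mxE => <-.
rewrite (posfun_eq pI (w := fun x => b j x * \sum_i (r *m pinvmx G) 0 i * b i x)); last first.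
  by move=> x _; rewrite mulrC.
rewrite IS//; apply: eq_bigr => i _; rewrite [G _ _]mxE; congr (_ * _).
by apply: (posfun_eq pI) => x _; rewrite mulrC.
Qed.

End posfun_theory.

Lemma posfun_Rintegral d (X : measurableType d) (mu : {measure set X -> \bar R})
    (A : set X) (c : X -> vec) (D : set vec) : measurable A -> (forall p, A p -> D (c p)) ->
  (forall u, {within D, continuous u} -> mu.-integrable A (EFin \o (u \o c))) ->
  posfun D (fun u => \int[mu]_(p in A) u (c p)).
Proof.
move=> mA AD iD; split=> [u w uw|a u w cu cw|u u0].
- by apply: eq_Rintegral => p; rewrite inE => /AD/uw.
- rewrite RintegralD//; [|by apply: (iD (fun x => a * u x));
    apply: within_continuousM => //; exact: within_continuousC|exact: iD].
  by rewrite RintegralZl//; exact: iD.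
- by apply: Rintegral_ge0 => p /AD/u0.
Qed.

End positive_functionals.

Section polyhedron_functionals.
Context {R : realType}.
Local Notation vec := 'rV[R]_3.
Variables (T : polyhedron (R := R)) (o : frame T).

Lemma posfun_face f : posfun (face f) (int_face o f).
Proof.
by apply: posfun_Rintegral => //; [exact: measurable_face|exact: integrable_face].
Qed.

Lemma edge_point (e : edgeT T) (s : R) : s \in `[0, edge_len e] ->
  edge e (vpos (src e) + s *: edge_dir e).
Proof. by rewrite in_itv/= => s0; apply/edgeP; exists s. Qed.

Lemma within_continuous_edge (e : edgeT T) (u : vec -> R) : {within edge e, continuous u} ->
  {within `[0, edge_len e], continuous (fun s : R => u (vpos (src e) + s *: edge_dir e))}.
Proof.
move=> cu; have := within_continuous_comp (@line_continuous _ (vpos (src e)) (edge_dir e)) cu.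
by apply: continuous_subspaceW => s /= ?; exact: edge_point.
Qed.

Lemma posfun_edge (e : edgeT T) : posfun (edge e) (int_edge e).
Proof.
apply: (posfun_Rintegral (c := fun s : measurableTypeR R => vpos (src e) + s *: edge_dir e)).
- exact: measurable_itv.
- exact: edge_point.
- move=> u cu; apply: continuous_compact_integrable; first exact: segment_compact.
  exact: within_continuous_edge.
Qed.

Lemma posfun_body : posfun T (int_vol T).
Proof.
have -> : int_vol T = int_basis T (ei i0) (ei i1) (ei i2).
  by apply/funext => h; rewrite int_volE.
have o012 := @ei_orthonormal R.
apply: (posfun_Rintegral (c :=
    fun p : (measurableTypeR R * measurableTypeR R) * measurableTypeR R =>
   p.1.1 *: ei i0 + p.1.2 *: ei i1 + p.2 *: (ei i2 : vec))) => //.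
  apply: (measurable_preimage_compact (measurable_space (ei i0) (ei i1) (ei i2))).
  exact: body_compact.
exact: (integrable_body o012).
Qed.

End polyhedron_functionals.

(** * Calculus of polynomial functions *)

Section polynomials.
Context {R : realType}.
Local Notation vec := 'rV[R]_3.
Implicit Types (u w : vec -> R) (x d : vec) (j : nat).

Lemma grad_ei u x i : dot (grad u x) (ei i) = partial i u x.
Proof. by rewrite dotC dot_ei mxE. Qed.

Lemma poly_fun_partial j u i : poly_fun j u ->
  (forall x, differentiable u x) /\ poly_fun j (partial i u).
Proof.
(* Differentiability is carried along with the partial derivative, so one induction on polynomials
   yields both. *)
pose E u u' := forall x, differentiable u x /\ is_derive x (ei i) u (u' x).
suff PE : forall j u, poly_fun j u -> exists2 u', poly_fun j u' & E u u'.
  move=> /PE[u' pu' uu']; split=> [x|]; first by have [] := uu' x.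
  have -> // : partial i u = u'.
  by apply/funext => x; have [_ [_]] := uu' x.
apply: PolyFun.poly_fun_derivative.
- by move=> v v' w w' /funext <- /funext <-.
- by move=> c x; split; [exact: differentiable_cst|exact: is_derive_cst].
- move=> l x; have dl : differentiable (fun y : vec => y 0 l) x by exact: differentiable_coord.
  split=> //; split; first exact: diff_derivable.
  have @f : {linear vec -> R}.
    by exists (fun y : vec => y 0 l); do 2![eexists]; do ?[constructor];
      rewrite ?mxE// => ? *; rewrite ?mxE//; move=> ?; rewrite !mxE.
  rewrite deriveE// (_ : (fun y : vec => y 0 l) = f)// diff_lin; last exact: coord_continuous.
  by rewrite /= mxE eqxx eq_sym.
- move=> v v' w w' vE wE x; have [dv v'E] := vE x; have [dw w'E] := wE x.
  by split; [exact: differentiableD|exact: is_deriveD].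
- move=> v v' w w' vE wE x; have [dv v'E] := vE x; have [dw w'E] := wE x.
  split; first exact: differentiableM.
  by apply: is_derive_eq; rewrite addrC /GRing.scale/=; congr (_ + _); rewrite mulrC.
Qed.

Lemma poly_fun_differentiable j u x : poly_fun j u -> differentiable u x.
Proof. by move=> /(poly_fun_partial i0)[]. Qed.

Lemma poly_fun_continuous j u (D : set vec) : poly_fun j u -> {within D, continuous u}.
Proof.
move=> pu; apply: continuous_subspaceT => x.
by apply: differentiable_continuous; exact: poly_fun_differentiable pu.
Qed.

Lemma poly_funZ j a u : poly_fun j u -> poly_fun j (fun x => a * u x).
Proof.
move=> pu; have -> : (fun x => a * u x) = (fun x => a * u x + cst 0 x).
  by apply/funext => x; rewrite addr0.
by apply: PolyFun.poly_funZD => //; exact: poly_fun0.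
Qed.

Lemma poly_funD j u w : poly_fun j u -> poly_fun j w -> poly_fun j (fun x => u x + w x).
Proof.
move=> pu pw; have -> : (fun x => u x + w x) = (fun x => 1 * u x + w x).
  by apply/funext => x; rewrite mul1r.
exact: PolyFun.poly_funZD.
Qed.

Lemma poly_fun_sum j I (r : seq I) (P : pred I) (F : I -> vec -> R) :
  (forall i, P i -> poly_fun j (F i)) -> poly_fun j (fun x => \sum_(i <- r | P i) F i x).
Proof.
move=> pF; elim: r => [|i r IH].
  by under eq_fun do rewrite big_nil; exact: poly_fun0.
have [Pi|nPi] := boolP (P i); last first.
  by under eq_fun do rewrite big_cons (negbTE nPi).
by under eq_fun do rewrite big_cons Pi; apply: poly_funD => //; exact: pF.
Qed.

Lemma poly_fun_dot j (q : vec -> vec) d : poly_vec j q -> poly_fun j (fun x => dot (q x) d).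
Proof.
move=> pq; apply: poly_fun_sum => i _.
under eq_fun do rewrite mulrC; exact: poly_funZ (pq i).
Qed.

Lemma poly_fun_grad j u d : poly_fun j u -> poly_fun j (fun x => dot (grad u x) d).
Proof.
move=> pu; apply: (poly_fun_dot (q := grad u)) => i.
have -> : vcomp (grad u) i = partial i u by apply/funext => x; rewrite /vcomp mxE.
by case: (poly_fun_partial i pu).
Qed.

Lemma is_derive_mul (u w : vec -> R) x d (a b : R) : is_derive x d u a -> is_derive x d w b ->
  is_derive x d (fun y => u y * w y) (a * w x + u x * b).
Proof.
move=> ua wb; apply: is_derive_eq; rewrite addrC /GRing.scale/=.
by congr (_ + _); rewrite mulrC.
Qed.

End polynomials.

Section projections.
Context {R : realType}.
Local Notation vec := 'rV[R]_3.
Variable D : set vec.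

Lemma patch_cst0 {U : lmodType R} (u : vec -> U) x : D x -> patch (cst 0) D u x = u x.
Proof. by move=> Dx; rewrite /patch mem_set. Qed.

Lemma eq_the_elt {U : normedModType R} (W : set (vec -> U)) (Q Q' : (vec -> U) -> Prop) :
  (forall p, on D W p -> Q p <-> Q' p) -> the_elt D W Q = the_elt D W Q'.
Proof.
move=> QQ'; rewrite /the_elt; congr (xget _ _); apply/seteqP.
by split=> p [Wp Qp]; split=> //; apply/(QQ' _ Wp).
Qed.

(** The default value 0 of the choice is excluded by exhibiting a projection, extended by 0 outside
    [D]. Testing with a spanning family is enough by linearity. *)
Lemma L2proj_poly (I : (vec -> R) -> R) j (u q : vec -> R) :
  posfun D I -> {within D, continuous u} ->
  poly_fun j q ->
  I (fun x => L2proj D (poly_fun j) *%R I u x * q x) = I (fun x => u x * q x).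
Proof.
move=> pI cu pq; have [n [b [pb bspan]]] := PolyFun.poly_fun_span R j.
have cb i : {within D, continuous (b i)} by exact: poly_fun_continuous (pb i).
have [c cE] := posfun_projection pI cb cu.
pose p x := \sum_i c i * b i x.
have pp : poly_fun j p by apply: poly_fun_sum => i _; exact/poly_funZ/pb.
suff [_ ] : [set p | on D (poly_fun j) p /\ forall q, poly_fun j q ->
  I (fun x => p x * q x) = I (fun x => u x * q x)] (L2proj D (poly_fun j) *%R I u) by apply.
apply: (@xgetI _ _ _ (patch (cst 0) D p)); split; first by exists p.
move=> r /bspan[a aE].
have S (w : vec -> R) : {within D, continuous w} ->
    I (fun x => w x * r x) = \sum_i a i * I (fun x => w x * b i x).
  move=> cw; have cab i : {within D, continuous (fun x => w x * b i x)}.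
    exact: within_continuousM.
  rewrite (posfun_eq pI (w := fun x => \sum_i a i * (w x * b i x))); last first.
    by move=> x _; rewrite aE mulr_sumr; apply: eq_bigr => i _; rewrite mulrCA.
  rewrite (posfun_sum pI); last first.
    by move=> i _; apply: within_continuousM => //; exact: within_continuousC.
  by apply: eq_bigr => i _; rewrite (posfunZ pI).
rewrite (posfun_eq pI (w := fun x => p x * r x)); last by move=> x /patch_cst0 ->.
rewrite !S//; last exact: poly_fun_continuous pp.
by apply: eq_bigr => i _; rewrite -cE.
Qed.

End projections.

(** * Integration by parts *)

Section cross_product.
Context {R : realType}.
Local Notation vec := 'rV[R]_3.
Implicit Types a b c : vec.

Lemma vec_ext a b : a 0 i0 = b 0 i0 -> a 0 i1 = b 0 i1 -> a 0 i2 = b 0 i2 -> a = b.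
Proof. by move=> ? ? ?; apply/rowP; exact: ord3P. Qed.

Let addE a b i : (a + b) 0 i = a 0 i + b 0 i. Proof. by rewrite mxE. Qed.
Let oppE a i : (- a) 0 i = - a 0 i. Proof. by rewrite mxE. Qed.
Let scaleE s a i : (s *: a) 0 i = s * a 0 i. Proof. by rewrite mxE. Qed.
Let vecE := (addE, oppE, scaleE, @dotE R, @vec3E R).

Lemma crossDl a b c : cross (a + b) c = cross a c + cross b c.
Proof. by apply: vec_ext; rewrite /cross !vecE; ring. Qed.

Lemma crossZl s a b : cross (s *: a) b = s *: cross a b.
Proof. by apply: vec_ext; rewrite /cross !vecE; ring. Qed.

Lemma cross_crossl a b c : cross (cross a b) c = dot a c *: b - dot b c *: a.
Proof. by apply: vec_ext; rewrite /cross !vecE; ring. Qed.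

Lemma cross_crossr a b c : cross a (cross b c) = dot a c *: b - dot a b *: c.
Proof. by apply: vec_ext; rewrite /cross !vecE; ring. Qed.

Lemma partial_tangential (u1 u2 : vec -> R) (t1 t2 : vec) i l x :
  differentiable u1 x -> differentiable u2 x ->
  partial i (vcomp (fun y => u1 y *: t1 + u2 y *: t2) l) x =
  grad u1 x 0 i * t1 0 l + grad u2 x 0 i * t2 0 l.
Proof.
move=> du1 du2.
have -> : vcomp (fun y => u1 y *: t1 + u2 y *: t2) l = (fun y => u1 y * t1 0 l + u2 y * t2 0 l).
  by apply/funext => y; rewrite /vcomp !mxE.
have D (u : vec -> R) (c : R) : differentiable u x ->
    is_derive x (ei i) (fun y => u y * c) (grad u x 0 i * c).
  move=> /(is_derive_grad (ei i)) uE; have := is_derive_mul uE (is_derive_cst c x (ei i)).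
  by rewrite mulr0 addr0 dotC dot_ei.
by have [_] := is_deriveD (D _ (t1 0 l) du1) (D _ (t2 0 l) du2).
Qed.

(** For constant [t] the curl of [u t] is the cross product of [grad u] and [t], and the triple
    product moves the cross to [t] and [n]. With [n] normal to the face only tangential derivatives
    of the coefficients remain. *)
Lemma curl_tangential (u1 u2 : vec -> R) (t1 t2 n : vec) x :
  differentiable u1 x -> differentiable u2 x ->
  dot (curl (fun y => u1 y *: t1 + u2 y *: t2) x) n =
  dot (grad u1 x) (cross t1 n) + dot (grad u2 x) (cross t2 n).
Proof.
move=> du1 du2; rewrite !dotE /curl /cross !vec3E !partial_tangential//; ring.
Qed.

End cross_product.

(** * Integration by parts on the body, its faces and its edges *)

Section commutation.
Context {R : realType}.
Local Notation vec := 'rV[R]_3.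
Variables (T : polyhedron (R := R)) (o : frame T).
Implicit Types (f : faceT T) (e : edgeT T).

Lemma edge_in_face e : exists f, e \in face_edges f.
Proof.
have : (0 < #|[set f | e \in face_edges f]%SET|)%N by rewrite edge_two_faces.
by rewrite card_gt0 => /set0Pn[f]; rewrite inE; exists f.
Qed.

Lemma edge_body e : edge e `<=` T.
Proof.
by have [f ef] := edge_in_face e; exact: subset_trans (edge_face ef) (@face_body _ _ f).
Qed.

(** The body is the closure of its interior, so the limit at [x] is taken along a proper filter and
    is unique. *)
Lemma grad_on_eq (v : vec -> R) (g : vec -> vec) x : {within T, continuous g} ->
  (forall y, (T : set vec)° y -> g y = grad v y) -> (T : set vec) x -> grad_on T v x = g x.
Proof.
move=> cg gE Tx; have Tcx : closure (T : set vec)° x by rewrite -body_regular.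
have FF : ProperFilter (within (T : set vec)° (nbhs x)) := within_nbhs_proper Tcx.
apply: cvg_lim; first exact: norm_hausdorff.
have gx : g y @[y --> within (T : set vec) (nbhs x)] --> g x.
  by have := cg x; rewrite /continuous_at nbhs_subspace_in.
move=> U /gx; rewrite /nbhs/= /within/= => TU.
near=> y => Ty; rewrite -gE//; apply: (near TU y) => //; exact: interior_subset.
Unshelve. all: by end_near.
Qed.

Variables (v : vec -> R) (g : vec -> vec).
Hypotheses (cv : {within T, continuous v}) (cg : {within T, continuous g}).
Hypothesis dv : forall x, (T : set vec)° x -> differentiable v x.
Hypothesis gE : forall x, (T : set vec)° x -> g x = grad v x.

Lemma divergence_theorem j (phi : vec -> vec) : poly_vec j phi ->
  int_vol T (fun x => dot (g x) (phi x)) =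
  - int_vol T (fun x => v x * div phi x) +
  \sum_f int_face o f (fun x => v x * dot (phi x) (nout f)).
Proof.
move=> pphi; have pI := posfun_body T.
have cphi i (D : set vec) : {within D, continuous (vcomp phi i)}.
  exact: poly_fun_continuous (pphi i).
have cpart i (D : set vec) : {within D, continuous (partial i (vcomp phi i))}.
  by case: (poly_fun_partial i (pphi i)) => _; exact: poly_fun_continuous.
have cgi i : {within T, continuous (fun x => g x 0 i)}.
  have -> : (fun x => g x 0 i) = (fun x => dot (g x) (ei i)).
    by apply/funext => x; rewrite dotC dot_ei.
  exact: within_continuous_dot.
(* The derivative of [v] times the component [i] of [phi], in direction [ei i]. *)
pose h i x := g x 0 i * vcomp phi i x + v x * partial i (vcomp phi i) x.
have ch i : {within T, continuous (h i)}.
  rewrite /h; under eq_fun do rewrite -[g _ _ _ * _]mul1r.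
  by apply: within_continuousZD; exact: within_continuousM.
have E i : int_vol T (h i) =
    \sum_f int_face o f (fun x => v x * (vcomp phi i x * dot (nout f) (ei i))).
  apply: (@etrans _ _ (\sum_f dot (nout f) (ei i) * int_face o f (fun x => v x * vcomp phi i x))).
    apply: int_vol_direction => //; first exact: within_continuousM.
    move=> x Tx; apply: is_derive_mul.
      by rewrite -dot_ei dotC; exact: (is_derive_body dv gE).
    by rewrite -grad_ei; exact/is_derive_grad/(poly_fun_differentiable _ (pphi i)).
  apply: eq_bigr => f _; have cvf : {within face f, continuous v}.
    by apply: continuous_subspaceW cv; exact: face_body.
  rewrite -(posfunZ (posfun_face o f)); last exact: within_continuousM.
  by apply: (posfun_eq (posfun_face o f)) => x _; ring.
have cvdiv : {within T, continuous (fun x => v x * div phi x)}.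
  by apply: within_continuousM => //; apply: within_continuous_sum.
have cgphi : {within T, continuous (fun x => dot (g x) (phi x))}.
  by apply: within_continuous_sum => i _; apply: within_continuousM => //; exact: cphi.
apply/eqP; rewrite eq_sym addrC subr_eq eq_sym -(posfunD pI)//; apply/eqP.
rewrite (posfun_eq pI (w := fun x => \sum_i h i x)); last first.
  move=> x _; rewrite /dot /div mulr_sumr -big_split/=.
  by apply: eq_bigr => i _.
rewrite (posfun_sum pI)//; under eq_bigr do rewrite E.
rewrite exchange_big/=; apply: eq_bigr => f _.
have cvf : {within face f, continuous v}.
  by apply: continuous_subspaceW cv; exact: face_body.
have pf := posfun_face o f.
rewrite -(posfun_sum pf).
  apply: (posfun_eq pf) => x _; rewrite -mulr_sumr; congr (_ * _).
  by apply: eq_bigr => i _; rewrite dotC dot_ei.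
move=> i _; apply: within_continuousM => //; apply: within_continuousM => //.
exact: within_continuousC.
Qed.

Lemma fundamental_theorem_edge e j (phi : vec -> R) : poly_fun j phi ->
  int_edge e (fun x => dot (g x) (te o e) * phi x) =
  - int_edge e (fun x => v x * dot (grad phi x) (te o e)) +
  (v (vpos (tgt e)) * (phi (vpos (tgt e)) * dot (te o e) (edge_dir e)) +
   v (vpos (src e)) * (phi (vpos (src e)) * dot (te o e) (- edge_dir e))).
Proof.
move=> pphi; have pI := posfun_edge e.
(* The fixed tangent may run against the parametrization of the edge; both sides are linear in the
   sign [s]. *)
have [s [s1 teE]] : exists s, s ^+ 2 = 1 /\ te o e = s *: edge_dir e.
  have [->|->] := te_tangent o e; first by exists 1; rewrite scale1r expr1n.
  by exists (-1); rewrite scaleN1r sqrrN expr1n.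
have [f ef] := edge_in_face e; have eT := @edge_body e.
have cve : {within edge e, continuous v} := continuous_subspaceW eT cv.
have cphi : {within edge e, continuous phi} := poly_fun_continuous pphi.
have cgd : {within edge e, continuous (fun x => dot (g x) (edge_dir e))}.
  by apply: (continuous_subspaceW eT); exact: within_continuous_dot.
have cphid : {within edge e, continuous (fun x => dot (grad phi x) (edge_dir e))}.
  by have := poly_fun_grad (edge_dir e) pphi; exact: poly_fun_continuous.
pose w x := v x * phi x.
pose h x := dot (g x) (edge_dir e) * phi x + v x * dot (grad phi x) (edge_dir e).
have cw : {within edge e, continuous w} by exact: within_continuousM.
have c1 := within_continuousM cgd cphi; have c2 := within_continuousM cve cphid.
have ch : {within edge e, continuous h}.
  rewrite /h; under eq_fun do rewrite -[dot (g _) _ * _]mul1r.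
  exact: within_continuousZD.
have hE : int_edge e h = w (vpos (tgt e)) - w (vpos (src e)).
  pose F t := w (vpos (src e) + t *: edge_dir e).
  have -> : w (vpos (tgt e)) - w (vpos (src e)) = F (edge_len e) - F 0.
    by rewrite /F scale0r addr0 -edge_vecE [vpos (src e) + _]addrC subrK.
  apply: Rintegral_FTC; first exact: edge_len_gt0.
  - exact: within_continuous_edge.
  - exact: within_continuous_edge.
  - move=> t t0; apply: is_derive_line; apply: is_derive_mul.
      apply: (is_derive_edge o cv cg dv gE ef).
      by apply/open_segmentP; exists t.
    by apply: is_derive_grad; exact: poly_fun_differentiable pphi.
rewrite teE.
have -> : int_edge e (fun x => dot (g x) (s *: edge_dir e) * phi x) =
    s * int_edge e (fun x => dot (g x) (edge_dir e) * phi x).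
  by rewrite -(posfunZ pI)//; apply: (posfun_eq pI) => x _; rewrite (dotZr s) mulrA.
have -> : int_edge e (fun x => v x * dot (grad phi x) (s *: edge_dir e)) =
    s * int_edge e (fun x => v x * dot (grad phi x) (edge_dir e)).
  by rewrite -(posfunZ pI)//; apply: (posfun_eq pI) => x _; rewrite (dotZr s) mulrCA.
move: hE; rewrite /h (posfunD pI)// /w dotNr (dotZl s) edge_dir1 => hE.
by move/(congr1 ( *%R s)): hE; rewrite mulrDr => /eqP; rewrite -subr_eq0 => /eqP hE;
  apply/eqP; rewrite -subr_eq0; apply/eqP; rewrite -[RHS]hE; ring.
Qed.


Lemma W2f_cross f k theta : W2f o k f theta ->
  W2f o k f (fun x => cross (theta x) (nf o f)).
Proof.
move=> [u1 [u2 [pu1 pu2 ->]]]; have of_ := dot_tf o f.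
have D (t : vec) : cross t (nf o f) = dot (cross t (nf o f)) (tf1 o f) *: tf1 o f +
    dot (cross t (nf o f)) (tf2 o f) *: tf2 o f.
  rewrite {1}(orthonormal_decomp (cross t (nf o f)) of_) dot_crossr scale0r addr0.
  by rewrite ![dot (cross _ _) _]dotC.
pose d1 := cross (tf1 o f) (nf o f); pose d2 := cross (tf2 o f) (nf o f).
exists (fun x => dot d1 (tf1 o f) * u1 x + dot d2 (tf1 o f) * u2 x),
  (fun x => dot d1 (tf2 o f) * u1 x + dot d2 (tf2 o f) * u2 x); split.
- by apply: PolyFun.poly_funZD => //; exact: poly_funZ.
- by apply: PolyFun.poly_funZD => //; exact: poly_funZ.
apply/funext => x; rewrite crossDl !crossZl (D (tf1 o f)) (D (tf2 o f)) -/d1 -/d2.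
rewrite !scalerDr !scalerDl !scalerA addrACA.
by rewrite ![u1 x * _]mulrC ![u2 x * _]mulrC.
Qed.

(* Crossing with [n_f] is a quarter turn of the plane of [f]. *)
Lemma W2f_crossK f k theta x : W2f o k f theta ->
  cross (cross (theta x) (nf o f)) (nf o f) = - theta x.
Proof.
move=> [u1 [u2 [_ _ ->]]]; have [[_ _ n1] [_ t1n t2n]] := dot_tf o f.
by rewrite cross_crossl dotDl !dotZl t1n t2n n1 !mulr0 addr0 scale0r scale1r sub0r.
Qed.

(** Both sides are linear in [d], and a tangential [d] is a combination of the two tangents of the
    frame. *)
Lemma green_theorem f j (u : vec -> R) d : poly_fun j u -> dot (nf o f) d = 0 ->
  int_face o f (fun x => dot (g x) d * u x + v x * dot (grad u x) d) =
  \sum_(e in face_edges f) dot (conormal o f e) d * int_edge e (fun x => v x * u x).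
Proof.
move=> pu nd; have of_ := dot_tf o f; have pI := posfun_face o f.
have dE y : dot y d = dot d (tf1 o f) * dot y (tf1 o f) + dot d (tf2 o f) * dot y (tf2 o f).
  rewrite (dot_decomp y d of_) nd ?mulr0 ?mul0r addr0.
  by rewrite !(dotC (tf1 o f)) !(dotC (tf2 o f)); ring.
have cvf : {within face f, continuous v}.
  by apply: continuous_subspaceW cv; exact: face_body.
have cu : {within face f, continuous u} := poly_fun_continuous pu.
pose H t x := dot (g x) t * u x + v x * dot (grad u x) t.
have cH t : {within face f, continuous (H t)}.
  rewrite /H; under eq_fun do rewrite -[dot (g _) _ * _]mul1r.
  have cg' : {within face f, continuous (fun x => dot (g x) t)}.
    by apply: (continuous_subspaceW (@face_body _ _ f)); exact: within_continuous_dot.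
  have cgu : {within face f, continuous (fun x => dot (grad u x) t)}.
    by have := poly_fun_grad t pu; exact: poly_fun_continuous.
  by apply: within_continuousZD; exact: within_continuousM.
have cw : {within face f, continuous (fun x => v x * u x)} by exact: within_continuousM.
have dH t x : rel_interior (nout f) (face f) x -> dot (nf o f) t = 0 ->
    is_derive x t (fun y => v y * u y) (H t x).
  move=> fx nt; apply: is_derive_mul; first exact: (is_derive_face cv cg dv gE fx (dot_nout nt)).
  exact/is_derive_grad/(poly_fun_differentiable _ pu).
rewrite (posfun_eq pI (w := fun x => dot d (tf1 o f) * H (tf1 o f) x +
    (dot d (tf2 o f) * H (tf2 o f) x))); last first.
  by move=> x _; rewrite (dE (g x)) (dE (grad u x)) /H; ring.
rewrite (posfunZD pI)//; last first.
  by apply: within_continuousM => //; exact: within_continuousC.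
rewrite (posfunZ pI)//.
rewrite (_ : int_face o f (H (tf1 o f)) = \sum_(e in face_edges f)
    dot (conormal o f e) (tf1 o f) * int_edge e (fun x => v x * u x)); last first.
  by apply: int_face_tf1 => // x fx; apply: dH => //; exact: tf1_tangent.
rewrite (_ : int_face o f (H (tf2 o f)) = \sum_(e in face_edges f)
    dot (conormal o f e) (tf2 o f) * int_edge e (fun x => v x * u x)); last first.
  by apply: int_face_tf2 => // x fx; apply: dH => //; exact: tf2_tangent.
rewrite !mulr_sumr -big_split/=; apply: eq_bigr => e _.
by rewrite (dE (conormal o f e)); ring.
Qed.

(** Green's theorem is applied to each coefficient of [theta], in the direction of its tangent
    crossed with the normal. *)
Lemma stokes_theorem f k theta : W2f o k f theta ->
  int_face o f (fun x => dot (g x) (cross (theta x) (nf o f))) =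
  - int_face o f (fun x => v x * dot (curl theta x) (nf o f)) +
  \sum_(e in face_edges f) int_edge e (fun x => v x * dot (theta x) (tbd o f e)).
Proof.
move=> [u1 [u2 [pu1 pu2 ->]]]; have pI := posfun_face o f.
have [[_ _ n1] [_ t1n t2n]] := dot_tf o f.
have cvf : {within face f, continuous v}.
  by apply: continuous_subspaceW cv; exact: face_body.
pose d1 := cross (tf1 o f) (nf o f); pose d2 := cross (tf2 o f) (nf o f).
have nd t : dot (nf o f) (cross t (nf o f)) = 0 by exact: dot_crossr.
have cd u d : poly_fun (k - 2) u -> {within face f, continuous (fun x => dot (grad u x) d)}.
  by move=> pu; have := poly_fun_grad d pu; exact: poly_fun_continuous.
have cgd d : {within face f, continuous (fun x => dot (g x) d)}.
  by apply: (continuous_subspaceW (@face_body _ _ f)); exact: within_continuous_dot.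
have cu u : poly_fun (k - 2) u -> {within face f, continuous u} by exact: poly_fun_continuous.
pose H u d x := dot (g x) d * u x + v x * dot (grad u x) d.
have cH u d : poly_fun (k - 2) u -> {within face f, continuous (H u d)}.
  move=> pu; rewrite /H; under eq_fun do rewrite -[dot (g _) _ * _]mul1r.
  apply: within_continuousZD; apply: within_continuousM => //; [exact: cu|exact: cd].
have cvcurl : {within face f, continuous
    (fun x => v x * (dot (grad u1 x) d1 + dot (grad u2 x) d2))}.
  apply: within_continuousM => //; under eq_fun do rewrite -[dot (grad u1 _) _]mul1r.
  by apply: within_continuousZD; exact: cd.
apply/eqP; rewrite eq_sym addrC subr_eq eq_sym; apply/eqP.
rewrite (posfun_eq pI (u := fun x => v x * _)
  (w := fun x => v x * (dot (grad u1 x) d1 + dot (grad u2 x) d2))); last first.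
  by move=> x _; rewrite curl_tangential//;
    [exact: poly_fun_differentiable pu1|exact: poly_fun_differentiable pu2].
rewrite (posfun_eq pI (u := fun x => dot _ _) 
  (w := fun x => dot (g x) d1 * u1 x + dot (g x) d2 * u2 x)); last first.
  move=> x _; rewrite crossDl !crossZl dotDr !dotZr -/d1 -/d2.
  by rewrite ![u1 x * _]mulrC ![u2 x * _]mulrC.
rewrite -(posfunD pI)//; last first.
  under eq_fun do rewrite -[dot (g _) d1 * _]mul1r.
  by apply: within_continuousZD; apply: within_continuousM => //; exact: cu.
rewrite (posfun_eq pI (w := fun x => H u1 d1 x + H u2 d2 x)); last first.
  by move=> x _; rewrite /H; ring.
rewrite (posfunD pI); [|exact: cH|exact: cH].
rewrite /H (green_theorem pu1 (nd _)) (green_theorem pu2 (nd _)) -big_split/=.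
apply: eq_bigr => e ef; have pe := posfun_edge e.
have ce u : poly_fun (k - 2) u -> {within edge e, continuous (fun x => v x * u x)}.
  move=> pu; apply: within_continuousM; last exact: poly_fun_continuous pu.
  by apply: (continuous_subspaceW (edge_face ef)).
(* The conormal is the boundary tangent crossed with the unit normal. Crossing both factors with
   this normal preserves the dot product of tangential vectors, so the boundary tangent
   reappears. *)
have cE t : dot t (nf o f) = 0 -> dot (conormal o f e) (cross t (nf o f)) = dot (tbd o f e) t.
  by move=> tn; rewrite cross_lagrange n1 [dot (nf o f) t]dotC tn; ring.
rewrite !cE// -(posfunZ pe); last exact: ce.
rewrite -(posfunZ pe); last exact: ce.
have cZ a u : poly_fun (k - 2) u -> {within edge e, continuous (fun x => a * (v x * u x))}.
  by move=> pu; apply: within_continuousM; [exact: within_continuousC|exact: ce].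
rewrite -(posfunD pe); [|exact: cZ|exact: cZ].
by apply: (posfun_eq pe) => x _; rewrite dotDl !dotZl !(dotC (tbd o f e)); ring.
Qed.

End commutation.

(** * The commutation identity *)

Lemma eq_W2 (R : realType) (T : polyhedron (R := R)) (o : frame T) k (a b : W2 o k) :
  u0 a = u0 b -> uf a = uf b -> ue a = ue b -> a = b.
Proof.
case: a b => [a0 af ae A0 Af Ae] [b0 bf be B0 Bf Be] /= E0 Ef Ee.
by subst; congr mkW2; exact: Prop_irrelevance.
Qed.

Theorem lemma5p1 (R : realType) (T : polyhedron (R := R)) (o : frame T)
    (k : nat) (hk : (3 <= k)%N) (v : 'rV[R]_3 -> R)
    (hH1 : H1_on T v) (hC1 : C1_on T v) :
  wgrad o (Rh1 o k v) = Rh2 o k (grad_on T v).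
Proof.
have [cv dv [g cg gE]] := hC1.
have gT x : (T : set 'rV[R]_3) x -> grad_on T v x = g x := grad_on_eq cg gE.
have cvf (f : faceT T) : {within face f, continuous v}.
  by apply: continuous_subspaceW cv; exact: face_body.
have cve (e : edgeT T) : {within edge e, continuous v} :=
  continuous_subspaceW (@edge_body _ T e) cv.
have k1 : (k - 1 <= k)%N by exact: leq_subr.
have k21 : (k - 2 <= k - 1)%N by exact: leq_sub2l.
have k32 : (k - 3 <= k - 2)%N by exact: leq_sub2l.
apply: eq_W2.
- have pI := posfun_body T; apply: eq_the_elt => p _.
  have E phi : poly_vec (k - 1) phi ->
      - int_vol T (fun x => v0 (Rh1 o k v) x * div phi x) +
      \sum_f int_face o f (fun x => vf (Rh1 o k v) f x * dot (phi x) (nout f)) =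
      int_vol T (fun x => dot (grad_on T v x) (phi x)).
    move=> pphi; rewrite [RHS](posfun_eq pI (w := fun x => dot (g x) (phi x))); last first.
      by move=> x Tx; rewrite gT.
    rewrite (divergence_theorem o cv cg dv gE pphi); congr (- _ + _).
      apply: (L2proj_poly pI cv); apply: (PolyFun.poly_funW k1).
      by apply: poly_fun_sum => i _; case: (poly_fun_partial i (pphi i)).
    apply: eq_bigr => f _; apply: (L2proj_poly (posfun_face o f) (cvf f)).
    exact: poly_fun_dot.
  by split=> Ep phi pphi; rewrite Ep// E.
- apply/funext => f; have pI := posfun_face o f; apply: eq_the_elt => p _.
  have E theta : W2f o k f theta ->
      - int_face o f (fun x => vf (Rh1 o k v) f x * dot (curl theta x) (nf o f)) +
      \sum_(e in face_edges f)
        int_edge e (fun x => ve (Rh1 o k v) e x * dot (theta x) (tbd o f e)) =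
      int_face o f (fun x => dot (cross (nf o f) (cross (grad_on T v x) (nf o f)))
        (cross (theta x) (nf o f))).
    move=> W; rewrite [RHS](posfun_eq pI (w := fun x =>
        dot (g x) (cross (theta x) (nf o f)))); last first.
      (* The gradient and its tangential part have the same dot product with a tangential field. *)
      move=> x /face_body Tx; rewrite gT// cross_crossr dotBl !dotZl nf1 mul1r.
      by rewrite dot_crossr mulr0 subr0.
    rewrite (stokes_theorem cv cg dv gE W).
    have [u1 [u2 [pu1 pu2 thetaE]]] := W; congr (- _ + _).
      apply: (L2proj_poly pI (cvf f)); apply: (PolyFun.poly_funW k21).
      have -> : (fun x => dot (curl theta x) (nf o f)) = (fun x =>
          dot (grad u1 x) (cross (tf1 o f) (nf o f)) +
          dot (grad u2 x) (cross (tf2 o f) (nf o f))).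
        apply/funext => x; rewrite thetaE curl_tangential//;
          [exact: poly_fun_differentiable pu1|exact: poly_fun_differentiable pu2].
      by apply: poly_funD; exact: poly_fun_grad.
    (* No derivative falls on [theta] here: its degree [k - 2] is exactly that of the edge
       component. *)
    apply: eq_bigr => e _; apply: (L2proj_poly (posfun_edge e) (cve e)).
    have -> : (fun x => dot (theta x) (tbd o f e)) = (fun x =>
        dot (tf1 o f) (tbd o f e) * u1 x + dot (tf2 o f) (tbd o f e) * u2 x).
      by apply/funext => x; rewrite thetaE dotDl !dotZl ![_ * dot _ _]mulrC.
    by apply: PolyFun.poly_funZD => //; exact: poly_funZ.
  split=> Ep q Wq; last by rewrite Ep ?E//; exact: W2f_cross.
  (* The weak gradient tests with [theta] crossed with the normal, the projection with any [q].
     Three quarter turns of [q] give a [theta] that a fourth turns back into [q]. *)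
  pose theta x := cross (cross (cross (q x) (nf o f)) (nf o f)) (nf o f).
  have W : W2f o k f theta by do 3!apply: W2f_cross.
  have qE : q = fun x => cross (theta x) (nf o f).
    apply/funext => x; rewrite (W2f_crossK _ (W2f_cross (W2f_cross Wq))).
    by rewrite (W2f_crossK _ Wq) opprK.
  by rewrite qE Ep// E.
- apply/funext => e; have pI := posfun_edge e; apply: eq_the_elt => p _.
  have te1 : dot (te o e) (te o e) = 1.
    by case: (te_tangent o e) => ->; rewrite ?dotNl ?dotNr ?opprK edge_dir1.
  have E phi : poly_fun (k - 3) phi ->
      - int_edge e (fun x => ve (Rh1 o k v) e x * dot (grad phi x) (te o e)) +
      (vn (Rh1 o k v) (tgt e) * (phi (vpos (tgt e)) * dot (te o e) (edge_dir e)) +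
       vn (Rh1 o k v) (src e) * (phi (vpos (src e)) * dot (te o e) (- edge_dir e))) =
      int_edge e (fun x => dot (dot (grad_on T v x) (te o e) *: te o e) (phi x *: te o e)).
    move=> pphi; rewrite [RHS](posfun_eq pI (w := fun x => dot (g x) (te o e) * phi x)); last first.
      by move=> x /edge_body Tx; rewrite gT// dotZl dotZr te1 mulr1.
    rewrite (fundamental_theorem_edge o cv cg dv gE e pphi); congr (- _ + _).
    apply: (L2proj_poly pI (cve e)); apply: (PolyFun.poly_funW k32).
    exact: poly_fun_grad.
  split=> Ep; first by move=> _ [phi pphi ->]; rewrite Ep// E.
  by move=> phi pphi; rewrite E// Ep//; exists phi.
Qed.
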